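(* Assume (A1)–(A3) and $N\geq \max\{1,\|f\|_\infty/2\}$, and let $v^h$ and $v$ be as in the context. Then $v(t,\cdot)$ is uniformly semi-concave for all $t\in[0,T]$. Moreover, for each $t\in[0,T]$ and for a.e. $x\in\mathbb{R}^d$, \[ \alpha(t_h,x_h,\nabla^h v^h(t_h,x_h))\to \alpha(t,x,\nabla v(t,x))\quad\text{as }h\to0, \] whenever $[0,T]\times\mathbb{R}^d\ni (t_h,x_h)\to(t,x)$ as $h\to0$.
   Context: Let $d,m\ge1$, $T\ge 1$, $A\subset\mathbb{R}^m$ compact, $c:[0,T]\times\mathbb{R}^d\times A\to\mathbb{R}$, $f:[0,T]\times\mathbb{R}^d\times A\to\mathbb{R}^d$, $q:\mathbb{R}^d\to\mathbb{R}$. Let $\alpha(t,x,p)=\operatorname{argmin}_{a\in A}[c(t,x,a)+p\cdot f(t,x,a)]$, assumed to be the unique minimizer, and $H(t,x,p)=\min_{a\in A}[c(t,x,a)+p\cdot f(t,x,a)]$. A function $g:\mathbb{R}^d\to\mathbb{R}$ is uniformly semi-concave if there is $C>0$ with $g(x+y)+g(x-y)-2g(x)\le C|y|^2$ for all $x,y$. Assumptions: (A1) $c,f,q$ are uniformly bounded and Lipschitz continuous in all their variables; (A2) $\alpha(\cdot,\cdot,\cdot)$ and a given continuous initial policy $\alpha_0$ are uniformly Lipschitz continuous in all their variables; (A3) $q$ is uniformly semi-concave, and $c(t,\cdot,a)$, $f(t,\cdot,a)$ are bounded in $W^{2,\infty}(\mathbb{R}^d)$ uniformly in $t\in[0,T]$,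 $a\in A$. For $\varphi:\mathbb{R}^d\to\mathbb{R}$, $h\in(0,1)$: $\nabla^h\varphi(x)=\big(\frac{\varphi(x+he_i)-\varphi(x-he_i)}{2h}\big)_{i=1}^d$, $\Delta^h\varphi(x)=\sum_{i=1}^d\frac{\varphi(x+he_i)-2\varphi(x)+\varphi(x-he_i)}{h^2}$ (acting in $x$). $v^h$ solves $\partial_t v^h+H(t,x,\nabla^h v^h)=-Nh\Delta^h v^h$ in $(0,T)\times\mathbb{R}^d$, $v^h(T,x)=q(x)$; $v$ is the viscosity solution of $\partial_t v+H(t,x,\nabla v)=0$ in $(0,T)\times\mathbb{R}^d$, $v(T,x)=q(x)$. *)

(* Defs.v *)
From HB Require Import structures.
From mathcomp Require Import all_boot all_order all_algebra.
From mathcomp Require Import all_classical all_reals all_analysis.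
Set Implicit Arguments. Unset Strict Implicit. Unset Printing Implicit Defensive.
Import Order.TTheory GRing.Theory Num.Theory.
Import numFieldNormedType.Exports.
Local Open Scope classical_set_scope.
Local Open Scope ring_scope.

Section Defs.
Variable R : realType.

Definition evec (d : nat) (i : 'I_d) : 'rV[R]_d := delta_mx 0 i.

Definition dotv (d : nat) (p y : 'rV[R]_d) : R := \sum_(i < d) p 0 i * y 0 i.
Definition enorm (d : nat) (y : 'rV[R]_d) : R := Num.sqrt (dotv y y).

Definition semiconcave (d : nat) (g : 'rV[R]_d -> R) : Prop :=
  exists C : R, 0 < C /\ forall x y : 'rV[R]_d,
    g (x + y) + g (x - y) - 2 * g x <= C * (enorm y) ^+ 2.

Definition gradh (d : nat) (h : R) (phi : 'rV[R]_d -> R) (x : 'rV[R]_d) : 'rV[R]_d :=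
  \row_(i < d) ((phi (x + h *: evec i) - phi (x - h *: evec i)) / (2 * h)).
Definition laplh (d : nat) (h : R) (phi : 'rV[R]_d -> R) (x : 'rV[R]_d) : R :=
  \sum_(i < d) ((phi (x + h *: evec i) - 2 * phi x + phi (x - h *: evec i)) / (h ^+ 2)).

Definition partial (d : nat) (i : 'I_d) (g : 'rV[R]_d -> R) (x : 'rV[R]_d) : R :=
  'D_(evec i) g x.
Definition grad (d : nat) (g : 'rV[R]_d -> R) (x : 'rV[R]_d) : 'rV[R]_d :=
  \row_(i < d) partial i g x.

Definition Ham (d m : nat) (A : set 'rV[R]_m)
  (c : R -> 'rV[R]_d -> 'rV[R]_m -> R) (f : R -> 'rV[R]_d -> 'rV[R]_m -> 'rV[R]_d)
  (t : R) (x p : 'rV[R]_d) : R :=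
  inf [set c t x a + dotv p (f t x a) | a in A].

Definition is_unique_argmin (d m : nat) (T : R) (A : set 'rV[R]_m)
  (c : R -> 'rV[R]_d -> 'rV[R]_m -> R) (f : R -> 'rV[R]_d -> 'rV[R]_m -> 'rV[R]_d)
  (alpha : R -> 'rV[R]_d -> 'rV[R]_d -> 'rV[R]_m) : Prop :=
  forall t x p, 0 <= t <= T ->
    A (alpha t x p) /\
    forall a, A a -> a != alpha t x p ->
      c t x (alpha t x p) + dotv p (f t x (alpha t x p)) < c t x a + dotv p (f t x a).

Definition assumption_A1 (d m : nat) (T : R) (A : set 'rV[R]_m)
  (c : R -> 'rV[R]_d -> 'rV[R]_m -> R) (f : R -> 'rV[R]_d -> 'rV[R]_m -> 'rV[R]_d)
  (q : 'rV[R]_d -> R) : Prop :=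
  exists M L : R,
    (forall t x a, 0 <= t <= T -> A a -> `|c t x a| <= M /\ enorm (f t x a) <= M) /\
    (forall x, `|q x| <= M) /\
    (forall t s x y a b, 0 <= t <= T -> 0 <= s <= T -> A a -> A b ->
        `|c t x a - c s y b| <= L * (`|t - s| + enorm (x - y) + enorm (a - b)) /\
        enorm (f t x a - f s y b) <= L * (`|t - s| + enorm (x - y) + enorm (a - b))) /\
    (forall x y, `|q x - q y| <= L * enorm (x - y)).

Definition assumption_A2 (d m : nat) (T : R) (A : set 'rV[R]_m)
  (alpha : R -> 'rV[R]_d -> 'rV[R]_d -> 'rV[R]_m)
  (alpha0 : R -> 'rV[R]_d -> 'rV[R]_m) : Prop :=
  exists L : R,
    (forall t s x y p r, 0 <= t <= T -> 0 <= s <= T ->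
       enorm (alpha t x p - alpha s y r) <= L * (`|t - s| + enorm (x - y) + enorm (p - r))) /\
    (forall t x, 0 <= t <= T -> A (alpha0 t x)) /\
    (forall t s x y, 0 <= t <= T -> 0 <= s <= T ->
       enorm (alpha0 t x - alpha0 s y) <= L * (`|t - s| + enorm (x - y))).

(* g is in W^{2,inf}(R^d) with norm <= K, rendered as C^{1,1}:
   |g| <= K, g differentiable, |grad g| <= K, grad g K-Lipschitz *)
Definition W2inf_bound (d : nat) (K : R) (g : 'rV[R]_d -> R) : Prop :=
  (forall x, `|g x| <= K) /\
  (forall x, differentiable g x) /\
  (forall x i, `|partial i g x| <= K) /\
  (forall x y i, `|partial i g x - partial i g y| <= K * enorm (x - y)).

Definition assumption_A3 (d m : nat) (T : R) (A : set 'rV[R]_m)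
  (c : R -> 'rV[R]_d -> 'rV[R]_m -> R) (f : R -> 'rV[R]_d -> 'rV[R]_m -> 'rV[R]_d)
  (q : 'rV[R]_d -> R) : Prop :=
  semiconcave q /\
  exists K : R, forall t a, 0 <= t <= T -> A a ->
    W2inf_bound K (fun x => c t x a) /\
    forall j : 'I_d, W2inf_bound K (fun x => f t x a 0 j).

Definition supnorm_f (d m : nat) (T : R) (A : set 'rV[R]_m)
  (f : R -> 'rV[R]_d -> 'rV[R]_m -> 'rV[R]_d) : R :=
  sup [set r | exists t x a, [/\ 0 <= t <= T, A a & r = enorm (f t x a)]].

Definition semidiscrete_solution (d m : nat) (T N h : R) (A : set 'rV[R]_m)
  (c : R -> 'rV[R]_d -> 'rV[R]_m -> R) (f : R -> 'rV[R]_d -> 'rV[R]_m -> 'rV[R]_d)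
  (q : 'rV[R]_d -> R) (w : R -> 'rV[R]_d -> R) : Prop :=
  (exists M : R, forall t x, 0 <= t <= T -> `|w t x| <= M) /\
  (forall x, {within `[0, T], continuous (fun s => w s x)}) /\
  (forall t x, 0 < t < T ->
     derivable (fun s => w s x) t 1 /\
     'D_1 (fun s => w s x) t + Ham A c f t x (gradh h (w t) x)
       = - (N * h * laplh h (w t) x)) /\
  (forall x, w T x = q x).

Definition jcont (d : nat) (g : R -> 'rV[R]_d -> R) : Prop :=
  forall t x (e : R), 0 < e -> exists2 r : R, 0 < r &
    forall s y, `|s - t| < r -> enorm (y - x) < r -> `|g s y - g t x| < e.

Definition C1test (d : nat) (phi : R -> 'rV[R]_d -> R) : Prop :=
  (forall t x, derivable (fun s => phi s x) t 1) /\
  (forall t x (i : 'I_d), derivable (phi t) x (evec i)) /\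
  jcont phi /\
  jcont (fun t x => 'D_1 (fun s => phi s x) t) /\
  (forall i : 'I_d, jcont (fun t x => partial i (phi t) x)).

Definition loc_max (d : nat) (T : R) (g : R -> 'rV[R]_d -> R) (t0 : R) (x0 : 'rV[R]_d) : Prop :=
  exists2 r : R, 0 < r & forall s y, 0 < s < T -> `|s - t0| < r -> enorm (y - x0) < r ->
    g s y <= g t0 x0.
Definition loc_min (d : nat) (T : R) (g : R -> 'rV[R]_d -> R) (t0 : R) (x0 : 'rV[R]_d) : Prop :=
  exists2 r : R, 0 < r & forall s y, 0 < s < T -> `|s - t0| < r -> enorm (y - x0) < r ->
    g t0 x0 <= g s y.

(* viscosity solution of the terminal value problem
   d_t v + H(t,x,grad v) = 0 in (0,T) x R^d, v(T,.) = q
   (the equation read as  -d_t v - H = 0, the standard convention for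
    value functions of minimisation problems) *)
Definition viscosity_solution (d m : nat) (T : R) (A : set 'rV[R]_m)
  (c : R -> 'rV[R]_d -> 'rV[R]_m -> R) (f : R -> 'rV[R]_d -> 'rV[R]_m -> 'rV[R]_d)
  (q : 'rV[R]_d -> R) (v : R -> 'rV[R]_d -> R) : Prop :=
  (exists M : R, forall t x, 0 <= t <= T -> `|v t x| <= M) /\
  (forall t x (e : R), 0 <= t <= T -> 0 < e -> exists2 r : R, 0 < r &
    forall s y, 0 <= s <= T -> `|s - t| < r -> enorm (y - x) < r -> `|v s y - v t x| < e) /\
  (forall x, v T x = q x) /\
  (forall phi t0 x0, C1test phi -> 0 < t0 < T ->
     loc_max T (fun s y => v s y - phi s y) t0 x0 ->
     0 <= 'D_1 (fun s => phi s x0) t0 + Ham A c f t0 x0 (grad (phi t0) x0)) /\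
  (forall phi t0 x0, C1test phi -> 0 < t0 < T ->
     loc_min T (fun s y => v s y - phi s y) t0 x0 ->
     'D_1 (fun s => phi s x0) t0 + Ham A c f t0 x0 (grad (phi t0) x0) <= 0).

Definition box_vol (d : nat) (a b : 'rV[R]_d) : R := \prod_(i < d) (b 0 i - a 0 i).
Definition lebesgue_null (d : nat) (E : set 'rV[R]_d) : Prop :=
  forall e : R, 0 < e -> exists a b : nat -> 'rV[R]_d,
    [/\ forall n (i : 'I_d), a n 0 i <= b n 0 i,
        forall x, E x -> exists n, forall i : 'I_d, a n 0 i <= x 0 i <= b n 0 i
      & forall k, \sum_(n < k) box_vol (a n) (b n) <= e].

End Defs.

(* Main.v *)
(* Since N >= |f|/2, the operator phi |-> f . grad^h phi + N h Delta^h phi is a sum of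
   increments phi(x +- h e_i) - phi(x) with nonnegative rates, that is, the generator of
   a controlled jump process, and v^h obeys a maximum principle. It yields bounds on v^h
   that are uniform in h: Lipschitz bounds; by coupling three copies of the process,
     v^h(x + y) + v^h(x - y) - 2 v^h(x) <= C (|y|^2 + sqrt (h |y|))   for |y| >= h;
   and, because the dissipation of the squared increments controls all mixed second
   differences, the bound C h^(3/2) when y = h e_i. Doubling of variables shows that v^h
   converges pointwise to v, which is thus Lipschitz and semiconcave. The points where v
   has a kink along an axis form a null set by a count of grid cells, as second
   differences telescope along a column; elsewhere v is differentiable. Because h^(3/2) is
   o(h), the two second difference bounds compare the forward difference quotient of v^h
   at scale h from below with the one at a fixed scale, hence with the directional
   derivative of v; using this for a direction and its opposite gives
   grad^h v^h -> grad v, and alpha is Lipschitz. *)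
Require Import Defs.
From HB Require Import structures.
From mathcomp Require Import all_boot all_order all_algebra.
From mathcomp Require Import all_classical all_reals all_analysis.
From mathcomp Require Import ring lra.
Set Implicit Arguments. Unset Strict Implicit. Unset Printing Implicit Defensive.
Import Order.TTheory GRing.Theory Num.Theory.
Import numFieldNormedType.Exports.
Local Open Scope classical_set_scope.
Local Open Scope ring_scope.


(** The Hamiltonian is a minimum: using at other points the control that is optimal at [x] gives
    inequalities in one direction only, so the second-order estimates are one-sided and the gradient
    is recovered from lower bounds on slopes. The obstacle is the range of scales. At [|y| = h] the
    three-copy bound is only O(h), which lets a slope change by O(1) in one step. The axis bound
    O(h^(3/2)) excludes this, but summed over [s / h] steps it changes a slope by about
    [s / sqrt h], too much at a fixed scale [s]. The two bounds are joined at the scale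
    [kap ^+ 2 * h]: below it the axis bound costs about [kap ^+ 2 * sqrt h]; above it, doubling the
    scale with the three-copy bound costs a geometric sum of order [1 / kap], besides a term of
    order [s]. So [s] is taken small, [kap] large, and only then does [h] tend to 0. Uniformity in
    [h] rests on the form of the maximum principle: the total jump rate, of order [1 / h], enters
    its hypothesis but not its conclusion. *)

Section EuclideanNorm.
Variables (R : realType) (d : nat).
Implicit Types (x y z : 'rV[R]_d) (a b : R).

Lemma dotvC x y : dotv x y = dotv y x.
Proof. by apply: eq_bigr => i _; rewrite mulrC. Qed.

Lemma dotvDl x y z : dotv (x + y) z = dotv x z + dotv y z.
Proof. by rewrite -big_split; apply: eq_bigr => i _; rewrite mxE mulrDl. Qed.

Lemma dotvZl a x z : dotv (a *: x) z = a * dotv x z.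
Proof. by rewrite mulr_sumr; apply: eq_bigr => i _; rewrite mxE mulrA. Qed.

Lemma dotvNl x z : dotv (- x) z = - dotv x z.
Proof. by rewrite -scaleN1r dotvZl mulN1r. Qed.

Lemma dotvBl x y z : dotv (x - y) z = dotv x z - dotv y z.
Proof. by rewrite dotvDl dotvNl. Qed.

Lemma dotvDr x y z : dotv x (y + z) = dotv x y + dotv x z.
Proof. by rewrite dotvC dotvDl !(dotvC x). Qed.

Lemma dotvZr a x z : dotv x (a *: z) = a * dotv x z.
Proof. by rewrite dotvC dotvZl dotvC. Qed.

Lemma dotvNr x z : dotv x (- z) = - dotv x z.
Proof. by rewrite dotvC dotvNl dotvC. Qed.

Lemma dotvBr x y z : dotv x (y - z) = dotv x y - dotv x z.
Proof. by rewrite dotvDr dotvNr. Qed.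

Lemma dotv_ge0 x : 0 <= dotv x x.
Proof. by apply: sumr_ge0 => i _; rewrite -expr2 sqr_ge0. Qed.

Lemma enorm_ge0 x : 0 <= enorm x. Proof. exact: sqrtr_ge0. Qed.

Lemma enorm_sqr x : enorm x ^+ 2 = dotv x x.
Proof. by rewrite sqr_sqrtr ?dotv_ge0. Qed.

Lemma enormN x : enorm (- x) = enorm x.
Proof. by rewrite /enorm dotvNl dotvNr opprK. Qed.

Lemma enormB x y : enorm (x - y) = enorm (y - x).
Proof. by rewrite -enormN opprB. Qed.

Lemma enorm0 : enorm (0 : 'rV[R]_d) = 0.
Proof. by rewrite /enorm -(scale0r 0) dotvZl mul0r sqrtr0. Qed.

Lemma enormZ a x : enorm (a *: x) = `|a| * enorm x.
Proof. by rewrite /enorm dotvZl dotvZr mulrA -expr2 sqrtrM ?sqr_ge0// sqrtr_sqr. Qed.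

Lemma enorm_evec (i : 'I_d) : enorm (evec R i) = 1.
Proof.
rewrite /enorm /dotv (bigD1 i)//= big1 ?addr0; last first.
  by move=> j ji; rewrite !mxE eqxx/= (negPf ji) mul0r.
by rewrite !mxE !eqxx/= mul1r sqrtr1.
Qed.

Lemma dotv_evec x (i : 'I_d) : dotv x (evec R i) = x 0 i.
Proof.
rewrite /dotv (bigD1 i)//= big1 ?addr0; last first.
  by move=> j ji; rewrite !mxE eqxx/= (negPf ji) mulr0.
by rewrite !mxE !eqxx/= mulr1.
Qed.

Lemma enorm_coord x (i : 'I_d) : `|x 0 i| <= enorm x.
Proof.
rewrite -sqrtr_sqr /enorm ler_sqrt ?dotv_ge0// /dotv (bigD1 i)//= -expr2.
by rewrite lerDl; apply: sumr_ge0 => j _; rewrite -expr2 sqr_ge0.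
Qed.

Lemma enorm0_eq0 x : enorm x = 0 -> x = 0.
Proof.
move=> x0; apply/rowP => i; rewrite mxE; apply/eqP; rewrite -normr_le0 -x0.
exact: enorm_coord.
Qed.

Lemma dotv_le_enorm x y : dotv x y <= enorm x * enorm y.
Proof.
have [x0|xp] := eqVneq (enorm x) 0.
  by rewrite x0 (enorm0_eq0 x0) -(scale0r 0) dotvZl !mul0r.
have [y0|yp] := eqVneq (enorm y) 0.
  by rewrite y0 (enorm0_eq0 y0) -(scale0r 0) dotvZr mul0r mulr0.
have ax : 0 < enorm x by rewrite lt_neqAle eq_sym xp enorm_ge0.
have ay : 0 < enorm y by rewrite lt_neqAle eq_sym yp enorm_ge0.
have := dotv_ge0 (enorm y *: x - enorm x *: y).
rewrite dotvBl !dotvBr !dotvZl !dotvZr -!enorm_sqr (dotvC y x) => H.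
have : 0 <= (enorm x * enorm y) * (enorm x * enorm y - dotv x y) by nra.
by rewrite pmulr_rge0 ?mulr_gt0// subr_ge0.
Qed.

Lemma norm_dotv_le x y : `|dotv x y| <= enorm x * enorm y.
Proof.
rewrite ler_norml dotv_le_enorm andbT lerNl -dotvNl.
by rewrite (le_trans (dotv_le_enorm _ _))// enormN.
Qed.

Lemma enormD x y : enorm (x + y) <= enorm x + enorm y.
Proof.
rewrite -(@ler_pXn2r _ 2)// ?nnegrE ?addr_ge0 ?enorm_ge0//.
rewrite enorm_sqr dotvDl !dotvDr -!enorm_sqr (dotvC y x).
have := dotv_le_enorm x y; nra.
Qed.

Lemma enorm_sum (I : Type) (s : seq I) (F : I -> 'rV[R]_d) :
  enorm (\sum_(i <- s) F i) <= \sum_(i <- s) enorm (F i).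
Proof.
elim: s => [|i s IH]; first by rewrite !big_nil enorm0.
by rewrite !big_cons (le_trans (enormD _ _))// lerD2l.
Qed.

Lemma row_sum_evec x : x = \sum_(i < d) x 0 i *: evec R i.
Proof. exact: row_sum_delta. Qed.

Lemma enorm_le_sum x : enorm x <= \sum_(i < d) `|x 0 i|.
Proof.
rewrite {1}(row_sum_evec x) (le_trans (enorm_sum _ _))//.
by apply: ler_sum => i _; rewrite enormZ enorm_evec mulr1.
Qed.

Lemma enorm_le_bound x a : (forall i, `|x 0 i| <= a) -> enorm x <= d%:R * a.
Proof.
move=> xa; rewrite (le_trans (enorm_le_sum x))//.
rewrite (le_trans (ler_sum _ (fun i _ => xa i)))//.
by rewrite sumr_const card_ord mulr_natl.
Qed.

(** The topology of ['rV[R]_d] comes from the sup norm; together with [enorm_le_norm] this transfers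
    limits and differentiability between the two norms. *)
Lemma norm_le_enorm x : `|x| <= enorm x.
Proof.
rewrite /Num.Def.normr/= mx_normrE; apply/bigmax_leP; split; first exact: enorm_ge0.
by move=> [i j] _ /=; rewrite (ord1 i) enorm_coord.
Qed.

Lemma norm_coord x (i : 'I_d) : `|x 0 i| <= `|x|.
Proof.
rewrite [leRHS]/Num.Def.normr/= mx_normrE.
by apply/bigmax_geP; right => /=; exists (0, i).
Qed.

Lemma enorm_le_norm x : enorm x <= d%:R * `|x|.
Proof. by apply: enorm_le_bound => i; exact: norm_coord. Qed.

Lemma enorm_sqrD x y : enorm (x + y) ^+ 2 = enorm x ^+ 2 + 2 * dotv x y + enorm y ^+ 2.
Proof. rewrite !enorm_sqr dotvDl !dotvDr (dotvC y x); ring. Qed.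

Lemma parallelogram x y :
  enorm (x + y) ^+ 2 + enorm (x - y) ^+ 2 = 2 * enorm x ^+ 2 + 2 * enorm y ^+ 2.
Proof. rewrite !enorm_sqr !dotvDl !dotvDr !dotvNl !dotvNr (dotvC y x); ring. Qed.

End EuclideanNorm.

Ltac ge0 := repeat first
  [ done | exact: enorm_ge0 | exact: expR_ge0 | exact: sqrtr_ge0 | exact: normr_ge0
  | exact: sqr_ge0 | apply: ltW; assumption
  | rewrite invr_ge0 | apply: exprn_ge0 | apply: mulr_ge0 | apply: addr_ge0 ].

Section FiniteSums.
Variables (R : realType) (I : Type).

Lemma is_derive_sum_seq (s : seq I) (E : I -> R -> R) (E' : I -> R) (t : R) :
  (forall i, is_derive t 1 (E i) (E' i)) ->
  is_derive t 1 (fun r => \sum_(i <- s) E i r) (\sum_(i <- s) E' i).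
Proof.
move=> dE; elim: s => [|i s IH].
  have -> : (fun r => \sum_(i <- [::]) E i r) = cst 0 by apply/funext => r; rewrite big_nil.
  by rewrite big_nil; exact: is_derive_cst.
have -> : (fun r => \sum_(j <- i :: s) E j r) = E i + (fun r => \sum_(j <- s) E j r).
  by apply/funext => r; rewrite big_cons.
by rewrite big_cons; exact: is_deriveD.
Qed.

Lemma cvg_sum_seq (U : Type) (F : set_system U) {FF : Filter F} (s : seq I) (E : I -> U -> R)
    (l : I -> R) :
  (forall i, E i r @[r --> F] --> l i) ->
  \sum_(i <- s) E i r @[r --> F] --> \sum_(i <- s) l i.
Proof.
move=> cE; elim: s => [|i s IH].
  by under eq_fun do rewrite big_nil; rewrite big_nil; exact: cvg_cst.
by under eq_fun do rewrite big_cons; rewrite big_cons; exact: cvgD.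
Qed.

End FiniteSums.

(** * Backward maximum principle for families of functions of time *)

Section MaximumPrinciple.
Variables (R : realType) (T : R).

(** Backward Gronwall: [expR (- k * s) * (y s - E)] is nondecreasing, so a nonpositive value at [T]
    forces nonpositive values before. *)
Lemma le_terminal_of_derive_ge (y y' : R -> R) (k E : R) :
  {within `[0, T], continuous y} ->
  (forall t : R, 0 < t < T -> is_derive t 1 y (y' t)) ->
  (forall t : R, 0 < t < T -> k * (y t - E) <= y' t) ->
  y T <= E -> forall t : R, 0 <= t <= T -> y t <= E.
Proof.
move=> cy dy hy yT t /andP[t0 tT].
pose F s := expR (- k * s) * (y s - E).
have dF s : 0 < s < T ->
    is_derive s 1 F (expR (- k * s) * (y' s - k * (y s - E))).
  move=> hs; have := dy _ hs => ds; rewrite /F.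
  apply: is_derive_eq; rewrite /GRing.scale/=; ring.
have cF : {within `[0, T], continuous F}.
  move=> s; rewrite /F; apply: cvgM; last by apply: cvgB; [exact: cy|exact: cvg_cst].
  apply: continuous_subspaceT => {}s.
  apply: (@continuous_comp _ _ _ (fun s : R => - k * s) expR).
    by apply: cvgM; [exact: cvg_cst|exact: cvg_id].
  exact: continuous_expR.
have : F t <= F T.
  apply: (@ger0_derive1_ndecr _ F 0 T) => // s; rewrite in_itv/= => hs.
    by have := dF _ hs => ds; exact: ex_derive.
  have := dF _ hs => ds; rewrite derive1E derive_val.
  by rewrite mulr_ge0 ?expR_ge0// subr_ge0 hy.
rewrite /F => H.
have : expR (- k * t) * (y t - E) <= 0.
  by rewrite (le_trans H)// mulr_ge0_le0 ?expR_ge0// subr_le0.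
by rewrite pmulr_rle0 ?expR_gt0// subr_le0.
Qed.

(* With D the supremum of exp(-(l+1)(T-t)) u and D > max B g, the differential
   inequality would bound that function by a strict convex combination of D and
   max B g; no maximum point is needed, so Z may be noncompact. *)
Lemma maximum_principle (Z : Type) (u u' : R -> Z -> R) (M B g k l : R) :
  (forall (t : R) z, 0 <= t <= T -> u t z <= M) ->
  (forall z, {within `[0, T], continuous (u ^~ z)}) ->
  (forall (t : R) z, 0 < t < T -> is_derive t 1 (u ^~ z) (u' t z)) ->
  0 <= B -> 0 <= k -> 0 <= l ->
  (forall z, u T z <= B) ->
  (forall (t : R) z (S : R), 0 < t < T -> 0 <= S -> (forall z', u t z' <= S) ->
     - u' t z <= k * (S - u t z) + l * S + g) ->
  forall (t : R) z, 0 <= t <= T -> u t z <= expR ((l + 1) * T) * Num.max B g.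
Proof.
move=> uM cu du B0 k0 l0 uT hu.
set E := Num.max B g; set mu := l + 1.
have E0 : 0 <= E by rewrite le_max B0.
pose y t z := expR (mu * (t - T)) * u t z.
pose Y := [set E] `|` [set r | exists t z, 0 <= t <= T /\ r = y t z].
have eT (t : R) : t <= T -> expR (mu * (t - T)) <= 1.
  by move=> tT; rewrite -expR0 ler_expR mulr_ge0_le0 ?subr_le0// addr_ge0.
have ubY : has_ubound Y.
  exists (Num.max E `|M|) => r [->|[t [z [tT ->]]]]; first by rewrite le_max lexx.
  rewrite le_max; apply/orP; right; rewrite /y.
  have e1 := eT t (proj2 (andP tT)); have e0 := expR_ge0 (mu * (t - T)).
  have := ler_norm M; have := uM t z tT; have := normr_ge0 M; nra.
have supY : has_sup Y by split=> //; exists E; left.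
set D := sup Y.
have ED : E <= D by apply: ub_le_sup => //; left.
have yD t z : 0 <= t <= T -> y t z <= D by move=> tT; apply: ub_le_sup => //; right; exists t, z.
suff DE : D <= E.
  move=> t z tT; have := le_trans (yD t z tT) DE; rewrite /y => H.
  have -> : u t z = expR (mu * (T - t)) * (expR (mu * (t - T)) * u t z).
    by rewrite mulrA -expRD -mulrDr addrA subrK subrr mulr0 expR0 mul1r.
  have /andP[t0 tT'] := tT.
  apply: (@le_trans _ _ (expR (mu * (T - t)) * E)).
    by rewrite ler_wpM2l ?expR_ge0.
  by rewrite ler_wpM2r// ler_expR ler_wpM2l ?addr_ge0//; lra.
rewrite leNgt; apply/negP => ltED.
pose c := k + l + 1; have c0 : 0 < c by rewrite /c; lra.
(* Chosen so that [mu * y - k * (D - y) - l * D - E = c * (y - E')]: this is the lower bound on the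
   derivative of [y], and the extra 1 in [mu = l + 1] is what gives [E] a positive weight. *)
pose E' := ((k + l) * D + E) / c.
have cE' : c * E' = (k + l) * D + E by rewrite /E' mulrC divfK ?gt_eqF.
have E'D : E' < D by rewrite -(ltr_pM2l c0) cE' /c; lra.
have EE' : E <= E' by rewrite -(ler_pM2l c0) cE' /c; nra.
have yE' t z : 0 <= t <= T -> y t z <= E'.
  apply: (@le_terminal_of_derive_ge (y ^~ z)
    (fun t => mu * y t z + expR (mu * (t - T)) * u' t z) c E').
  - move=> s; rewrite /y; apply: cvgM; last exact: cu.
    apply: continuous_subspaceT => {}s.
    apply: (@continuous_comp _ _ _ (fun s : R => mu * (s - T)) expR).
      by apply: cvgM; [exact: cvg_cst|apply: cvgB; [exact: cvg_id|exact: cvg_cst]].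
    exact: continuous_expR.
  - move=> s hs; have := du _ z hs => ds; rewrite /y.
    apply: is_derive_eq; rewrite /GRing.scale/=; ring.
  - move=> s /[dup] hs /andP[s0 sT].
    have e1 := eT s (ltW sT).
    pose S := expR (mu * (T - s)) * D.
    have S0 : 0 <= S by rewrite mulr_ge0 ?expR_ge0// (le_trans E0).
    have eK : expR (mu * (s - T)) * expR (mu * (T - s)) = 1.
      by rewrite -expRD -mulrDr addrA subrK subrr mulr0 expR0.
    have uS z' : u s z' <= S.
      rewrite -(ler_pM2l (expR_gt0 (mu * (s - T)))) /S mulrA eK mul1r.
      by apply: yD; rewrite !ltW.
    have := hu s z S hs S0 uS.
    rewrite -(ler_pM2l (expR_gt0 (mu * (s - T)))) => H.
    have eS : expR (mu * (s - T)) * S = D by rewrite /S mulrA eK mul1r.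
    have eg : expR (mu * (s - T)) * g <= E.
      have gE : g <= E by rewrite le_max lexx orbT.
      have := expR_ge0 (mu * (s - T)); nra.
    have {}H : - (expR (mu * (s - T)) * u' s z) <=
        k * (D - y s z) + l * D + E.
      rewrite -mulrN (le_trans H)//.
      have -> : expR (mu * (s - T)) * (k * (S - u s z) + l * S + g) =
        k * (expR (mu * (s - T)) * S - y s z) + l * (expR (mu * (s - T)) * S)
        + expR (mu * (s - T)) * g by rewrite /y; ring.
      by rewrite eS lerD2l.
    rewrite mulrBr cE' /c /mu; lra.
  - by rewrite /y subrr mulr0 expR0 mul1r (le_trans (uT z))// (le_trans _ EE')// le_max lexx.
have : D <= E'.
  by apply: sup_le_ub => [|r [->//|[t [z [tT ->]]]]]; [exists E; left|exact: yE'].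
by rewrite leNgt E'D.
Qed.
End MaximumPrinciple.

(** * The jump generator of the scheme *)

Section JumpGenerator.
Variables (R : realType) (d : nat).
Implicit Types (x y z F : 'rV[R]_d) (phi : 'rV[R]_d -> R) (k l : 'I_d * bool).

Definition sgb (b : bool) : R := if b then 1 else -1.

Definition step (h : R) k : 'rV[R]_d := (sgb k.2 * h) *: evec R k.1.

(** Jump intensities: the two opposite rates on axis [i] differ by [F 0 i / h], which reproduces the
    drift, and add up to [2 * N / h], which is the numerical viscosity. *)
Definition rate (N h : R) F k : R := N / h + sgb k.2 * F 0 k.1 / (2 * h).

Definition gen (N h : R) F phi x : R :=
  \sum_k rate N h F k * (phi (x + step h k) - phi x).

Lemma sum_dir (E : 'I_d * bool -> R) :
  \sum_k E k = \sum_(i < d) (E (i, true) + E (i, false)).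
Proof.
rewrite (eq_bigr (fun k => E (k.1, k.2))); last by case.
rewrite -(pair_bigA _ (fun i b => E (i, b)))/=.
by apply: eq_bigr => i _; rewrite big_bool.
Qed.

Lemma sum_dir_const (a : R) : \sum_(k : 'I_d * bool) a = 2 * d%:R * a.
Proof. by rewrite sum_dir sumr_const card_ord -mulr2n -mulr_natl -[a *+ 2]mulr_natl; ring. Qed.

Lemma sgb_sqr b : sgb b * sgb b = 1.
Proof. by case: b; rewrite /sgb ?mulrNN mulr1. Qed.

Lemma norm_sgb b : `|sgb b| = 1.
Proof. by case: b; rewrite /sgb ?normrN normr1. Qed.

Definition opdir k := (k.1, ~~ k.2).

Lemma step_opdir h k : step h (opdir k) = - step h k.
Proof.
by case: k => i []; rewrite /step /opdir /sgb/= mulN1r mul1r -?scaleNr ?opprK.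
Qed.

Lemma enorm_step h k : 0 <= h -> enorm (step h k) = h.
Proof. by move=> h0; rewrite /step enormZ enorm_evec mulr1 normrM norm_sgb mul1r ger0_norm. Qed.

Lemma gen_gradh_laplh (N h : R) F phi x : h != 0 ->
  dotv (gradh h phi x) F + N * h * laplh h phi x = gen N h F phi x.
Proof.
move=> h0; rewrite /gen sum_dir /dotv /laplh mulr_sumr -big_split/=.
apply: eq_bigr => i _; rewrite /rate /step /sgb/= mxE !mulN1r !mul1r.
have -> : x - h *: evec R i = x + (- h) *: evec R i by rewrite scaleNr.
by field.
Qed.

Lemma rate_ge0 (N h : R) F k : 0 < h -> enorm F <= 2 * N -> 0 <= rate N h F k.
Proof.
move=> h0 FN; rewrite /rate.
have -> : N / h + sgb k.2 * F 0 k.1 / (2 * h) = (2 * N + sgb k.2 * F 0 k.1) / (2 * h).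
  by field; rewrite gt_eqF.
rewrite divr_ge0 ?mulr_ge0 ?(ltW h0)//.
have := enorm_coord F k.1; rewrite ler_norml => /andP[F1 F2].
by rewrite /sgb; case: (k.2); lra.
Qed.

Lemma rate_opdir (N h : R) F k : rate N h F k + rate N h F (opdir k) = 2 * N / h.
Proof. by case: k => i b; rewrite /rate/=; case: b; rewrite /sgb/=; ring. Qed.

Lemma rate_le (N h : R) F k : 0 < h -> enorm F <= 2 * N -> rate N h F k <= 2 * N / h.
Proof. by move=> h0 FN; rewrite -(rate_opdir N h F k) lerDl rate_ge0. Qed.

Lemma rate_lip (N h : R) F1 F2 k : 0 < h ->
  `|rate N h F1 k - rate N h F2 k| <= enorm (F1 - F2) / (2 * h).
Proof.
move=> h0; rewrite /rate.
have -> : N / h + sgb k.2 * F1 0 k.1 / (2 * h) - (N / h + sgb k.2 * F2 0 k.1 / (2 * h))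
   = sgb k.2 * ((F1 - F2) 0 k.1) / (2 * h) by rewrite !mxE; field; rewrite gt_eqF.
have h2 : 0 < 2 * h by rewrite mulr_gt0.
by rewrite !normrM norm_sgb mul1r normfV (gtr0_norm h2) ler_wpM2r ?enorm_coord// invr_ge0 ltW.
Qed.

Lemma sum_rate (N h : R) F : \sum_k rate N h F k = 2 * d%:R * (N / h).
Proof.
rewrite sum_dir -sum_dir_const sum_dir; apply: eq_bigr => i _.
by rewrite /rate /sgb/=; ring.
Qed.

(** Supplies the term [k * (S - u)] of [maximum_principle], with [k] the total jump rate. That rate
    blows up as [h] tends to 0, which is harmless because [k] is absent from the conclusion
    there. *)
Lemma gen_le (N h S : R) F phi x : 0 < h -> enorm F <= 2 * N ->
  (forall z, phi z <= S) -> gen N h F phi x <= 2 * d%:R * (N / h) * (S - phi x).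
Proof.
move=> h0 FN phiS; rewrite -(sum_rate N h F) mulr_suml; apply: ler_sum => k _.
by rewrite ler_wpM2l ?rate_ge0// lerD2r.
Qed.

End JumpGenerator.
Arguments sgb {R}.
Arguments step {R d}.

(** * Lipschitz bounds in space and time, uniform in [h] *)

Section SchemeLipschitz.
Variables (R : realType) (d : nat).
Implicit Types (x y z : 'rV[R]_d) (k l : 'I_d * bool).

(* C and F stand for the running cost and the drift at a frozen time and control. *)
Definition coeff_bounds (N M L K : R) (C : 'rV[R]_d -> R) (F : 'rV[R]_d -> 'rV[R]_d) :=
  [/\ forall y, `|C y| <= M /\ enorm (F y) <= 2 * N,
      forall y z, `|C y - C z| <= L * enorm (y - z),
      forall y z, enorm (F y - F z) <= L * enorm (y - z),
      forall y z, `|C (y + z) + C (y - z) - 2 * C y| <= K * enorm z ^+ 2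
    & forall y z i, `|F (y + z) 0 i + F (y - z) 0 i - 2 * F y 0 i| <= K * enorm z ^+ 2].

(* At each (t, x) the frozen coefficients are those of a minimising control, which gives
   equality at x and an inequality at every other point. *)
Definition scheme_at (N h M L K : R) (phi phi' : 'rV[R]_d -> R) x :=
  exists C F, [/\ coeff_bounds N M L K C F,
    - phi' x = C x + gen N h (F x) phi x
    & forall y, - phi' y <= C y + gen N h (F y) phi y].

(** Collects what the estimates need from the control problem; neither [A] nor [Ham] appears any
    more, only frozen coefficients. *)
Record scheme_solution (T N h M L K : R) (q : 'rV[R]_d -> R) (w w' : R -> 'rV[R]_d -> R) := {
  sol_h : 0 < h; sol_h1 : h < 1; sol_T : 0 < T;
  sol_N : 1 <= N; sol_M : 0 <= M; sol_L : 0 <= L; sol_K : 0 <= K;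
  sol_bounded : exists B, forall (t : R) x, 0 <= t <= T -> `|w t x| <= B;
  sol_continuous : forall x, {within `[0, T], continuous (w ^~ x)};
  sol_derive : forall (t : R) x, 0 < t < T -> is_derive t 1 (w ^~ x) (w' t x);
  sol_scheme : forall (t : R) x, 0 < t < T -> scheme_at N h M L K (w t) (w' t) x;
  sol_terminal : forall x, w T x = q x;
  sol_qlip : forall x y, `|q x - q y| <= L * enorm (x - y);
  sol_qsc : forall x y, q (x + y) + q (x - y) - 2 * q x <= K * enorm y ^+ 2 }.

Variables (T N h M L K : R) (q : 'rV[R]_d -> R) (w w' : R -> 'rV[R]_d -> R).
Hypothesis sol : scheme_solution T N h M L K q w w'.

Let h0 : 0 < h := sol_h sol.
Let T0 : 0 < T := sol_T sol.
Let L0 : 0 <= L := sol_L sol.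
Let N0 : 0 <= N. Proof. by rewrite (le_trans _ (sol_N sol)). Qed.
Let kap := 2 * d%:R * (N / h).
Let kap0 : 0 <= kap. Proof. by rewrite /kap; ge0. Qed.

(** The control optimal at [x] gives equality there and an upper bound at [x + y]. With the rates at
    [x + y] used for both generators, what remains is the rate mismatch, of order [|y| / h], times
    single-step increments of [w]; these must therefore be bounded before general increments. *)
Lemma increment_inequality t x y : 0 < t < T ->
  exists2 F, enorm F <= 2 * N & - (w' t (x + y) - w' t x) <=
    L * enorm y + gen N h F (fun z => w t (z + y) - w t z) x
    + \sum_k L * enorm y / (2 * h) * `|w t (x + step h k) - w t x|.
Proof.
move=> tT; have [C [F [[CF Clip Flip _ _] eqx ley]]] := sol_scheme sol x tT.
exists (F (x + y)); first by case: (CF (x + y)).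
have := ley (x + y); have := Clip (x + y) x.
rewrite [x + y - x]addrAC subrr add0r ler_norml => /andP[_ Cy] Hy.
have -> : - (w' t (x + y) - w' t x) = - w' t (x + y) - (- w' t x) by ring.
rewrite eqx.
suff : gen N h (F (x + y)) (w t) (x + y) - gen N h (F x) (w t) x <=
   gen N h (F (x + y)) (fun z => w t (z + y) - w t z) x
    + \sum_k L * enorm y / (2 * h) * `|w t (x + step h k) - w t x| by lra.
rewrite /gen -sumrB -big_split/=; apply: ler_sum => k _.
rewrite (addrAC x y (step h k)).
set a := rate _ _ (F (x + y)) k; set b := rate _ _ (F x) k.
have ab : `|a - b| <= L * enorm y / (2 * h).
  apply: (le_trans (rate_lip N _ _ k h0)); apply: ler_wpM2r; first by ge0.
  by rewrite (le_trans (Flip _ _))// [x + y - x]addrAC subrr add0r.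
set p := w t (x + step h k) - w t x.
set P := w t (x + step h k + y) - w t (x + y).
have -> : a * P - b * p = a * (w t (x + step h k + y) - w t (x + step h k) -
    (w t (x + y) - w t x)) + (a - b) * p by rewrite /P /p; ring.
rewrite lerD2l (le_trans (ler_norm _))// normrM ler_wpM2r//.
Qed.

Let bounded_diff : exists B : R, forall (t : R) x y, 0 <= t <= T -> w t x - w t y <= B.
Proof.
have [B wB] := sol_bounded sol; exists (B + B) => t x y tT.
have := wB t x tT; have := wB t y tT; rewrite !ler_norml; lra.
Qed.

Definition lip_step := expR ((d%:R * L + 1) * T) * L.

(** The rate mismatch brings back single-step increments in every direction, so all directions are
    treated as one family indexed by direction and point; the mismatch then becomes the term [l * S]
    with [l = d%:R * L]. *)
Lemma scheme_lip_step t x k : 0 <= t <= T -> `|w t (x + step h k) - w t x| <= lip_step * h.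
Proof.
suff H k' x' t' : 0 <= t' <= T -> (w t' (x' + step h k') - w t' x') / h <= lip_step.
  move=> tT; rewrite ler_norml; apply/andP; split; last by rewrite -ler_pdivrMr ?H.
  have := H (opdir k) (x + step h k) t tT.
  by rewrite ler_pdivrMr// step_opdir addrK; lra.
pose u t (z : ('I_d * bool) * 'rV[R]_d) := (w t (z.2 + step h z.1) - w t z.2) / h.
pose u' t (z : ('I_d * bool) * 'rV[R]_d) := (w' t (z.2 + step h z.1) - w' t z.2) / h.
rewrite -/(u t' (k', x')) /lip_step => tT'.
have [B wB] := bounded_diff.
have -> : expR ((d%:R * L + 1) * T) * L = expR ((d%:R * L + 1) * T) * Num.max L L by rewrite maxxx.
apply: (@maximum_principle R T _ u u' (B / h) L L kap (d%:R * L)) => //.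
- by move=> s z sT; rewrite ler_pM2r ?invr_gt0// wB.
- move=> z s; apply: cvgM; last exact: cvg_cst.
  by apply: cvgB; exact: (sol_continuous sol).
- move=> s z sT; have d1 := sol_derive sol (z.2 + step h z.1) sT.
  have d2 := sol_derive sol z.2 sT.
  by rewrite /u; apply: is_derive_eq; rewrite /u' /GRing.scale/=; ring.
- by rewrite mulr_ge0.
- move=> z; rewrite /u ler_pdivrMr// !(sol_terminal sol).
  rewrite (le_trans (ler_norm _))// (le_trans (sol_qlip sol _ _))//.
  by rewrite [_ + _ - _]addrAC subrr add0r (enorm_step _ (ltW h0)).
move=> s [{}k {}x] S sT S0 uS; rewrite /u' /u/= in uS *.
have [F FN] := increment_inequality x (step h k) sT.
rewrite (enorm_step _ (ltW h0))//.
set g := fun z => _; set Sg := \sum_k _ => H.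
have gS z : g z <= S * h by have := uS (k, z); rewrite /= ler_pdivrMr.
have gs l z : `|w s (z + step h l) - w s z| <= S * h.
  rewrite ler_norml; apply/andP; split.
    have := uS (opdir l, z + step h l); rewrite /= step_opdir addrK ler_pdivrMr//; lra.
  by have := uS (l, z); rewrite /= ler_pdivrMr.
have SgS : Sg <= d%:R * L * (S * h).
  rewrite (@le_trans _ _ (\sum_(l : 'I_d * bool) L / 2 * (S * h)))//.
    apply: ler_sum => l _.
    have -> : L * h / (2 * h) = L / 2 by field; rewrite gt_eqF.
    by rewrite ler_wpM2l ?divr_ge0.
  by rewrite sum_dir_const le_eqVlt; apply/orP; left; apply/eqP; field.
have := gen_le x h0 FN gS; rewrite -/kap => H2.
have {}H : - (w' s (x + step h k) - w' s x) <= L * h + kap * (S * h - g x) + d%:R * L * (S * h).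
  by rewrite (le_trans H)// !lerD.
rewrite -mulNr ler_pdivrMr// (le_trans H)// /g le_eqVlt; apply/orP; left; apply/eqP.
by field; rewrite gt_eqF.
Qed.

Definition lip_space := expR T * (L + d%:R * L * lip_step).

Lemma lip_step_ge0 : 0 <= lip_step. Proof. by rewrite /lip_step; ge0. Qed.

Lemma lip_space_ge0 : 0 <= lip_space.
Proof. by have := lip_step_ge0; rewrite /lip_space => ?; ge0. Qed.

(** Single steps being controlled by [scheme_lip_step], the rate mismatch is now a mere source term
    proportional to [enorm y']. *)
Lemma scheme_lip t x y : 0 <= t <= T -> `|w t x - w t y| <= lip_space * enorm (x - y).
Proof.
suff H x' y' t' : 0 <= t' <= T -> w t' (x' + y') - w t' x' <= lip_space * enorm y'.
  move=> tT; rewrite ler_norml; apply/andP; split.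
    by have := H x (y - x) t tT; rewrite addrCA subrr addr0 enormB; lra.
  by have := H y (x - y) t tT; rewrite addrCA subrr addr0.
move=> tT'.
have [B wB] := bounded_diff.
pose c := (L + d%:R * L * lip_step) * enorm y'.
have c0 : 0 <= c by have := lip_step_ge0; rewrite /c => ?; ge0.
(* Puts the bound in the shape of [maximum_principle] with [l = 0] and both [B] and [g] equal to
   [c]. *)
rewrite /lip_space -mulrA -/c -(maxxx c) -[X in expR X]mul1r -[X in expR (X * _)]add0r.
apply: (@maximum_principle R T _ (fun t x => w t (x + y') - w t x)
  (fun t x => w' t (x + y') - w' t x) B c c kap 0) => //.
- by move=> *; exact: wB.
- by move=> z s; apply: cvgB; exact: (sol_continuous sol).
- by move=> s z sT; have d1 := sol_derive sol (z + y') sT; have d2 := sol_derive sol z sT; exact: is_deriveB.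
- move=> z; rewrite !(sol_terminal sol).
  rewrite (le_trans (ler_norm _))// (le_trans (sol_qlip sol _ _))//.
  rewrite [_ + _ - _]addrAC subrr add0r ler_wpM2r ?enorm_ge0// lerDl.
  by have := lip_step_ge0 => ?; ge0.
move=> s z S sT S0 gS.
have [F FN] := increment_inequality z y' sT.
set g := fun z => _; set Sg := \sum_k _ => H.
have := gen_le z h0 FN gS; rewrite -/kap => H2.
have SgS : Sg <= d%:R * L * lip_step * enorm y'.
  rewrite (@le_trans _ _ (\sum_(l : 'I_d * bool) L * enorm y' / (2 * h) * (lip_step * h)))//.
    apply: ler_sum => l _.
    apply: ler_wpM2l; first by ge0.
    by rewrite scheme_lip_step//; case/andP: sT => ? ?; rewrite !ltW.
  rewrite sum_dir_const le_eqVlt; apply/orP; left; apply/eqP; field.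
  by rewrite gt_eqF.
rewrite mul0r addr0 (le_trans H)// /c; move: H2; rewrite /=; lra.
Qed.

Definition lip_time := M + 4 * d%:R * N * lip_step.

Lemma lip_time_ge0 : 0 <= lip_time.
Proof. by have := lip_step_ge0; have := sol_M sol; rewrite /lip_time => ? ?; ge0. Qed.

(** Rates of order [1 / h] meet increments of order [h]. *)
Lemma scheme_derive_bound t x : 0 < t < T -> `|w' t x| <= lip_time.
Proof.
move=> tT; have [C [F [[CF _ _ _ _] eqx _]]] := sol_scheme sol x tT.
have [CM FN] := CF x.
rewrite -normrN eqx (le_trans (ler_normD _ _))// lerD// (le_trans (ler_norm_sum _ _ _))//.
apply: (@le_trans _ _ (\sum_(k : 'I_d * bool) (2 * N / h) * (lip_step * h))).
  apply: ler_sum => k _; rewrite normrM ler_pM//.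
    by rewrite ger0_norm ?rate_ge0// rate_le.
  by rewrite scheme_lip_step//; case/andP: tT => ? ?; rewrite !ltW.
rewrite sum_dir_const le_eqVlt; apply/orP; left; apply/eqP; field.
by rewrite gt_eqF.
Qed.

Lemma scheme_lip_time s t x : 0 <= s <= T -> 0 <= t <= T ->
  `|w s x - w t x| <= lip_time * `|s - t|.
Proof.
wlog st : s t / s < t.
  move=> H sT tT; have [st|ts|->] := ltgtP s t; first exact: H.
    by rewrite distrC (distrC s) H.
  by rewrite !subrr normr0 mulr0.
move=> /andP[s0 sT] /andP[t0 tT].
have dw r : r \in `]s, t[%R -> is_derive r 1 (w ^~ x) (w' r x).
  by rewrite in_itv/= => /andP[sr rt]; apply: (sol_derive sol);
     rewrite (le_lt_trans s0 sr) (lt_le_trans rt tT).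
have [|c] := MVT st dw.
  have cx : {within `[0, T], continuous (w ^~ x)} by exact: (sol_continuous sol).
  apply: (@continuous_subspaceW _ _ `[s, t] `[0, T]); last exact: cx.
  by apply: subset_itv; rewrite bnd_simp.
rewrite in_itv/= => /andP[sc ct] wst.
rewrite distrC wst normrM (distrC s) ler_wpM2r// scheme_derive_bound//.
by rewrite (le_lt_trans s0 sc) (lt_le_trans ct tT).
Qed.

End SchemeLipschitz.

(** * Semiconcavity at scales above [h]: three coupled points *)

Section SemiconcavityAtMesoscopicScale.
Variable R : realType.

(** Here [P] and [Z] are the squared lengths of [x1 - x2] and [x1 + x2 - 2 *: x3], [q] and [r] the
    scalar products of these vectors with the step, [a], [b], [c] the rates at the three points and
    [m] their minimum; the left side is the effect on the weight of the jumps that are not made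
    together. Excess rates are of order [(p + z) / h] and increments of the weight carry a factor
    [h], so each product can be absorbed by Young's inequality. *)
Lemma coupled_quartic_bound (L K h eta p0 dl p z P Z q r a b c m : R) :
  0 <= L -> 0 <= K -> 0 < h -> h <= 1 -> h <= p0 -> eta * p0 = h -> 0 <= eta ->
  h * p0 <= dl ^+ 2 ->
  0 <= p -> 0 <= z -> P = p ^+ 2 -> Z = z ^+ 2 ->
  `|q| <= h * p -> `|r| <= h * z ->
  m <= a -> m <= b -> m <= c ->
  `|a - b| <= L * p / (2 * h) -> `|a + b - 2 * c| <= (K / 4 * P + L * z) / (2 * h) ->
  a - m <= L * (p + z) / (2 * h) -> b - m <= L * (p + z) / (2 * h) ->
  c - m <= L * (p + z) / (2 * h) ->
  (a - m) * ((P + 2 * q + h ^+ 2) ^+ 2 + eta * (P + 2 * q + h ^+ 2) + (Z + 2 * r + h ^+ 2)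
              - (P ^+ 2 + eta * P + Z))
  + (b - m) * ((P - 2 * q + h ^+ 2) ^+ 2 + eta * (P - 2 * q + h ^+ 2) + (Z + 2 * r + h ^+ 2)
              - (P ^+ 2 + eta * P + Z))
  + (c - m) * (Z - 4 * r + 4 * h ^+ 2 - Z)
  <= (36 * L + K) * (dl ^+ 2 + P ^+ 2 + eta * P + Z).
Proof.
move=> L0 K0 h0 h1 hp eh eta0 hd p0' z0 PE ZE qh rh ma mb mc ab abc am bm cm.
set Q := dl ^+ 2 + _ + _ + _.
have P0 : 0 <= P by rewrite PE sqr_ge0.
have Z0 : 0 <= Z by rewrite ZE sqr_ge0.
have eP : 0 <= eta * P by rewrite mulr_ge0.
have P2 : 0 <= P ^+ 2 by rewrite sqr_ge0.
have d2 : 0 <= dl ^+ 2 by rewrite sqr_ge0.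
have hh : h ^+ 2 <= dl ^+ 2 by nra.
have h4 : h ^+ 4 <= dl ^+ 2.
  apply: le_trans hh; have -> : h ^+ 4 = h ^+ 2 * h ^+ 2 by ring.
  have := sqr_ge0 h; have : h ^+ 2 <= 1 by nra.
  nra.
have eta1 : eta <= 1 by nra.
have hP : h ^+ 2 * P <= Q.
  have := sqr_ge0 (h ^+ 2 - P); have -> : (h ^+ 2 - P) ^+ 2 = h ^+ 4 - 2 * (h ^+ 2 * P) + P ^+ 2 by ring.
  by rewrite /Q; lra.
have t1 : h * p * P <= Q.
  have := sqr_ge0 (h * p - P).
  have -> : (h * p - P) ^+ 2 = h ^+ 2 * P - 2 * (h * p * P) + P ^+ 2 by rewrite PE; ring.
  by move: hP; rewrite /Q; lra.
have h2P2 : h ^+ 2 * P ^+ 2 <= P ^+ 2 by rewrite ler_piMl//; nra.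
have t2 : h * z * P <= Q.
  have := sqr_ge0 (h * P - z).
  have -> : (h * P - z) ^+ 2 = h ^+ 2 * P ^+ 2 - 2 * (h * z * P) + Z by rewrite ZE; ring.
  by rewrite /Q; lra.
have t3 : h ^+ 3 * p <= Q.
  have := sqr_ge0 (h * p - h ^+ 2).
  have -> : (h * p - h ^+ 2) ^+ 2 = h ^+ 2 * P - 2 * (h ^+ 3 * p) + h ^+ 4 by rewrite PE; ring.
  by move: hP; rewrite /Q; lra.
have t8 : h * z <= Q.
  have := sqr_ge0 (h - z).
  have -> : (h - z) ^+ 2 = h ^+ 2 - 2 * (h * z) + Z by rewrite ZE; ring.
  by rewrite /Q; lra.
have hz0 : 0 <= h * z by rewrite mulr_ge0// ltW.
have hp0 : 0 <= h * p by rewrite mulr_ge0// ltW.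
have t4 : h ^+ 3 * z <= Q.
  apply: le_trans t8; have -> : h ^+ 3 * z = h ^+ 2 * (h * z) by ring.
  by rewrite ler_piMl//; nra.
(* Young with weight [eta]: since [eta * p0 = h], the two halves are [h * p0], at most [dl ^+ 2],
   and [eta * P]. *)
have t9 : h * p <= Q.
  have := mulr_ge0 eta0 (sqr_ge0 (p0 - p)).
  have -> : eta * (p0 - p) ^+ 2 = h * p0 - 2 * (h * p) + eta * P by rewrite -eh PE; ring.
  by rewrite /Q; lra.
have t5 : eta * (h * p) <= Q by apply: le_trans t9; rewrite ler_piMl.
have t6 : eta * (h * z) <= Q by apply: le_trans t8; rewrite ler_piMl.
have t7 : z * P <= Q.
  have := sqr_ge0 (z - P).
  have -> : (z - P) ^+ 2 = Z - 2 * (z * P) + P ^+ 2 by rewrite ZE; ring.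
  by rewrite /Q; lra.
have Q1 : P ^+ 2 <= Q by rewrite /Q; lra.
have Q2 : eta * P <= Q by rewrite /Q; lra.
have Q3 : Z <= Q by rewrite /Q; lra.
have Q0 : 0 <= Q by apply: le_trans Q3.
pose D := L * (p + z) / (2 * h).
have D0 : 0 <= D by rewrite /D; ge0; lra.
have Dh : h * D = L / 2 * (p + z) by rewrite /D; field; rewrite gt_eqF.
have qq : q ^+ 2 <= h ^+ 2 * P.
  by rewrite PE -exprMn -(real_normK (num_real q)) lerXn2r ?nnegrE.
have abq : q * (a - b) <= L / 2 * P.
  apply: (le_trans (ler_norm _)); rewrite normrM.
  apply: (@le_trans _ _ (h * p * (L * p / (2 * h)))); first by rewrite ler_pM.
  by rewrite PE le_eqVlt; apply/orP; left; apply/eqP; field; rewrite gt_eqF.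
have abr : r * (a + b - 2 * c) <= z / 2 * (K / 4 * P + L * z).
  apply: (le_trans (ler_norm _)); rewrite normrM.
  apply: (@le_trans _ _ (h * z * ((K / 4 * P + L * z) / (2 * h)))); first by rewrite ler_pM.
  by rewrite le_eqVlt; apply/orP; left; apply/eqP; field; rewrite gt_eqF.
have sq1 : (2 * q + h ^+ 2) ^+ 2 <= 8 * (h ^+ 2 * P) + 2 * h ^+ 4.
  have := sqr_ge0 (2 * q - h ^+ 2).
  have -> : (2 * q - h ^+ 2) ^+ 2 = 8 * q ^+ 2 + 2 * h ^+ 4 - (2 * q + h ^+ 2) ^+ 2 by ring.
  lra.
have sq2 : (- 2 * q + h ^+ 2) ^+ 2 <= 8 * (h ^+ 2 * P) + 2 * h ^+ 4.
  have := sqr_ge0 (2 * q + h ^+ 2).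
  have -> : (2 * q + h ^+ 2) ^+ 2 = 8 * q ^+ 2 + 2 * h ^+ 4 - (- 2 * q + h ^+ 2) ^+ 2 by ring.
  lra.
(* Regrouped so that the terms linear in [q] and [r] carry the differences [a - b] and
   [a + b - 2 * c], which are smaller than the excess rates; only terms of second order in the step
   keep the latter. *)
rewrite [leLHS](_ : _ = 4 * P * (q * (a - b)) + 2 * P * h ^+ 2 * ((a - m) + (b - m))
  + (a - m) * (2 * q + h ^+ 2) ^+ 2 + (b - m) * (- 2 * q + h ^+ 2) ^+ 2
  + eta * (2 * (q * (a - b)) + h ^+ 2 * ((a - m) + (b - m)))
  + (2 * (r * (a + b - 2 * c)) + h ^+ 2 * ((a - m) + (b - m) + 4 * (c - m)))); last by ring.
have e1 : 4 * P * (q * (a - b)) <= 2 * L * Q.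
  apply: (@le_trans _ _ (4 * P * (L / 2 * P))); first by rewrite ler_wpM2l ?mulr_ge0.
  have -> : 4 * P * (L / 2 * P) = 2 * L * P ^+ 2 by field.
  by rewrite ler_wpM2l ?mulr_ge0.
have S2 : (a - m) + (b - m) <= 2 * D by rewrite /D; lra.
have e2 : 2 * P * h ^+ 2 * ((a - m) + (b - m)) <= 4 * L * Q.
  apply: (@le_trans _ _ (2 * P * h ^+ 2 * (2 * D))); first by rewrite ler_wpM2l// mulr_ge0 ?sqr_ge0// mulr_ge0.
  have -> : 2 * P * h ^+ 2 * (2 * D) = 2 * L * (h * p * P + h * z * P).
    transitivity (4 * P * h * (h * D)); [ring|by rewrite Dh; field].
  have := mulr_ge0 L0 Q0; have := ler_wpM2l L0 t1; have := ler_wpM2l L0 t2; lra.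
have hQ0 : 0 <= 8 * (h ^+ 2 * P) + 2 * h ^+ 4 by apply: le_trans sq1; rewrite sqr_ge0.
have e3' : D * (8 * (h ^+ 2 * P) + 2 * h ^+ 4) <= 10 * L * Q.
  have -> : D * (8 * (h ^+ 2 * P) + 2 * h ^+ 4) =
     L * (4 * (h * p * P + h * z * P) + (h ^+ 3 * p + h ^+ 3 * z)).
    transitivity (h * D * (8 * h * P + 2 * h ^+ 3)); first ring.
    by rewrite Dh; field.
  rewrite (_ : 10 * L * Q = L * (10 * Q)); last ring.
  apply: ler_wpM2l => //; lra.
have e3 : (a - m) * (2 * q + h ^+ 2) ^+ 2 <= 10 * L * Q.
  by apply: le_trans e3'; rewrite ler_pM ?sqr_ge0 ?subr_ge0.
have e4 : (b - m) * (- 2 * q + h ^+ 2) ^+ 2 <= 10 * L * Q.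
  by apply: le_trans e3'; rewrite ler_pM ?sqr_ge0 ?subr_ge0.
have e5 : eta * (2 * (q * (a - b)) + h ^+ 2 * ((a - m) + (b - m))) <= 3 * L * Q.
  apply: (@le_trans _ _ (eta * (2 * (L / 2 * P) + h ^+ 2 * (2 * D)))).
    apply: ler_wpM2l => //; apply: lerD; first by rewrite ler_pM2l.
    by rewrite ler_wpM2l ?sqr_ge0.
  have -> : eta * (2 * (L / 2 * P) + h ^+ 2 * (2 * D)) =
     L * (eta * P + eta * (h * p) + eta * (h * z)).
    transitivity (eta * (2 * (L / 2 * P) + 2 * h * (h * D))); [ring|by rewrite Dh; field].
  rewrite (_ : 3 * L * Q = L * (3 * Q)); last ring.
  apply: ler_wpM2l => //; lra.
have e6 : 2 * (r * (a + b - 2 * c)) <= (K + L) * Q.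
  apply: (@le_trans _ _ (2 * (z / 2 * (K / 4 * P + L * z)))); first by rewrite ler_pM2l.
  have -> : 2 * (z / 2 * (K / 4 * P + L * z)) = K / 4 * (z * P) + L * Z by rewrite ZE; field.
  have := ler_wpM2l K0 t7; have := ler_wpM2l L0 Q3; have := mulr_ge0 K0 Q0; lra.
have e7 : h ^+ 2 * ((a - m) + (b - m) + 4 * (c - m)) <= 6 * L * Q.
  apply: (@le_trans _ _ (h ^+ 2 * (6 * D))).
    by rewrite ler_wpM2l ?sqr_ge0// /D; lra.
  have -> : h ^+ 2 * (6 * D) = 3 * L * (h * p + h * z).
    transitivity (6 * h * (h * D)); [ring|by rewrite Dh; field].
  have := ler_wpM2l L0 t8; have := ler_wpM2l L0 t9; lra.
lra.
Qed.

Variable d : nat.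
Implicit Types x y z : 'rV[R]_d.

(** Second difference about the midpoint of [x1] and [x2], then the Lipschitz bound from the
    midpoint to [x3]. *)
Lemma three_point_le (g : 'rV[R]_d -> R) (K L : R) :
  (forall y z, g (y + z) + g (y - z) - 2 * g y <= K * enorm z ^+ 2) ->
  (forall y z, `|g y - g z| <= L * enorm (y - z)) ->
  forall x1 x2 x3, g x1 + g x2 - 2 * g x3 <=
    K / 4 * enorm (x1 - x2) ^+ 2 + L * enorm (x1 + x2 - 2 *: x3).
Proof.
move=> gK gL x1 x2 x3.
pose mid := 2^-1 *: (x1 + x2); pose e := 2^-1 *: (x1 - x2).
have E1 : mid + e = x1 by apply/rowP => i; rewrite !mxE; field.
have E2 : mid - e = x2 by apply/rowP => i; rewrite !mxE; field.
have := gK mid e; rewrite E1 E2 enormZ exprMn real_normK ?num_real//.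
have := gL mid x3; have -> : mid - x3 = 2^-1 *: (x1 + x2 - 2 *: x3).
  by apply/rowP => i; rewrite !mxE; field.
have n2 : `|2^-1 : R| = 2^-1 by rewrite ger0_norm ?invr_ge0.
rewrite enormZ n2 ler_norml => /andP[_ H1] H2.
rewrite (_ : 2^-1 ^+ 2 = 4^-1 :> R) in H2; last by field.
lra.
Qed.

Lemma three_point_norm_le (g : 'rV[R]_d -> R) (K L : R) :
  (forall y z, `|g (y + z) + g (y - z) - 2 * g y| <= K * enorm z ^+ 2) ->
  (forall y z, `|g y - g z| <= L * enorm (y - z)) ->
  forall x1 x2 x3, `|g x1 + g x2 - 2 * g x3| <=
    K / 4 * enorm (x1 - x2) ^+ 2 + L * enorm (x1 + x2 - 2 *: x3).
Proof.
move=> gK gL x1 x2 x3; rewrite ler_norml; apply/andP; split; last first.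
  by apply: three_point_le => // y z; apply: le_trans (ler_norm _) (gK y z).
have H : - g x1 + - g x2 - 2 * - g x3 <=
    K / 4 * enorm (x1 - x2) ^+ 2 + L * enorm (x1 + x2 - 2 *: x3).
  apply: (@three_point_le (fun x => - g x)) => y z; last by rewrite -opprD normrN gL.
  by have := gK y z; rewrite ler_norml; lra.
lra.
Qed.

End SemiconcavityAtMesoscopicScale.

Section ThreeRates.
Variable R : realType.
Implicit Types a b c m u D : R.

Lemma excess_le a b c D : 0 <= D -> `|a - b| <= D -> `|a - c| <= D -> `|b - c| <= D ->
  let m := Num.min a (Num.min b c) in [/\ a - m <= D, b - m <= D & c - m <= D].
Proof.
move=> D0; rewrite !ler_norml => /andP[ab1 ab2] /andP[ac1 ac2] /andP[bc1 bc2] m.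
by split; rewrite lerBlDr -lerBlDl !le_min; apply/and3P; split; lra.
Qed.

Lemma three_rates_le a b c m u : 0 <= m -> a <= u -> b <= u -> c <= u ->
  a + b + c - 2 * m <= 3 * u.
Proof. lra. Qed.

End ThreeRates.

Section ThreePointEstimate.
Variables (R : realType) (d : nat).
Implicit Types (x y z : 'rV[R]_d) (k l : 'I_d * bool).
Variables (T N h M L K : R) (q : 'rV[R]_d -> R) (w w' : R -> 'rV[R]_d -> R).
Hypothesis sol : scheme_solution T N h M L K q w w'.

Let h0 : 0 < h := sol_h sol.
Let T0 : 0 < T := sol_T sol.
Let L0 : 0 <= L := sol_L sol.
Let K0 : 0 <= K := sol_K sol.
Let N0 : 0 <= N. Proof. by rewrite (le_trans _ (sol_N sol)). Qed.

Variables (eta dl p0 : R).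
Hypotheses (eta0 : 0 <= eta) (dl0 : 0 < dl) (hp0 : h <= p0) (etap0 : eta * p0 = h)
  (hdl : h * p0 <= dl ^+ 2).

(* Estimating V / Q, rather than V, turns the bound at the single triple (x + y, x - y, x)
   with |y| = p0 into a maximum principle over all triples; eta P pays for the separate
   jumps of the first two points when they are closer than p0. *)
Let V (f : 'rV[R]_d -> R) (X : 'rV[R]_d * 'rV[R]_d * 'rV[R]_d) := f X.1.1 + f X.1.2 - 2 * f X.2.

Let Q (X : 'rV[R]_d * 'rV[R]_d * 'rV[R]_d) :=
  let P := enorm (X.1.1 - X.1.2) ^+ 2 in
  dl ^+ 2 + P ^+ 2 + eta * P + enorm (X.1.1 + X.1.2 - 2 *: X.2) ^+ 2.

Let Q_gt0 X : 0 < Q X.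
Proof.
rewrite /Q; have : 0 < dl ^+ 2 by rewrite exprn_gt0.
have := sqr_ge0 (enorm (X.1.1 - X.1.2)).
have := sqr_ge0 (enorm (X.1.1 - X.1.2) ^+ 2).
have := sqr_ge0 (enorm (X.1.1 + X.1.2 - 2 *: X.2)).
have := mulr_ge0 eta0 (sqr_ge0 (enorm (X.1.1 - X.1.2))).
lra.
Qed.

(** Young against the constant part [dl ^+ 2] of the weight. The factor [1 / dl] is recovered in the
    end, because [Q] is of order [dl ^+ 2] at the triple of interest. *)
Let weight_le X : K / 4 * enorm (X.1.1 - X.1.2) ^+ 2 + L * enorm (X.1.1 + X.1.2 - 2 *: X.2)
  <= (K + L) / dl * Q X.
Proof.
set p := enorm _; set z := enorm _.
rewrite [leRHS]mulrAC ler_pdivlMr//.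
have H1 : 2 * (p ^+ 2 * dl) <= Q X.
  have := sqr_ge0 (p ^+ 2 - dl); rewrite sqrrB => H.
  have := sqr_ge0 z; have : 0 <= eta * p ^+ 2 by rewrite mulr_ge0 ?sqr_ge0.
  by rewrite /Q -/p -/z; move: H; rewrite -[in X in X -> _]mulr_natl; lra.
have H2 : 2 * (z * dl) <= Q X.
  have := sqr_ge0 (z - dl); rewrite sqrrB => H.
  have := sqr_ge0 (p ^+ 2); have : 0 <= eta * p ^+ 2 by rewrite mulr_ge0 ?sqr_ge0.
  by rewrite /Q -/p -/z; move: H; rewrite -[in X in X -> _]mulr_natl; lra.
have := ler_wpM2l K0 H1; have := ler_wpM2l L0 H2.
have := mulr_ge0 K0 (ltW (Q_gt0 X)); have := mulr_ge0 L0 (ltW (Q_gt0 X)).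
by rewrite !mulrDl; lra.
Qed.

Let terminal_le X : V (w T) X <= (K + L) / dl * Q X.
Proof.
apply: le_trans (weight_le X); rewrite /V !(sol_terminal sol).
exact: three_point_le (sol_qsc sol) (sol_qlip sol) _ _ _.
Qed.

Let lam := 2 * d%:R * (36 * L + K).
Let kap := 2 * d%:R * (6 * N / h).

(* All three points jump together at the smallest of the three rates, and separately at the
   excess rates. *)
Let derive_le t X S : 0 < t < T -> 0 <= S -> (forall Y, V (w t) Y <= S * Q Y) ->
  - V (w' t) X <= kap * (S * Q X - V (w t) X) + lam * (S * Q X) + (K + L) / dl * Q X.
Proof.
move=> tT S0 VS; case: X => [[x1 x2] x3].
have [C [F [[CF Clip Flip Csc Fsc] eqx ley]]] := sol_scheme sol x3 tT.
have H1 := ley x1; have H2 := ley x2.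
have HC := three_point_norm_le Csc Clip x1 x2 x3.
have {}HC := le_trans (le_trans (ler_norm _) HC) (weight_le (x1, x2, x3)).
have HF i x y : `|F x 0 i - F y 0 i| <= L * enorm (x - y).
  by have := enorm_coord (F x - F y) i; rewrite !mxE => H; apply: le_trans H (Flip _ _).
suff Hgen : gen N h (F x1) (w t) x1 + gen N h (F x2) (w t) x2 - 2 * gen N h (F x3) (w t) x3
   <= kap * (S * Q (x1, x2, x3) - V (w t) (x1, x2, x3)) + lam * (S * Q (x1, x2, x3)).
  rewrite /V/= in HC *; rewrite /V/= in Hgen; lra.
rewrite /gen mulr_sumr -big_split -sumrB/= /kap /lam -!sum_dir_const !mulr_suml -big_split/=.
apply: ler_sum => k _; set e := step h k.
set a := rate _ _ (F x1) k; set b := rate _ _ (F x2) k; set c := rate _ _ (F x3) k.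
pose m := Num.min a (Num.min b c).
have ma : m <= a by rewrite ge_min lexx.
have mb : m <= b by rewrite !ge_min lexx orbT.
have mc : m <= c by rewrite !ge_min lexx !orbT.
have [_ FN1] := CF x1; have [_ FN2] := CF x2; have [_ FN3] := CF x3.
have a0 : 0 <= a by exact: rate_ge0.
have b0 : 0 <= b by exact: rate_ge0.
have c0 : 0 <= c by exact: rate_ge0.
have m0 : 0 <= m by rewrite !le_min a0 b0.
have aN : a <= 2 * N / h by exact: rate_le.
have bN : b <= 2 * N / h by exact: rate_le.
have cN : c <= 2 * N / h by exact: rate_le.
set v := w t; set X := (x1, x2, x3).
have J := VS (x1 + e, x2 + e, x3 + e); have J1 := VS (x1 + e, x2, x3).
have J2 := VS (x1, x2 + e, x3); have J3 := VS (x1, x2, x3 + e).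
(* The point of the coupling: the joint jump does not move the weight. *)
have QJ : Q (x1 + e, x2 + e, x3 + e) = Q X.
  rewrite /Q/=; have -> : x1 + e - (x2 + e) = x1 - x2 by apply/rowP => i; rewrite !mxE; ring.
  by have -> : x1 + e + (x2 + e) - 2 *: (x3 + e) = x1 + x2 - 2 *: x3
    by apply/rowP => i; rewrite !mxE; ring.
set p := enorm (x1 - x2); set z := enorm (x1 + x2 - 2 *: x3).
pose P := p ^+ 2; pose Z := z ^+ 2.
pose q0 := dotv (x1 - x2) e; pose r0 := dotv (x1 + x2 - 2 *: x3) e.
have eh : enorm e ^+ 2 = h ^+ 2 by rewrite (enorm_step _ (ltW h0)).
have QX : Q X = dl ^+ 2 + P ^+ 2 + eta * P + Z by [].
have Q1 : Q (x1 + e, x2, x3) = dl ^+ 2 + (P + 2 * q0 + h ^+ 2) ^+ 2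
    + eta * (P + 2 * q0 + h ^+ 2) + (Z + 2 * r0 + h ^+ 2).
  by rewrite /Q/= [x1 + e - x2]addrAC [x1 + e + x2]addrAC [x1 + x2 + e - _]addrAC (enorm_sqrD (x1 - x2)) (enorm_sqrD (x1 + x2 - _)) eh.
have Q2 : Q (x1, x2 + e, x3) = dl ^+ 2 + (P - 2 * q0 + h ^+ 2) ^+ 2
    + eta * (P - 2 * q0 + h ^+ 2) + (Z + 2 * r0 + h ^+ 2).
  rewrite /Q/= opprD !addrA [x1 + x2 + e - _]addrAC (enorm_sqrD (x1 - x2)) (enorm_sqrD (x1 + x2 - _)) dotvNr enormN eh.
  rewrite mulrN /P /Z /q0 /r0 /p /z; ring.
have Q3 : Q (x1, x2, x3 + e) = dl ^+ 2 + P ^+ 2 + eta * P + (Z - 4 * r0 + 4 * h ^+ 2).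
  have e2 : enorm (- (2 *: e)) ^+ 2 = 4 * h ^+ 2.
    by rewrite enormN (enormZ 2 e) ger0_norm// -eh; ring.
  rewrite /Q/= scalerDr opprD !addrA (enorm_sqrD (x1 + x2 - _)) e2 dotvNr (dotvZr 2).
  by rewrite /P /Z /r0 /p /z; ring.
have p0' : 0 <= p by exact: enorm_ge0.
have z0 : 0 <= z by exact: enorm_ge0.
have x13 : enorm (x1 - x3) <= (p + z) / 2.
  have -> : x1 - x3 = 2^-1 *: ((x1 - x2) + (x1 + x2 - 2 *: x3)).
    by apply/rowP => i; rewrite !mxE; field.
  rewrite enormZ ger0_norm ?invr_ge0// mulrC ler_wpM2r ?invr_ge0//; exact: enormD.
have x23 : enorm (x2 - x3) <= (p + z) / 2.
  have -> : x2 - x3 = 2^-1 *: ((x2 - x1) + (x1 + x2 - 2 *: x3)).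
    by apply/rowP => i; rewrite !mxE; field.
  rewrite enormZ ger0_norm ?invr_ge0// mulrC ler_wpM2r ?invr_ge0// /p enormB; exact: enormD.
pose D := L * (p + z) / (2 * h).
have h2 : 0 < 2 * h by rewrite mulr_gt0.
have rd y1 y2 u : enorm (y1 - y2) <= u ->
    `|rate N h (F y1) k - rate N h (F y2) k| <= L * u / (2 * h).
  move=> yu; apply: (le_trans (rate_lip N _ _ k h0)).
  apply: ler_wpM2r; first by rewrite invr_ge0 ltW.
  by apply: (le_trans (Flip _ _)); apply: ler_wpM2l.
have D0 : 0 <= D by rewrite /D; ge0.
have Dmono u : u <= p + z -> L * u / (2 * h) <= D.
  by move=> upz; rewrite ler_wpM2r ?invr_ge0 ?(ltW h2)// ler_wpM2l.
have ab := rd _ _ _ (lexx p).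
have hpz : (p + z) / 2 <= p + z by rewrite ler_pdivrMr// mulr_natr mulr2n lerDl addr_ge0.
have ab' : `|a - b| <= D by apply: le_trans ab _; apply: Dmono; rewrite lerDl.
have ac : `|a - c| <= D by apply: le_trans (rd _ _ _ x13) _; exact: Dmono.
have bc : `|b - c| <= D by apply: le_trans (rd _ _ _ x23) _; exact: Dmono.
have [am bm cm] := excess_le D0 ab' ac bc.
have abc : `|a + b - 2 * c| <= (K / 4 * P + L * z) / (2 * h).
  have -> : a + b - 2 * c = sgb k.2 * (F x1 0 k.1 + F x2 0 k.1 - 2 * F x3 0 k.1) / (2 * h).
    by rewrite /a /b /c /rate; field; rewrite gt_eqF.
  rewrite !normrM norm_sgb mul1r normfV (gtr0_norm h2).
  apply: ler_wpM2r; first by rewrite invr_ge0 ltW.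
  exact: (three_point_norm_le (g := fun x => F x 0 k.1) (fun y z => Fsc y z k.1) (HF k.1) x1 x2 x3).
have qh : `|q0| <= h * p.
  by rewrite mulrC -[h in leRHS](enorm_step k (ltW h0)) norm_dotv_le.
have rh : `|r0| <= h * z.
  by rewrite mulrC -[h in leRHS](enorm_step k (ltW h0)) norm_dotv_le.
have := coupled_quartic_bound L0 K0 h0 (ltW (sol_h1 sol)) hp0 etap0 eta0 hdl p0' z0
  erefl erefl qh rh ma mb mc ab abc am bm cm.
rewrite -/P -/Z -QX; set S1 := (X in X <= _ -> _) => HS1.
have VX := VS X.
have {}HS1 := ler_wpM2l S0 HS1.
have m1 := ler_wpM2l m0 J.
have m2 := @ler_wpM2l _ (a - m) _ _ _ J1.
have m3 := @ler_wpM2l _ (b - m) _ _ _ J2.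
have m4 := @ler_wpM2l _ (c - m) _ _ _ J3.
rewrite !subr_ge0 in m2 m3 m4.
have {}m2 := m2 ma; have {}m3 := m3 mb; have {}m4 := m4 mc.
(* The sum [m + (a - m) + (b - m) + (c - m)] is the total rate of the coupled jumps in one
   direction; it is at most three times the bound [2 * N / h] on a single rate. *)
have m5 : (a + b + c - 2 * m) * (S * Q X - V v X) <= 6 * N / h * (S * Q X - V v X).
  apply: ler_wpM2r; first by rewrite subr_ge0.
  by rewrite (_ : 6 * N / h = 3 * (2 * N / h)); [exact: three_rates_le|ring].
rewrite QJ Q1 Q2 Q3 /V/= -/v in m1 m2 m3 m4.
rewrite /V/= in m5 VX; rewrite /V/=.
have -> : (36 * L + K) * (S * Q X) = S * ((36 * L + K) * Q X) by ring.
apply: le_trans (lerD m5 HS1).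
(* The four bounds, weighted by the rates of the joint and of the separate jumps, add up to the
   claim; the rest is a polynomial identity. *)
have := lerD (lerD (lerD m1 m2) m3) m4.
rewrite -subr_ge0; set E1 := (X in 0 <= X -> _) => HE1.
rewrite -subr_ge0; set E2 := (X in 0 <= X).
have -> : E2 = E1 by rewrite /E1 /E2 /S1 QX; ring.
exact: HE1.
Qed.

Let three_point t X : 0 <= t <= T -> V (w t) X <= expR ((lam + 1) * T) * ((K + L) / dl) * Q X.
Proof.
move=> tT; rewrite -ler_pdivrMr//.
rewrite -[X in expR _ * X]maxxx.
have [B wB] := sol_bounded sol.
apply: (@maximum_principle R T _ (fun t X => V (w t) X / Q X) (fun t X => V (w' t) X / Q X)
  ((4 * `|B|) / dl ^+ 2) ((K + L) / dl) ((K + L) / dl) kap lam) => //.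
- move=> s Y sT; rewrite /V.
  have := wB s Y.1.1 sT; have := wB s Y.1.2 sT; have := wB s Y.2 sT.
  rewrite !ler_norml => /andP[w1 w2] /andP[w3 w4] /andP[w5 w6].
  have dQ : dl ^+ 2 <= Q Y.
    have := sqr_ge0 (enorm (Y.1.1 - Y.1.2)) => HH; have := mulr_ge0 eta0 HH.
    have := sqr_ge0 (enorm (Y.1.1 - Y.1.2) ^+ 2).
    have := sqr_ge0 (enorm (Y.1.1 + Y.1.2 - 2 *: Y.2)).
    by rewrite /Q; lra.
  apply: (@le_trans _ _ (4 * `|B| / Q Y)).
    by rewrite ler_pM2r ?invr_gt0//; have := ler_norm B; lra.
  by rewrite ler_wpM2l ?mulr_ge0// lef_pV2 ?posrE ?exprn_gt0.
- move=> Y s; apply: cvgM; last exact: cvg_cst.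
  apply: cvgB; last by apply: cvgM; [exact: cvg_cst|exact: (sol_continuous sol)].
  by apply: cvgD; exact: (sol_continuous sol).
- move=> s Y sT; rewrite /V; have d1 := sol_derive sol Y.1.1 sT.
  have d2 := sol_derive sol Y.1.2 sT; have d3 := sol_derive sol Y.2 sT.
  by apply: is_derive_eq; rewrite /GRing.scale/=; ring.
- by ge0.
- by rewrite /kap; ge0.
- by rewrite /lam; ge0.
- by move=> Y; rewrite ler_pdivrMr.
move=> s Y S sT S0 VS.
have VS' Z : V (w s) Z <= S * Q Z by have := VS Z; rewrite ler_pdivrMr.
rewrite -mulNr ler_pdivrMr// (le_trans (derive_le Y sT S0 VS'))// le_eqVlt.
by apply/orP; left; apply/eqP; field; rewrite !gt_eqF.
Qed.

(** At the triple [(x + y, x - y, x)] the last term of [Q] vanishes and the others are [dl ^+ 2],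
    [16 * p0 ^+ 4] and [4 * h * p0], at most 1, 16 and 4 times [dl ^+ 2]; hence 21. *)
Lemma scheme_second_difference_aux t x y : 0 <= t <= T -> enorm y = p0 -> p0 ^+ 2 <= dl ->
  w t (x + y) + w t (x - y) - 2 * w t x <= 21 * expR ((lam + 1) * T) * (K + L) * dl.
Proof.
move=> tT yp pd; have := three_point (x + y, x - y, x) tT; rewrite /V/= => H.
apply: le_trans H _.
have -> : 21 * expR ((lam + 1) * T) * (K + L) * dl =
   expR ((lam + 1) * T) * ((K + L) / dl) * (21 * dl ^+ 2) by field; rewrite gt_eqF.
apply: ler_wpM2l; first by ge0.
rewrite /Q/=.
have -> : x + y - (x - y) = 2 *: y by apply/rowP => i; rewrite !mxE; ring.
have -> : x + y + (x - y) - 2 *: x = 0 by apply/rowP => i; rewrite !mxE; ring.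
rewrite enorm0 enormZ yp ger0_norm//.
have e1 : eta * (2 * p0) ^+ 2 = 4 * (h * p0) by rewrite -etap0; ring.
have p4 : ((2 * p0) ^+ 2) ^+ 2 <= 16 * dl ^+ 2.
  have -> : ((2 * p0) ^+ 2) ^+ 2 = 16 * (p0 ^+ 2) ^+ 2 by ring.
  by rewrite ler_pM2l// lerXn2r ?nnegrE ?sqr_ge0// ltW.
rewrite e1 expr0n/= addr0.
rewrite [leRHS](_ : _ = dl ^+ 2 + 16 * dl ^+ 2 + 4 * dl ^+ 2); last by ring.
by rewrite !lerD// ler_pM2l.
Qed.

End ThreePointEstimate.

Definition sc_const (R : realType) (d : nat) (T L K : R) : R :=
  21 * expR ((2 * d%:R * (36 * L + K) + 1) * T) * (K + L).

(** Takes for [dl], up to a constant factor, the smallest value allowed by the two constraints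
    [p0 ^+ 2 <= dl] and [h * p0 <= dl ^+ 2] at [p0 = enorm y]. *)
Lemma scheme_second_difference (R : realType) (d : nat) (T N h M L K : R)
    (q : 'rV[R]_d -> R) (w w' : R -> 'rV[R]_d -> R) t x y :
  scheme_solution T N h M L K q w w' -> 0 <= t <= T -> h <= enorm y ->
  w t (x + y) + w t (x - y) - 2 * w t x <=
    sc_const d T L K * (enorm y ^+ 2 + Num.sqrt (h * enorm y)).
Proof.
move=> sol tT hy; have h0 := sol_h sol.
have y0 : 0 < enorm y by exact: lt_le_trans hy.
have hy0 : 0 <= h * enorm y by rewrite mulr_ge0 ?ltW.
have s0 := sqrtr_ge0 (h * enorm y).
have y2 : 0 < enorm y ^+ 2 by rewrite exprn_gt0.
apply: (scheme_second_difference_aux sol (eta := h / enorm y) (p0 := enorm y)) => //.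
- by rewrite divr_ge0 ?ltW.
- by rewrite ltr_pwDl.
- by rewrite divfK ?gt_eqF.
- rewrite -[leLHS](sqr_sqrtr hy0); apply: lerXn2r; rewrite ?nnegrE ?addr_ge0 ?sqr_ge0//.
  by rewrite lerDr sqr_ge0.
- by rewrite lerDl.
Qed.

(** * Second differences of a single step: order h^(3/2) *)

Section AxisSemiconcavity.
Variables (R : realType) (d : nat).
Implicit Types (x y z : 'rV[R]_d) (j k l : 'I_d * bool).

(** One rate may vanish, but not two at once: opposite rates add up to [2 * N / h], and on different
    axes the Euclidean bound on [F] gives [|F_j| + |F_l| <= 2 * sqrt 2 * N <= 3 * N]. *)
Lemma axis_rates_ge (N h : R) (F : 'rV[R]_d) j l : 0 < h -> 0 <= N -> enorm F <= 2 * N ->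
  l != j -> N / (2 * h) <= rate N h F j + rate N h F l.
Proof.
move=> h0 N0 FN lj.
have h2 : 0 < 2 * h by rewrite mulr_gt0.
have [ij|ij] := eqVneq l.1 j.1.
  have -> : l = opdir j.
    case: l j lj ij {FN} => [i b] [i' b'] /= + ij; rewrite ij /opdir/=.
    by case: b b' => [] []; rewrite ?eqxx.
  rewrite rate_opdir ler_pdivrMr// (_ : 2 * N / h * (2 * h) = 4 * N); first lra.
  by field; rewrite gt_eqF.
have Fs : F 0 j.1 ^+ 2 + F 0 l.1 ^+ 2 <= (2 * N) ^+ 2.
  apply: (@le_trans _ _ (enorm F ^+ 2)); last by rewrite lerXn2r ?nnegrE ?enorm_ge0 ?mulr_ge0.
  rewrite enorm_sqr /dotv (bigD1 j.1)//= (bigD1 l.1)//= addrA -!expr2 lerDl.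
  by apply: sumr_ge0 => i _; rewrite -expr2 sqr_ge0.
rewrite /rate ler_pdivrMr//.
have -> : (N / h + sgb j.2 * F 0 j.1 / (2 * h) + (N / h + sgb l.2 * F 0 l.1 / (2 * h))) * (2 * h)
  = 4 * N + (sgb j.2 * F 0 j.1 + sgb l.2 * F 0 l.1) by field; rewrite gt_eqF.
have : (sgb j.2 * F 0 j.1 + sgb l.2 * F 0 l.1) ^+ 2 <= (3 * N) ^+ 2.
  have := sqr_ge0 (sgb j.2 * F 0 j.1 - sgb l.2 * F 0 l.1); rewrite sqrrB sqrrD.
  rewrite !exprMn !(expr2 (sgb _)) !sgb_sqr !mul1r.
  have : 0 <= N ^+ 2 by rewrite sqr_ge0.
  rewrite exprMn in Fs; lra.
rewrite -ler_sqrt ?sqr_ge0// !sqrtr_sqr (ger0_norm (mulr_ge0 _ N0))// ler_norml => /andP[H _].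
by rewrite -subr_ge0; lra.
Qed.

Lemma absorb_linear (L m N h a : R) : 0 < m -> 1 <= N -> 0 < h ->
  L * `|a| - m * (N / (4 * h) * a ^+ 2) <= L ^+ 2 * (h / m).
Proof.
move=> m0 N1 h0; rewrite -real_normK ?num_real//; set b := `|a|.
pose c := m / (4 * h); have c0 : 0 < c by rewrite divr_gt0// mulr_gt0.
have -> : L ^+ 2 * (h / m) = L ^+ 2 / (4 * c) by rewrite /c; field; rewrite !gt_eqF.
have H : c * b ^+ 2 <= m * (N / (4 * h) * b ^+ 2).
  have -> : m * (N / (4 * h) * b ^+ 2) = N * (c * b ^+ 2) by rewrite /c; field; rewrite gt_eqF.
  by rewrite ler_peMl// mulr_ge0 ?sqr_ge0// ltW.
apply: (@le_trans _ _ (L * b - c * b ^+ 2)); first by rewrite lerB.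
have c4 : 0 < 4 * c by rewrite mulr_gt0.
rewrite ler_pdivlMr// -subr_ge0.
have -> : L ^+ 2 - (L * b - c * b ^+ 2) * (4 * c) = (L - 2 * c * b) ^+ 2 by ring.
exact: sqr_ge0.
Qed.

Variables (T N h M L K : R) (q : 'rV[R]_d -> R) (w w' : R -> 'rV[R]_d -> R).
Hypothesis sol : scheme_solution T N h M L K q w w'.

Let h0 : 0 < h := sol_h sol.
Let T0 : 0 < T := sol_T sol.
Let L0 : 0 <= L := sol_L sol.
Let K0 : 0 <= K := sol_K sol.
Let N1 : 1 <= N := sol_N sol.
Let N0 : 0 <= N. Proof. by rewrite (le_trans _ N1). Qed.
Let G := lip_step d T L.
Let G0 : 0 <= G. Proof. exact: lip_step_ge0 sol. Qed.

Section FrozenTime.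
Variables (t : R) (tT : 0 < t < T).
Let tT' : 0 <= t <= T. Proof. by case/andP: tT => ? ?; rewrite !ltW. Qed.
Let p k x := w t (x + step h k) - w t x.
Let A x j l := w t (x + step h j + step h l) - w t (x + step h j) - w t (x + step h l) + w t x.

Let AC x j l : A x j l = A x l j.
Proof. by rewrite /A [x + step h j + _]addrAC; ring. Qed.

Let AE x j l : A x j l = p j (x + step h l) - p j x.
Proof. by rewrite /A /p [x + step h j + _]addrAC; ring. Qed.

Let p_bound k x : `|p k x| <= G * h.
Proof. exact: (scheme_lip_step sol). Qed.

Variables (C : 'rV[R]_d -> R) (F : 'rV[R]_d -> 'rV[R]_d) (x : 'rV[R]_d).
Hypotheses (CF : coeff_bounds N M L K C F)
  (eqx : - w' t x = C x + gen N h (F x) (w t) x)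
  (ley : forall y, - w' t y <= C y + gen N h (F y) (w t) y).
Let r l := rate N h (F x) l.

Let FN y : enorm (F y) <= 2 * N. Proof. by case: CF => H _ _ _ _; case: (H y). Qed.

Let rate_step y z l : `|rate N h (F y) l - rate N h (F z) l| <= L * enorm (y - z) / (2 * h).
Proof.
case: CF => _ _ Flip _ _; apply: (le_trans (rate_lip N _ _ l h0)).
by apply: ler_wpM2r; rewrite ?Flip// invr_ge0 mulr_ge0// ltW.
Qed.

Let shift_enorm k : enorm (x + step h k - x) = h.
Proof. by rewrite addrAC subrr add0r (enorm_step _ (ltW h0)). Qed.

(** Unlike in [increment_inequality], the rates are those at [x], common to all [j]; this is what
    allows the dissipation to be symmetrised in [j] and [l]. *)
Let increment_le j : - (w' t (x + step h j) - w' t x) <=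
  (L + d%:R * L * G) * h + \sum_l r l * A x j l.
Proof.
have [_ Clip _ _ _] := CF; have eqx' := eqx.
have := Clip (x + step h j) x; rewrite shift_enorm ler_norml => /andP[_ HC].
have H := ley (x + step h j).
suff Hg : gen N h (F (x + step h j)) (w t) (x + step h j) - gen N h (F x) (w t) x
    <= \sum_l r l * A x j l + d%:R * L * G * h by lra.
have -> : d%:R * L * G * h = \sum_(l : 'I_d * bool) L / 2 * (G * h).
  by rewrite sum_dir_const; field.
rewrite /gen -sumrB -big_split/=; apply: ler_sum => l _.
have := rate_step (x + step h j) x l; rewrite shift_enorm.
have -> : L * h / (2 * h) = L / 2 by field; rewrite gt_eqF.
rewrite -/(r l); set a := rate _ _ _ _ => ar.
have -> : a * (w t (x + step h j + step h l) - w t (x + step h j)) -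
    r l * (w t (x + step h l) - w t x) = r l * A x j l + (a - r l) * p l (x + step h j).
  by rewrite /A /p; ring.
rewrite lerD2l (le_trans (ler_norm _))// normrM ler_pM//.
Qed.

(** The shift by [G * h] makes the increments nonnegative: [increment_le] is one-sided and can only
    be multiplied by a nonnegative factor. *)
Let Theta y := \sum_j (p j y + G * h) ^+ 2.

Let p_shift j y : 0 <= p j y + G * h <= 2 * (G * h).
Proof. by have := p_bound j y; rewrite ler_norml => /andP[? ?]; apply/andP; split; lra. Qed.

Let dissipation := \sum_j \sum_(l | l != j) N / (4 * h) * A x j l ^+ 2.

(** As [A] is symmetric in [j] and [l], the rate [r l] may be replaced by the mean of [r j] and
    [r l], which [axis_rates_ge] bounds from below off the diagonal. The diagonal entries remain
    uncontrolled. *)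
Let dissipation_le : dissipation <= \sum_j \sum_l r l * A x j l ^+ 2.
Proof.
have E : \sum_j \sum_l r l * A x j l ^+ 2 = \sum_j \sum_l r j * A x j l ^+ 2.
  by rewrite exchange_big/=; apply: eq_bigr => j _; apply: eq_bigr => l _; rewrite AC.
have -> : \sum_j \sum_l r l * A x j l ^+ 2 =
    \sum_j \sum_l (r j + r l) / 2 * A x j l ^+ 2.
  have -> : \sum_j \sum_l (r j + r l) / 2 * A x j l ^+ 2 =
     (\sum_j \sum_l r j * A x j l ^+ 2 + \sum_j \sum_l r l * A x j l ^+ 2) / 2.
    rewrite -big_split mulr_suml/=; apply: eq_bigr => j _.
    by rewrite -big_split mulr_suml/=; apply: eq_bigr => l _; field.
  by rewrite -E; field.
apply: ler_sum => j _; rewrite [leRHS](bigID (fun l => l != j))/=.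
rewrite -[leLHS]addr0; apply: lerD.
  apply: ler_sum => l lj; apply: ler_wpM2r; first exact: sqr_ge0.
  have := axis_rates_ge h0 N0 (FN x) lj; rewrite -/(r j) -/(r l).
  have -> : N / (4 * h) = N / (2 * h) / 2 by field; rewrite gt_eqF.
  by move=> H; rewrite ler_pM2r ?invr_gt0.
apply: sumr_ge0 => l _; rewrite mulr_ge0 ?sqr_ge0// divr_ge0// addr_ge0//; exact: rate_ge0.
Qed.

(** Chain rule for a jump generator: [2 * b * (b' - b) = b' ^+ 2 - b ^+ 2 - (b' - b) ^+ 2], where
    the last square is the dissipation. *)
Let Theta_le : - (\sum_j 2 * (p j x + G * h) * (w' t (x + step h j) - w' t x)) <=
  8 * d%:R * G * (L + d%:R * L * G) * h ^+ 2
  + \sum_l r l * (Theta (x + step h l) - Theta x) - dissipation.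
Proof.
have H : - (\sum_j 2 * (p j x + G * h) * (w' t (x + step h j) - w' t x)) <=
    \sum_j (4 * (G * h) * ((L + d%:R * L * G) * h)
      + \sum_l r l * ((p j (x + step h l) + G * h) ^+ 2 - (p j x + G * h) ^+ 2)
      - \sum_l r l * A x j l ^+ 2).
  rewrite -sumrN; apply: ler_sum => j _; have /andP[b1 b2] := p_shift j x.
  set b := p j x + G * h in b1 b2 *; rewrite -mulrN.
  apply: (@le_trans _ _ (2 * b * ((L + d%:R * L * G) * h + \sum_l r l * A x j l))).
    by apply: ler_wpM2l; [rewrite mulr_ge0|exact: increment_le].
  rewrite mulrDr -addrA; apply: lerD.
    apply: ler_wpM2r; last by lra.
    by rewrite mulr_ge0 ?(ltW h0)// addr_ge0// !mulr_ge0.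
  rewrite mulr_sumr -sumrB; apply: ler_sum => l _.
  rewrite AE le_eqVlt; apply/orP; left; apply/eqP; rewrite /b; ring.
apply: (le_trans H); rewrite sumrB big_split/= sum_dir_const.
have -> : \sum_j \sum_l r l * ((p j (x + step h l) + G * h) ^+ 2 - (p j x + G * h) ^+ 2)
  = \sum_l r l * (Theta (x + step h l) - Theta x).
  rewrite exchange_big/=; apply: eq_bigr => l _.
  by rewrite /Theta -sumrB mulr_sumr.
apply: lerB; last exact: dissipation_le.
rewrite lerD2r le_eqVlt; apply/orP; left; apply/eqP; ring.
Qed.

Variable k : 'I_d * bool.
Let W y := w t (y + step h k) + w t (y - step h k) - 2 * w t y.
(** The rates are modified in the directions [k] and [opdir k] so that the diagonal differences
    [A x k k] and [A x (opdir k) (opdir k)], which the dissipation does not control, cancel from the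
    error of [W_le]. *)
Let rho l := if l == k then rate N h (F (x + step h k)) l
             else if l == opdir k then rate N h (F (x - step h k)) l else r l.

Let opdir_neq : opdir k != k.
Proof. by case: k => i b; rewrite /opdir/= xpair_eqE eqxx/=; case: b. Qed.

Let rho_ge0 l : 0 <= rho l.
Proof. by rewrite /rho; case: ifP => _; [|case: ifP => _]; exact: rate_ge0. Qed.

Let rho_le l : rho l <= 2 * N / h.
Proof. by rewrite /rho; case: ifP => _; [|case: ifP => _]; exact: rate_le. Qed.

Let shift_enormB : enorm (x - step h k - x) = h.
Proof. by rewrite addrAC subrr add0r enormN (enorm_step _ (ltW h0)). Qed.

Let rho_r l : `|r l - rho l| <= L / 2.
Proof.
have E : L * h / (2 * h) = L / 2 by field; rewrite gt_eqF.
rewrite distrC /rho; case: ifP => _; [|case: ifP => _].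
- by have := rate_step (x + step h k) x l; rewrite shift_enorm E.
- by have := rate_step (x - step h k) x l; rewrite shift_enormB E.
- by rewrite subrr normr0 divr_ge0.
Qed.

Let cross := \sum_(l | l != k) `|A x k l| + \sum_(l | l != opdir k) `|A x (opdir k) l|.

Let W_le : - (w' t (x + step h k) + w' t (x - step h k) - 2 * w' t x) <=
  (K + d%:R * K * G) * h ^+ 2 + \sum_l rho l * (W (x + step h l) - W x) + L * cross.
Proof.
have [_ _ _ Csc Fsc] := CF; have eqx' := eqx.
have := Csc x (step h k); rewrite (enorm_step _ (ltW h0)) ler_norml => /andP[_ HC].
have H1 := ley (x + step h k); have H2 := ley (x - step h k).
suff Hg : gen N h (F (x + step h k)) (w t) (x + step h k)
   + gen N h (F (x - step h k)) (w t) (x - step h k) - 2 * gen N h (F x) (w t) x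
   <= d%:R * K * G * h ^+ 2 + \sum_l rho l * (W (x + step h l) - W x) + L * cross by lra.
have -> : d%:R * K * G * h ^+ 2 = \sum_(l : 'I_d * bool) K * h / 2 * (G * h).
  by rewrite sum_dir_const; field.
rewrite /cross !(big_mkcond (fun l => l != _))/= mulrDr !mulr_sumr.
rewrite /gen ?mulr_sumr -!big_split -sumrB/=; apply: ler_sum => l _.
set a := rate N h (F (x + step h k)) l; set b := rate N h (F (x - step h k)) l.
rewrite -/(r l).
have abr : `|a + b - 2 * r l| <= K * h / 2.
  have -> : a + b - 2 * r l = sgb l.2 *
     (F (x + step h k) 0 l.1 + F (x - step h k) 0 l.1 - 2 * F x 0 l.1) / (2 * h).
    by rewrite /a /b /r /rate; field; rewrite gt_eqF.
  rewrite !normrM norm_sgb mul1r normfV (@gtr0_norm _ (2 * h)) ?mulr_gt0//.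
  rewrite ler_pdivrMr ?mulr_gt0// (le_trans (Fsc _ _ _))// (enorm_step _ (ltW h0)).
  by rewrite le_eqVlt; apply/orP; left; apply/eqP; field.
have -> : a * (w t (x + step h k + step h l) - w t (x + step h k)) +
    b * (w t (x - step h k + step h l) - w t (x - step h k)) -
    2 * (r l * (w t (x + step h l) - w t x)) =
  (a + b - 2 * r l) * p l x + (a * A x k l + b * A x (opdir k) l).
  by rewrite /A /p step_opdir; ring.
have -> : W (x + step h l) - W x = A x k l + A x (opdir k) l.
  by rewrite /W /A step_opdir [x + step h l + _]addrAC [x + step h l - _]addrAC; ring.
rewrite -addrA; apply: lerD.
  by rewrite (le_trans (ler_norm _))// normrM ler_pM.
have ar : `|a - r l| <= L.
  apply: le_trans (rate_step _ _ _) _; rewrite shift_enorm.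
  have -> : L * h / (2 * h) = L / 2 by field; rewrite gt_eqF.
  by rewrite ler_pdivrMr// mulr_natr mulr2n lerDl.
have br : `|b - r l| <= L.
  apply: le_trans (rate_step _ _ _) _; rewrite shift_enormB.
  have -> : L * h / (2 * h) = L / 2 by field; rewrite gt_eqF.
  by rewrite ler_pdivrMr// mulr_natr mulr2n lerDl.
have ab : `|a - b| <= L.
  apply: le_trans (rate_step _ _ _) _.
  have -> : x + step h k - (x - step h k) = 2 *: step h k.
    by apply/rowP => i; rewrite !mxE; ring.
  rewrite enormZ ger0_norm// (enorm_step _ (ltW h0)) ler_pdivrMr ?mulr_gt0//.
have sub u v : `|u| <= L -> u * v <= L * `|v|.
  by move=> uL; rewrite (le_trans (ler_norm _))// normrM ler_wpM2r.
rewrite /rho; have [lk|lk] := eqVneq l k.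
  subst l; rewrite -/a eq_sym opdir_neq/= mulr0 add0r -lerBlDl.
  have -> : a * A x k k + b * A x (opdir k) k - a * (A x k k + A x (opdir k) k)
    = - (a - b) * A x (opdir k) k by ring.
  by apply: sub; rewrite normrN.
have [lk'|lk'] := eqVneq l (opdir k).
  subst l; rewrite -/b/= mulr0 addr0 -lerBlDl.
  have -> : a * A x k (opdir k) + b * A x (opdir k) (opdir k)
     - b * (A x k (opdir k) + A x (opdir k) (opdir k)) = (a - b) * A x k (opdir k) by ring.
  exact: sub.
rewrite -lerBlDl.
have -> : a * A x k l + b * A x (opdir k) l - r l * (A x k l + A x (opdir k) l)
  = (a - r l) * A x k l + (b - r l) * A x (opdir k) l by ring.
by apply: lerD; exact: sub.
Qed.

Variable m : R.
Hypothesis m0 : 0 < m.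

(** Only the rows [k] and [opdir k] occur in [cross]; they are two distinct rows of [dissipation],
    and completing the square costs at most [L ^+ 2 * (h / m)] per entry. *)
Let absorb : L * cross - m * dissipation <= 4 * d%:R * L ^+ 2 * (h / m).
Proof.
have D2 : \sum_(l | l != k) N / (4 * h) * A x k l ^+ 2
   + \sum_(l | l != opdir k) N / (4 * h) * A x (opdir k) l ^+ 2 <= dissipation.
  rewrite /dissipation [leRHS](bigD1 k)//= [X in _ <= _ + X](bigD1 (opdir k))//= addrA lerDl.
  apply: sumr_ge0 => j _; apply: sumr_ge0 => l _; rewrite mulr_ge0 ?sqr_ge0//.
  by ge0.
apply: le_trans (lerB (lexx _) (ler_wpM2l (ltW m0) D2)) _.
have part j : L * (\sum_(l | l != j) `|A x j l|)
    - m * (\sum_(l | l != j) N / (4 * h) * A x j l ^+ 2) <= 2 * d%:R * (L ^+ 2 * (h / m)).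
  rewrite -sum_dir_const !mulr_sumr -sumrB.
  rewrite [leRHS](bigID (fun l => l != j))/= -[leLHS]addr0; apply: lerD.
    by apply: ler_sum => l _; exact: absorb_linear.
  by apply: sumr_ge0 => l _; ge0.
rewrite /cross !mulrDr opprD addrACA.
have -> : 4 * d%:R * L ^+ 2 * (h / m) = 2 * d%:R * (L ^+ 2 * (h / m)) + 2 * d%:R * (L ^+ 2 * (h / m)).
  ring.
exact: lerD.
Qed.

Let Theta_ge0 y : 0 <= Theta y.
Proof. by apply: sumr_ge0 => j _; exact: sqr_ge0. Qed.

Let Theta_bound y : Theta y <= 8 * d%:R * G ^+ 2 * h ^+ 2.
Proof.
apply: (@le_trans _ _ (\sum_(j : 'I_d * bool) (2 * (G * h)) ^+ 2)).
  apply: ler_sum => j _; have /andP[b1 b2] := p_shift j y.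
  by rewrite lerXn2r ?nnegrE// mulr_ge0// mulr_ge0// ltW.
by rewrite sum_dir_const le_eqVlt; apply/orP; left; apply/eqP; ring.
Qed.

(* Second differences alone do not close the estimate, since the rates depend on x: the
   resulting mixed second differences are absorbed by the dissipation of m times the
   squared increments. *)
Lemma axis_functional_le S :
  (forall y, W y + m * Theta y <= S) ->
  - ((w' t (x + step h k) + w' t (x - step h k) - 2 * w' t x)
     + m * \sum_j 2 * (p j x + G * h) * (w' t (x + step h j) - w' t x)) <=
  2 * d%:R * (2 * N / h) * (S - (W x + m * Theta x))
  + ((K + d%:R * K * G) * h ^+ 2 + (8 * d%:R * G * (L + d%:R * L * G)
      + 8 * d%:R ^+ 2 * L * G ^+ 2) * (m * h ^+ 2) + 4 * d%:R * L ^+ 2 * (h / m)).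
Proof.
move=> PS.
have H1 := W_le; have H2 := ler_wpM2l (ltW m0) Theta_le; have H3 := absorb.
have H4 : \sum_l rho l * (W (x + step h l) - W x)
   + m * (\sum_l r l * (Theta (x + step h l) - Theta x)) <=
   2 * d%:R * (2 * N / h) * (S - (W x + m * Theta x))
   + 8 * d%:R ^+ 2 * L * G ^+ 2 * (m * h ^+ 2).
  have -> : 8 * d%:R ^+ 2 * L * G ^+ 2 * (m * h ^+ 2)
     = 2 * d%:R * (m * (L / 2 * (8 * d%:R * G ^+ 2 * h ^+ 2))) by field.
  rewrite -[2 * d%:R * (2 * N / h) * _]mulrA -!sum_dir_const mulr_sumr -!big_split/=.
  apply: ler_sum => l _.
  set U := W _; set V := Theta (x + _); set U0 := W x; set V0 := Theta x.
  (* [W] comes with the rates [rho] and [Theta] with [r]. Moving [Theta] to [rho] costs little,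
     since the rates differ by at most [L / 2] while [Theta] is of order [h ^+ 2]. *)
  have -> : rho l * (U - U0) + m * (r l * (V - V0)) =
     rho l * (U + m * V - (U0 + m * V0)) + m * ((r l - rho l) * (V - V0)) by ring.
  apply: lerD.
    apply: (@le_trans _ _ (rho l * (S - (U0 + m * V0)))).
      by apply: ler_wpM2l => //; rewrite lerD2r PS.
    by apply: ler_wpM2r; [rewrite subr_ge0 PS|].
  apply: ler_wpM2l; first exact: ltW.
  rewrite (le_trans (ler_norm _))// normrM ler_pM//.
  have := Theta_bound (x + step h l); have := Theta_bound x.
  rewrite -/V -/V0 => B1 B2.
  have V1 : 0 <= V by exact: Theta_ge0. have V2 : 0 <= V0 by exact: Theta_ge0.
  by rewrite ler_norml; apply/andP; split; lra.
rewrite mulrBr mulrDr in H2.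
rewrite (opprD _ (m * _)) -(mulrN m).
apply: le_trans (lerD H1 H2) _; move: H3 H4.
move: (L * cross) (m * dissipation) (\sum_l rho l * _) (m * (\sum_l r l * _)) => a1 a2 a3 a4.
move: (2 * d%:R * (2 * N / h) * _) => a5 H3 H4.
have -> : m * (8 * d%:R * G * (L + d%:R * L * G) * h ^+ 2)
  = 8 * d%:R * G * (L + d%:R * L * G) * (m * h ^+ 2) by ring.
rewrite (mulrDl _ _ (m * h ^+ 2)); move: H3 H4.
lra.
Qed.
End FrozenTime.

Definition axis_const :=
  expR T * (2 * K + d%:R * K * G + 8 * d%:R * G * (L + d%:R * L * G)
    + 8 * d%:R ^+ 2 * L * G ^+ 2 + 4 * d%:R * L ^+ 2 + 8 * d%:R * G ^+ 2).

(** The weight [m = 1 / sqrt h] balances the size [m * h ^+ 2] of the auxiliary squares, and of the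
    errors they bring, against the absorption cost [h / m]: both equal [sqrt h ^+ 3]. The auxiliary
    term is nonnegative and is dropped from the final bound. *)
Lemma scheme_axis_second_difference t x k : 0 <= t <= T ->
  w t (x + step h k) + w t (x - step h k) - 2 * w t x <= axis_const * Num.sqrt h ^+ 3.
Proof.
move=> tT; set s := Num.sqrt h.
have s0 : 0 < s by rewrite sqrtr_gt0.
have hs : h = s ^+ 2 by rewrite sqr_sqrtr ?ltW.
have s1 : s <= 1.
  by rewrite -(@ler_pXn2r _ 2)// ?nnegrE ?(ltW s0)// -hs expr1n (ltW (sol_h1 sol)).
pose m := s^-1; have m0 : 0 < m by rewrite invr_gt0.
pose p j t y := w t (y + step h j) - w t y.
pose W t y := w t (y + step h k) + w t (y - step h k) - 2 * w t y.
pose Theta t y := \sum_j (p j t y + G * h) ^+ 2.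
pose u t y := W t y + m * Theta t y.
pose u' t y := (w' t (y + step h k) + w' t (y - step h k) - 2 * w' t y)
  + m * \sum_j 2 * (p j t y + G * h) * (w' t (y + step h j) - w' t y).
have Th0 r y : 0 <= Theta r y by apply: sumr_ge0 => j _; exact: sqr_ge0.
apply: (@le_trans _ _ (u t x)); first by rewrite lerDl mulr_ge0// ltW.
pose c := (2 * K + d%:R * K * G + 8 * d%:R * G * (L + d%:R * L * G)
    + 8 * d%:R ^+ 2 * L * G ^+ 2 + 4 * d%:R * L ^+ 2 + 8 * d%:R * G ^+ 2) * s ^+ 3.
have c0 : 0 <= c by rewrite /c; have := G0 => ?; ge0.
have Thb r y : 0 <= r <= T -> Theta r y <= 8 * d%:R * G ^+ 2 * h ^+ 2.
  move=> rT; apply: (@le_trans _ _ (\sum_(j : 'I_d * bool) (2 * (G * h)) ^+ 2)).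
    apply: ler_sum => j _; have := scheme_lip_step sol y j rT.
    rewrite -/G ler_norml => /andP[b1 b2].
    have b3 : 0 <= p j r y + G * h by rewrite /p; lra.
    have b4 : p j r y + G * h <= 2 * (G * h) by rewrite /p; lra.
    by rewrite lerXn2r ?nnegrE// (le_trans b3).
  by rewrite sum_dir_const le_eqVlt; apply/orP; left; apply/eqP; ring.
have mh2 : m * h ^+ 2 = s ^+ 3 by rewrite /m hs; field; rewrite gt_eqF.
have hm : h / m = s ^+ 3 by rewrite /m hs; field; rewrite gt_eqF.
have h2s : h ^+ 2 <= s ^+ 3.
  by rewrite -mh2 ler_peMl ?sqr_ge0// /m invf_ge1.
have -> : axis_const * s ^+ 3 = expR ((0 + 1) * T) * Num.max c c.
  by rewrite maxxx add0r mul1r /axis_const /c mulrA.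
have [B wB] := sol_bounded sol.
apply: (@maximum_principle R T _ u u' (4 * `|B| + m * (8 * d%:R * G ^+ 2 * h ^+ 2)) c c
  (2 * d%:R * (2 * N / h)) 0) => //.
- move=> r y rT; apply: lerD; last by apply: ler_wpM2l; rewrite ?Thb// ltW.
  have := wB r (y + step h k) rT; have := wB r (y - step h k) rT; have := wB r y rT.
  have := ler_norm B; rewrite /W !ler_norml.
  by move=> ? /andP[? ?] /andP[? ?] /andP[? ?]; lra.
- move=> y r; rewrite /u /W /Theta /p.
  apply: cvgD.
    apply: cvgB; last by apply: cvgM; [exact: cvg_cst|exact: (sol_continuous sol)].
    by apply: cvgD; exact: (sol_continuous sol).
  apply: cvgM; first exact: cvg_cst.
  refine (@cvg_sum_seq R ('I_d * bool)%type _ (nbhs_subspace r) _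
    (index_enum _) (fun j r' => (w r' (y + step h j) - w r' y + G * h) ^+ 2)
    (fun j => (w r (y + step h j) - w r y + G * h) ^+ 2) _) => j.
  apply: cvgM; (apply: cvgD; last exact: cvg_cst).
    by apply: cvgB; exact: (sol_continuous sol).
  by apply: cvgB; exact: (sol_continuous sol).
- move=> r y rT; rewrite /u /u' /W /Theta.
  have d1 := sol_derive sol (y + step h k) rT; have d2 := sol_derive sol (y - step h k) rT.
  have d3 := sol_derive sol y rT.
  have dj j : is_derive r 1 (fun r => (p j r y + G * h) ^+ 2)
      (2 * (p j r y + G * h) * (w' r (y + step h j) - w' r y)).
    have d4 := sol_derive sol (y + step h j) rT; rewrite /p.
    by apply: is_derive_eq; rewrite /GRing.scale/=; ring.
  have dS : is_derive r 1 (fun r => \sum_j (p j r y + G * h) ^+ 2)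
      (\sum_j 2 * (p j r y + G * h) * (w' r (y + step h j) - w' r y)).
    exact: is_derive_sum_seq.
  apply: is_derive_eq; rewrite /GRing.scale/=; ring.
- by ge0.
- move=> y; rewrite /u /W !(sol_terminal sol).
  have := sol_qsc sol y (step h k); rewrite (enorm_step _ (ltW h0)) => qK.
  have := Thb T y; rewrite lexx (ltW T0) => /(_ erefl) HT.
  have := ler_wpM2l (ltW m0) HT.
  have -> : m * (8 * d%:R * G ^+ 2 * h ^+ 2) = 8 * d%:R * G ^+ 2 * s ^+ 3 by rewrite -mh2; ring.
  have Kh := ler_wpM2l K0 h2s.
  have r0 : 0 <= (K + d%:R * K * G + 8 * d%:R * G * (L + d%:R * L * G)
    + 8 * d%:R ^+ 2 * L * G ^+ 2 + 4 * d%:R * L ^+ 2) * s ^+ 3 by have := G0 => ?; ge0.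
  move=> Hm; apply: le_trans (lerD qK Hm) _; apply: le_trans (lerD Kh (lexx _)) _.
  rewrite -subr_ge0; apply: le_trans r0 _; rewrite le_eqVlt; apply/orP; left; apply/eqP.
  by rewrite /c; ring.
move=> r y S rT S0 uS.
have [C [F [CF eqx ley]]] := sol_scheme sol y rT.
have := axis_functional_le rT CF eqx ley m0 uS.
move=> H; apply: le_trans H _; rewrite mul0r addr0 mh2 hm lerD2l.
have Kh : (K + d%:R * K * G) * h ^+ 2 <= (K + d%:R * K * G) * s ^+ 3.
  by apply: ler_wpM2l => //; have := G0 => ?; ge0.
have r0 : 0 <= (K + 8 * d%:R * G ^+ 2) * s ^+ 3 by have := G0 => ?; ge0.
apply: le_trans (lerD (lerD Kh (lexx _)) (lexx _)) _.
rewrite -subr_ge0; apply: le_trans r0 _; rewrite le_eqVlt; apply/orP; left; apply/eqP.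
by rewrite /c; ring.
Qed.
End AxisSemiconcavity.

(** * From the control problem to frozen coefficients *)

Section SecondDifferences.
Variables (R : realType) (d : nat).
Implicit Types (x y z : 'rV[R]_d).

Lemma is_derive_line (g : 'rV[R]_d -> R) y z (t : R) : differentiable g (y + t *: z) ->
  is_derive t 1 (fun s => g (y + s *: z)) (\sum_(i < d) z 0 i * partial i g (y + t *: z)).
Proof.
move=> dg.
have E : (fun h : R => h^-1 *: (g (y + (h *: (1 : R) + t) *: z) - g (y + t *: z))) =
   (fun h : R => h^-1 *: (g (h *: z + (y + t *: z)) - g (y + t *: z))).
  apply/funext => h; congr (_ *: (g _ - _)).
  by apply/rowP => i; rewrite !mxE /GRing.scale/=; ring.
have dz : derivable g (y + t *: z) z by exact: diff_derivable.
split.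
  by rewrite /derivable /= E.
have -> : 'D_1 (fun s : R => g (y + s *: z)) t = 'D_z g (y + t *: z) by rewrite /derive/= E.
clear E; move: (y + t *: z) dg dz => u dg dz.
rewrite deriveE// [in LHS](row_sum_evec z) linear_sum/=; apply: eq_bigr => i _.
by rewrite linearZ/= /partial deriveE.
Qed.

(** The mean value theorem for [g (y + s *: z) + g (y - s *: z)] as a function of [s]: its
    derivative is a difference of gradients at two points [2 * c * enorm z] apart, so the Lipschitz
    gradient suffices. *)
Lemma W2inf_second_difference (K : R) (g : 'rV[R]_d -> R) y z : W2inf_bound K g ->
  `|g (y + z) + g (y - z) - 2 * g y| <= 2 * d%:R * K * enorm z ^+ 2.
Proof.
move=> [gK [dg [_ Dg]]].
have K0 : 0 <= K by apply: le_trans (gK y).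
pose phi (s : R) := g (y + s *: z) + g (y + s *: - z).
pose dphi (s : R) := \sum_(i < d) z 0 i * partial i g (y + s *: z)
  + \sum_(i < d) (- z) 0 i * partial i g (y + s *: - z).
have dp (s : R) : is_derive s 1 phi (dphi s).
  by apply: is_deriveD; exact: is_derive_line.
have cphi : {within `[0, 1], continuous phi}.
  apply: continuous_subspaceT => s; apply: differentiable_continuous.
  by apply/derivable1_diffP; have := dp s => ?; exact: ex_derive.
have [c] := MVT ltr01 (fun s _ => dp s) cphi.
rewrite in_itv/= => /andP[c0 c1]; rewrite subr0 mulr1 /phi !scale1r !scale0r !addr0 => E.
have -> : g (y + z) + g (y - z) - 2 * g y = g (y + z) + g (y - z) - (g y + g y) by ring.
rewrite {}E /dphi -big_split/= (le_trans (ler_norm_sum _ _ _))//.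
apply: (@le_trans _ _ (\sum_(i < d) 2 * K * enorm z ^+ 2)); last first.
  rewrite sumr_const card_ord -mulr_natl le_eqVlt; apply/orP; left; apply/eqP; ring.
apply: ler_sum => i _; rewrite mxE mulNr -mulrBr normrM.
have E2 : y + c *: z - (y + c *: - z) = (2 * c) *: z by apply/rowP => j; rewrite !mxE; ring.
have := Dg (y + c *: z) (y + c *: - z) i; rewrite E2 enormZ (@ger0_norm _ (2 * c)) ?mulr_ge0 ?(ltW c0)// => H.
have -> : 2 * K * enorm z ^+ 2 = enorm z * (K * (2 * enorm z)) by ring.
apply: ler_pM => //; first exact: enorm_coord.
apply: le_trans H _; apply: ler_wpM2l => //; apply: ler_wpM2r; first exact: enorm_ge0.
lra.
Qed.

End SecondDifferences.

Section FromControlProblem.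
Variables (R : realType) (d m : nat) (T N : R) (A : set 'rV[R]_m).
Variables (c : R -> 'rV[R]_d -> 'rV[R]_m -> R) (f : R -> 'rV[R]_d -> 'rV[R]_m -> 'rV[R]_d).
Variables (q : 'rV[R]_d -> R) (alpha : R -> 'rV[R]_d -> 'rV[R]_d -> 'rV[R]_m).
Hypothesis argmin : is_unique_argmin T A c f alpha.

Lemma argmin_le t x p a : 0 <= t <= T -> A a ->
  c t x (alpha t x p) + dotv p (f t x (alpha t x p)) <= c t x a + dotv p (f t x a).
Proof.
move=> tT Aa; have [->|an] := eqVneq a (alpha t x p) => //.
by apply: ltW; apply: (proj2 (argmin x p tT)).
Qed.

Lemma Ham_argmin t x p : 0 <= t <= T ->
  Ham A c f t x p = c t x (alpha t x p) + dotv p (f t x (alpha t x p)).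
Proof.
move=> tT; have Aa := proj1 (argmin x p tT); apply/eqP; rewrite eq_le; apply/andP; split.
  apply: ge_inf; last by exists (alpha t x p).
  exists (c t x (alpha t x p) + dotv p (f t x (alpha t x p))) => _ [a Aa' <-].
  exact: argmin_le.
apply: lb_le_inf; first by exists (c t x (alpha t x p) + dotv p (f t x (alpha t x p))), (alpha t x p).
by move=> _ [a Aa' <-]; exact: argmin_le.
Qed.

Lemma Ham_le t x p a : 0 <= t <= T -> A a -> Ham A c f t x p <= c t x a + dotv p (f t x a).
Proof. by move=> tT Aa; rewrite Ham_argmin// argmin_le. Qed.

Hypothesis A1 : assumption_A1 T A c f q.
Hypothesis A3 : assumption_A3 T A c f q.
Hypothesis NF : Num.max 1 (supnorm_f T A f / 2) <= N.

(** The supremum in [supnorm_f] bounds the members of its set only once that set is known to be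
    bounded, which [A1] provides. *)
Lemma drift_le t x a : 0 <= t <= T -> A a -> enorm (f t x a) <= 2 * N.
Proof.
move=> tT Aa; have [M [L [cfM _]]] := A1.
have : supnorm_f T A f / 2 <= N by apply: le_trans NF; rewrite le_max lexx orbT.
rewrite ler_pdivrMr// mulrC; apply: le_trans; apply: ub_le_sup; last by exists t, x, a.
by exists M => _ [s [y [b [sT Ab ->]]]]; have [] := cfM s y b sT Ab.
Qed.

Lemma exists_scheme_constants : exists M L K : R,
  [/\ 0 <= M, 0 <= L, 0 <= K,
    (forall (t : R) a, 0 <= t <= T -> A a -> coeff_bounds N M L K (fun y => c t y a) (fun y => f t y a))
  & (forall x y, `|q x - q y| <= L * enorm (x - y)) /\
    forall x y, q (x + y) + q (x - y) - 2 * q x <= K * enorm y ^+ 2].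
Proof.
have [M [L [cfM [qM [cfL qL]]]]] := A1.
have [[Cq [Cq0 qsc]] [K cfK]] := A3.
pose K' := Num.max Cq (2 * d%:R * `|K|).
exists `|M|, `|L|, K'.
have LL (u v : R) : 0 <= v -> u <= L * v -> u <= `|L| * v.
  by move=> v0 uv; rewrite (le_trans uv)// ler_wpM2r// ler_norm.
split => //; first by rewrite le_max ltW.
- move=> t a tT Aa; split.
  + move=> y; have [cM _] := cfM t y a tT Aa; split; last exact: drift_le.
    exact: le_trans cM (ler_norm _).
  + move=> y z; have [+ _] := cfL t t y z a a tT tT Aa Aa.
    by rewrite !subrr normr0 enorm0 addr0 add0r => /LL; apply; exact: enorm_ge0.
  + move=> y z; have [_ +] := cfL t t y z a a tT tT Aa Aa.
    by rewrite !subrr normr0 enorm0 addr0 add0r => /LL; apply; exact: enorm_ge0.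
  + move=> y z; have [cK _] := cfK t a tT Aa.
    apply: le_trans (W2inf_second_difference y z cK) _.
    apply: ler_wpM2r; first exact: sqr_ge0.
    by rewrite le_max; apply/orP; right; rewrite ler_wpM2l ?mulr_ge0// ler_norm.
  + move=> y z i; have [_ fK] := cfK t a tT Aa.
    apply: le_trans (W2inf_second_difference y z (fK i)) _.
    apply: ler_wpM2r; first exact: sqr_ge0.
    by rewrite le_max; apply/orP; right; rewrite ler_wpM2l ?mulr_ge0// ler_norm.
- split; first by move=> x y; apply: LL; [exact: enorm_ge0|exact: qL].
  move=> x y; apply: le_trans (qsc x y) _; apply: ler_wpM2r; first exact: sqr_ge0.
  by rewrite le_max lexx.
Qed.

Lemma semidiscrete_scheme_solution (M L K h : R) (w : R -> 'rV[R]_d -> R) :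
  0 < T -> 0 < h < 1 -> 0 <= M -> 0 <= L -> 0 <= K ->
  (forall (t : R) a, 0 <= t <= T -> A a -> coeff_bounds N M L K (fun y => c t y a) (fun y => f t y a)) ->
  (forall x y, `|q x - q y| <= L * enorm (x - y)) ->
  (forall x y, q (x + y) + q (x - y) - 2 * q x <= K * enorm y ^+ 2) ->
  semidiscrete_solution T N h A c f q w ->
  scheme_solution T N h M L K q w (fun t x => 'D_1 (fun s => w s x) t).
Proof.
move=> T0 /andP[h0 h1] M0 L0 K0 cb ql qk [wM [cw [dw wT]]]; split => //.
- by apply: le_trans NF; rewrite le_max lexx.
- by move=> t x tT; apply/derivableP; case: (dw t x tT).
move=> t x tT; have tT' : 0 <= t <= T by case/andP: tT => ? ?; rewrite !ltW.
pose a := alpha t x (gradh h (w t) x); have Aa : A a by have [] := argmin x (gradh h (w t) x) tT'.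
have h0' : h != 0 by rewrite gt_eqF.
exists (fun y => c t y a), (fun y => f t y a); split; first exact: cb.
  have [_ E] := dw t x tT.
  rewrite -gen_gradh_laplh// addrA -Ham_argmin//; lra.
move=> y; have [_ E] := dw t y tT.
have := Ham_le y (gradh h (w t) y) tT' Aa.
rewrite -gen_gradh_laplh//; lra.
Qed.

End FromControlProblem.

(** * Joint continuity, test functions and doubling of variables *)

Lemma continuous_lincomb (R : realType) (U : topologicalType) (f g : U -> R) (b c : R) :
  continuous f -> continuous g -> continuous (fun y => b * f y + c * g y).
Proof.
move=> cf cg y.
apply: (@continuousD R _ _ (fun y => b * f y) (fun y => c * g y) y).
  by apply: (@continuousM R _ (cst b) f y); [exact: cst_continuous|exact: cf].
by apply: (@continuousM R _ (cst c) g y); [exact: cst_continuous|exact: cg].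
Qed.

Section JointContinuity.
Variables (R : realType) (d : nat).
Implicit Types (x y : 'rV[R]_d).

Lemma near_enorm x (e : R) : 0 < e -> \forall y \near x, enorm (y - x) < e.
Proof.
move=> e0; have d1 : 0 < d%:R + 1 :> R by rewrite ltr_wpDl.
apply/nbhs_ballP; exists (e / (d%:R + 1)) => /=; first by rewrite divr_gt0.
move=> y; rewrite -ball_normE/= distrC => H.
apply: le_lt_trans (enorm_le_norm _) _.
apply: (@le_lt_trans _ _ ((d%:R + 1) * `|y - x|)); first by rewrite ler_wpM2r// lerDl.
by rewrite mulrC -ltr_pdivlMr.
Qed.

Lemma near_enormP x (P : 'rV[R]_d -> Prop) : (\forall y \near x, P y) ->
  exists2 r : R, 0 < r & forall y, enorm (y - x) < r -> P y.
Proof.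
move=> /nbhs_ballP[r /= r0 H]; exists r => // y yr; apply: H.
by rewrite -ball_normE/= distrC; apply: le_lt_trans (norm_le_enorm _) yr.
Qed.

Lemma jcont_continuous (g : R -> 'rV[R]_d -> R) : jcont g ->
  continuous (fun p : R * 'rV[R]_d => g p.1 p.2).
Proof.
move=> gc [t x]; apply/cvgrPdist_lt => e e0 /=.
have [r r0 H] := gc t x e e0.
exists ([set s | `|s - t| < r], [set y | enorm (y - x) < r]) => /=.
  split; last exact: near_enorm.
  by apply/nbhs_ballP; exists r => //= s; rewrite -ball_normE/= distrC.
by move=> [s y] /= [st yx]; rewrite distrC; exact: H.
Qed.

Lemma jcont_sum (a : R -> R) (b : 'rV[R]_d -> R) : continuous a -> continuous b ->
  jcont (fun s y => a s + b y).
Proof.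
move=> ca cb t x e e0; have e2 : 0 < e / 2 by rewrite divr_gt0.
have /cvgrPdist_lt/(_ _ e2)/nbhs_ballP[r1 /= r10 H1] := ca t.
have /cvgrPdist_lt/(_ _ e2)/near_enormP[r2 r20 H2] := cb x.
exists (Num.min r1 r2); first by rewrite lt_min r10.
move=> s y; rewrite !lt_min => /andP[st _] /andP[_ yx].
have {}H1 := H1 s _; have {}H2 := H2 _ yx.
have -> : a s + b y - (a t + b x) = - (a t - a s) + - (b x - b y) by ring.
rewrite (le_lt_trans (ler_normD _ _))// !normrN [e]splitr ltrD//.
by apply: H1; rewrite -ball_normE/= distrC.
Qed.

(** The test functions are quadratic in space, so their partial derivatives can be read off an exact
    expansion. *)
Lemma is_derive_quadratic (f : 'rV[R]_d -> R) y v (b c : R) :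
  (forall h : R, f (h *: v + y) = f y + h * b + h ^+ 2 * c) -> is_derive y v f b.
Proof.
move=> fE.
have H : h^-1 *: (f (h *: v + y) - f y) @[h --> (0:R)^'] --> b.
  apply: (@cvg_trans _ ((b + h * c) @[h --> (0:R)^'])).
    apply: near_eq_cvg; near=> h.
    have h0 : h != 0 by near: h; exact: nbhs_dnbhs_neq.
    by rewrite fE /GRing.scale/=; field.
  suff : b + h * c @[h --> (0:R)^'] --> b + 0 * c by rewrite mul0r addr0.
  apply: cvgD; first exact: cvg_cst.
  apply: cvgM; last exact: cvg_cst.
  by apply: cvg_within_filter; exact: cvg_id.
split; first by apply/cvg_ex; exists b.
by rewrite /derive; exact: cvg_lim H.
Unshelve. all: by end_near.
Qed.

Definition sqdist x y : R := dotv (y - x) (y - x).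

Lemma sqdistE x y : sqdist x y = enorm (y - x) ^+ 2.
Proof. by rewrite /sqdist enorm_sqr. Qed.

Lemma sqdist_line x y (i : 'I_d) (h : R) :
  sqdist x (h *: evec R i + y) = sqdist x y + h * (2 * (y - x) 0 i) + h ^+ 2.
Proof.
rewrite /sqdist -addrA; move: (y - x) => u.
rewrite dotvDl !dotvDr !dotvZl !dotvZr (dotvC (evec R i) u) (dotv_evec u).
have -> : dotv (evec R i) (evec R i) = 1 by rewrite -enorm_sqr enorm_evec expr1n.
ring.
Qed.

Lemma continuous_coord (i : 'I_d) : continuous (fun y : 'rV[R]_d => y 0 i).
Proof. exact: coord_continuous. Qed.

Lemma continuous_sqdist x : continuous (sqdist x).
Proof.
move=> y; rewrite /sqdist /dotv.
apply: (@cvg_sum_seq R 'I_d _ (nbhs y) _ (index_enum _)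
  (fun i z => (z - x) 0 i * (z - x) 0 i) (fun i => (y - x) 0 i * (y - x) 0 i)) => i.
under eq_fun do rewrite !mxE.
by rewrite !mxE; apply: cvgM; apply: cvgB; [exact: continuous_coord|exact: cvg_cst|
  exact: continuous_coord|exact: cvg_cst].
Qed.

(* The test functions of the doubling argument: separated in time and space. *)
Lemma C1test_separated (a a' : R -> R) (x1 x2 : 'rV[R]_d) (b1 b2 : R) :
  (forall t : R, is_derive t 1 a (a' t)) -> continuous a' ->
  C1test (fun s y => a s + (b1 * sqdist x1 y + b2 * sqdist x2 y)) /\
  forall (t : R) x, 'D_1 (fun s : R => a s + (b1 * sqdist x1 x + b2 * sqdist x2 x)) t = a' t /\
    grad (fun y => a t + (b1 * sqdist x1 y + b2 * sqdist x2 y)) x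
      = (2 * b1) *: (x - x1) + (2 * b2) *: (x - x2).
Proof.
move=> da ca'.
have ca : continuous a.
  move=> t; apply: differentiable_continuous; apply/derivable1_diffP.
  by have := da t => ?; exact: ex_derive.
have dt (t : R) x : is_derive t 1 (fun s : R => a s + (b1 * sqdist x1 x + b2 * sqdist x2 x)) (a' t).
  by have := da t => ?; apply: is_derive_eq; rewrite addr0.
have dx (t : R) x i : is_derive x (evec R i) (fun y => a t + (b1 * sqdist x1 y + b2 * sqdist x2 y))
    (2 * b1 * (x - x1) 0 i + 2 * b2 * (x - x2) 0 i).
  by apply: (@is_derive_quadratic _ _ _ _ (b1 + b2)) => h; rewrite !sqdist_line; ring.
have cb : continuous (fun y => b1 * sqdist x1 y + b2 * sqdist x2 y).
  by apply: continuous_lincomb; exact: continuous_sqdist.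
split; last first.
  move=> t x; have := dt t x => H; split; first by rewrite derive_val.
  by apply/rowP => i; have := dx t x i => H'; rewrite !mxE /partial derive_val !mxE.
split; [|split; [|split; [|split]]].
- by move=> t x; have := dt t x => H; exact: ex_derive.
- by move=> t x i; have := dx t x i => H; exact: ex_derive.
- exact: jcont_sum.
- have -> : (fun (t : R) x => 'D_1 (fun s : R => a s + (b1 * sqdist x1 x + b2 * sqdist x2 x)) t) =
     (fun t (x : 'rV[R]_d) => a' t + cst 0 x).
    by apply/funext => t; apply/funext => x; have := dt t x => H; rewrite derive_val addr0.
  by apply: jcont_sum; [exact: ca'|exact: cst_continuous].
- move=> i.
  have -> : (fun t x => partial i (fun y => a t + (b1 * sqdist x1 y + b2 * sqdist x2 y)) x) =
     (fun t x => cst 0 t + (2 * b1 * (x - x1) 0 i + 2 * b2 * (x - x2) 0 i)).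
    by apply/funext => t; apply/funext => x; have := dx t x i => H; rewrite /partial derive_val add0r.
  apply: jcont_sum; first exact: cst_continuous.
  apply: continuous_lincomb.
  all: have -> x' : (fun y : 'rV[R]_d => (y - x') 0 i) = (fun y => 1 * y 0 i + (- x' 0 i) * cst 1 y)
    by apply/funext => y; rewrite !mxE mul1r mulr1.
  all: by apply: continuous_lincomb; [exact: continuous_coord|exact: cst_continuous].
Qed.

End JointContinuity.

Section Clamp.
Variables (R : realType) (T : R).
Hypothesis T0 : 0 <= T.

(** Extends functions controlled only on [[0, T]] to all times and keeps them continuous, so that
    the extreme value theorem can be applied to a function on the whole product space. *)
Definition clamp (s : R) := Num.max 0 (Num.min T s).

Lemma clamp_in s : 0 <= clamp s <= T.
Proof. by rewrite /clamp le_max lexx/= ge_max T0 ge_min lexx. Qed.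

Lemma clamp_id s : 0 <= s <= T -> clamp s = s.
Proof. by move=> /andP[s0 sT]; rewrite /clamp (min_idPr sT) (max_idPr s0). Qed.

Lemma clamp_dist s t : `|clamp s - clamp t| <= `|s - t|.
Proof.
wlog st : s t / s <= t.
  by move=> H; have [/H//|/ltW/H] := leP s t; rewrite distrC (distrC t).
have T0' := T0.
rewrite /clamp distrC (distrC s) (@ger0_norm _ (t - s)) ?subr_ge0//.
have H1 : Num.min T s <= Num.min T t by rewrite le_min ge_min lexx/= ge_min st orbT.
have H2 : Num.max 0 (Num.min T s) <= Num.max 0 (Num.min T t).
  by rewrite ge_max le_max lexx/= le_max H1 orbT.
rewrite ger0_norm ?subr_ge0//.
clear H1 H2; case: (leP T s) => h1; case: (leP T t) => h2;
  rewrite ?(max_idPr T0); try case: (leP 0 t) => h3; try case: (leP 0 s) => h4; lra.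
Qed.

End Clamp.

Section Doubling.
Variables (R : realType) (d : nat).
Implicit Types (x y : 'rV[R]_d).
Variables (T : R) (T0 : 0 < T).

Lemma box_compact x (r : R) :
  compact [set y : 'rV[R]_d | forall i, x 0 i - r <= y 0 i <= x 0 i + r].
Proof.
have := @rV_compact R d (fun i => `[x 0 i - r, x 0 i + r]%classic)
  (fun i => @segment_compact R _ _).
by congr compact; apply/seteqP; split => y /= H i; have := H i; rewrite in_itv.
Qed.

Variable z : R -> 'rV[R]_d -> R.
Hypothesis zc : forall t x (e : R), 0 <= t <= T -> 0 < e -> exists2 r : R, 0 < r &
    forall s y, 0 <= s <= T -> `|s - t| < r -> enorm (y - x) < r -> `|z s y - z t x| < e.

Lemma jcont_clamp : jcont (fun s y => z (clamp T s) y).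
Proof.
move=> t x e e0; have [r r0 H] := zc x (clamp_in (ltW T0) t) e0.
exists r => // s y st yx; apply: H => //; first exact: clamp_in (ltW T0) s.
exact: le_lt_trans (clamp_dist (ltW T0) s t) st.
Qed.

(** Compactness of the box makes the continuity at time [T] uniform in [y]; this is needed to
    exclude maximum points close to the terminal time. *)
Lemma terminal_modulus x (r e : R) : 0 < e -> exists2 th : R, 0 < th &
  forall s y, 0 <= s <= T -> T - s < th -> (forall i, x 0 i - r <= y 0 i <= x 0 i + r) ->
    z T y - z s y < e.
Proof.
move=> e0.
have /compact_near_coveringP := box_compact (x := x) (r := r).
move=> /(_ R (nbhs T) (fun s y => 0 <= s <= T -> z T y - z s y < e) _).
case=> [y _|].
  have TT : 0 <= T <= T by rewrite lexx ltW.
  have [r1 r10 H] := zc y TT (divr_gt0 e0 (ltr0n R 2)).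
  exists ([set y' | enorm (y' - y) < r1], [set s | `|s - T| < r1]) => /=.
    split; first exact: near_enorm.
    by apply/nbhs_ballP; exists r1 => //= s; rewrite -ball_normE/= distrC.
  move=> [y' s] /= [yy sT] s0T.
  have := H s y' s0T sT yy; have := H T y' TT; rewrite subrr normr0 => /(_ r10 yy).
  by rewrite !ltr_norml => /andP[h1 h2] /andP[h3 h4]; lra.
move=> th /= th0 H; exists th => // s y sT sth yb.
apply: (H s) => //=; rewrite ger0_norm// subr_ge0; by case/andP: sT.
Qed.

(** A box replaces decay at infinity. The [eta] penalty is there for the caller, who uses it to keep
    the maximum point away from the faces of the box. *)
Lemma doubling_max (w : R -> 'rV[R]_d -> R) (a : R -> R) x0 (r eps eta Lx Lt : R) :
  0 <= r ->
  (forall t x y, 0 <= t <= T -> `|w t x - w t y| <= Lx * enorm (x - y)) ->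
  (forall s t x, 0 <= s <= T -> 0 <= t <= T -> `|w s x - w t x| <= Lt * `|s - t|) ->
  continuous a ->
  let K x := forall i, x0 0 i - r <= x 0 i <= x0 0 i + r in
  let Psi t x s y := w t x - z s y - (2 * eps)^-1 * enorm (x - y) ^+ 2
     - (2 * eps)^-1 * (t - s) ^+ 2 - eta * enorm (y - x0) ^+ 2 - a s in
  exists t x s y, [/\ 0 <= t <= T, K x, 0 <= s <= T, K y &
    forall t' x' s' y', 0 <= t' <= T -> K x' -> 0 <= s' <= T -> K y' ->
      Psi t' x' s' y' <= Psi t x s y].
Proof.
move=> r0 wx wt ca K Psi.
pose P := ((R * 'rV[R]_d) * (R * 'rV[R]_d))%type.
pose KK : set P := ([set t | 0 <= t <= T] `*` [set x | K x]) `*`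
   ([set t | 0 <= t <= T] `*` [set x | K x]).
have cI : compact [set t : R | 0 <= t <= T].
  have -> : [set t : R | 0 <= t <= T] = `[0, T]%classic.
    by apply/seteqP; split => t /=; rewrite in_itv.
  exact: segment_compact.
have cK : compact [set x | K x] by exact: box_compact.
have cKK : compact KK by apply: compact_setX; exact: compact_setX.
pose Psi' (p : P) := Psi (clamp T p.1.1) p.1.2 (clamp T p.2.1) p.2.2.
have cw : jcont (fun s y => w (clamp T s) y).
  move=> t x e e0; pose L := `|Lx| + `|Lt| + 1.
  have L0 : 0 < L by rewrite /L ltr_pwDr// addr_ge0.
  exists (e / L / 2) => [|s y st yx]; first by rewrite !divr_gt0.
  have I1 := clamp_in (ltW T0) s; have I2 := clamp_in (ltW T0) t.
  have H1 := wx _ y x I1; have H2 := wt _ _ x I1 I2.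
  have H3 := clamp_dist (ltW T0) s t.
  have -> : w (clamp T s) y - w (clamp T t) x =
    w (clamp T s) y - w (clamp T s) x + (w (clamp T s) x - w (clamp T t) x) by ring.
  apply: le_lt_trans (ler_normD _ _) _.
  have LxL : Lx <= L by rewrite /L; have := ler_norm Lx; have := normr_ge0 Lt; lra.
  have LtL : Lt <= L by rewrite /L; have := ler_norm Lt; have := normr_ge0 Lx; lra.
  have E1 : `|w (clamp T s) y - w (clamp T s) x| < e / 2.
    apply: le_lt_trans H1 _; apply: (@le_lt_trans _ _ (L * enorm (y - x))).
      by rewrite ler_wpM2r// enorm_ge0.
    by rewrite mulrC -ltr_pdivlMr// mulrAC.
  have E2 : `|w (clamp T s) x - w (clamp T t) x| < e / 2.
    apply: le_lt_trans H2 _; apply: (@le_lt_trans _ _ (L * `|s - t|)).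
      apply: (@le_trans _ _ (L * `|clamp T s - clamp T t|)); first by rewrite ler_wpM2r.
      by rewrite ler_wpM2l// ltW.
    by rewrite mulrC -ltr_pdivlMr// mulrAC.
  by rewrite [e]splitr ltrD.
have cl1 : continuous (clamp T).
  move=> s; apply/cvgrPdist_lt => e e0; apply/nbhs_ballP; exists e => //= s'.
  move=> /= H; exact: le_lt_trans (clamp_dist (ltW T0) _ _) H.
have f1 : continuous (fun p : P => p.1) by move=> p; exact: cvg_fst.
have f2 : continuous (fun p : P => p.2) by move=> p; exact: cvg_snd.
have g1 : continuous (fun p : R * 'rV[R]_d => p.1) by move=> p; exact: cvg_fst.
have g2 : continuous (fun p : R * 'rV[R]_d => p.2) by move=> p; exact: cvg_snd.
have c11 : continuous (fun p : P => clamp T p.1.1).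
  move=> p; apply: (@continuous_comp _ _ _ (fun p : P => p.1.1) (clamp T)); last exact: cl1.
  by apply: (@continuous_comp _ _ _ (fun p : P => p.1) fst); [exact: f1|exact: g1].
have c21 : continuous (fun p : P => clamp T p.2.1).
  move=> p; apply: (@continuous_comp _ _ _ (fun p : P => p.2.1) (clamp T)); last exact: cl1.
  by apply: (@continuous_comp _ _ _ (fun p : P => p.2) fst); [exact: f2|exact: g1].
have c12 : continuous (fun p : P => p.1.2).
  by move=> p; apply: (@continuous_comp _ _ _ (fun p : P => p.1) snd); [exact: f1|exact: g2].
have c22 : continuous (fun p : P => p.2.2).
  by move=> p; apply: (@continuous_comp _ _ _ (fun p : P => p.2) snd); [exact: f2|exact: g2].
have cPsi : continuous Psi'.
  have -> : Psi' = (fun p => 1 * (1 * (1 * (1 * (1 * w (clamp T p.1.1) p.1.2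
     + (-1) * z (clamp T p.2.1) p.2.2) + (- (2 * eps)^-1) * sqdist 0 (p.1.2 - p.2.2))
     + (- (2 * eps)^-1) * (1 * clamp T p.1.1 + (-1) * clamp T p.2.1) ^+ 2)
     + (- eta) * sqdist x0 p.2.2) + (-1) * a (clamp T p.2.1)).
    by apply/funext => p; rewrite /Psi' /Psi !sqdistE subr0; ring.
  apply: continuous_lincomb; last first.
    move=> p; apply: (@continuous_comp _ _ _ (fun p : P => clamp T p.2.1) a); [exact: c21|exact: ca].
  apply: continuous_lincomb; last first.
    move=> p; apply: (@continuous_comp _ _ _ (fun p : P => p.2.2) (sqdist x0)); first exact: c22.
    exact: continuous_sqdist.
  apply: continuous_lincomb; last first.
    move=> p; apply: (@continuous_comp _ _ _
      (fun p : P => 1 * clamp T p.1.1 + (-1) * clamp T p.2.1) (fun t : R => t ^+ 2)); last exact: exprn_continuous.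
    by apply: continuous_lincomb; [exact: c11|exact: c21].
  apply: continuous_lincomb; last first.
    move=> p; apply: (@continuous_comp _ _ _ (fun p : P => p.1.2 - p.2.2) (sqdist 0)); last exact: continuous_sqdist.
    by apply: (@continuousB _ _ _ (fun p : P => p.1.2) (fun p : P => p.2.2) p); [exact: c12|exact: c22].
  apply: continuous_lincomb.
    move=> p; apply: (@continuous_comp _ _ _ (fun p : P => p.1)
      (fun p : R * 'rV[R]_d => w (clamp T p.1) p.2)); first exact: f1.
    exact: (jcont_continuous cw).
  move=> p; apply: (@continuous_comp _ _ _ (fun p : P => p.2)
      (fun p : R * 'rV[R]_d => z (clamp T p.1) p.2)); first exact: f2.
  exact: (jcont_continuous jcont_clamp).
have K0 : K x0 by move=> i; rewrite lerBlDr lerDl r0.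
have KK0 : KK !=set0 by exists ((0, x0), (0, x0)); rewrite /KK/= !lexx ltW.
have [[[t x] [s y]] + Hmax] := compact_EVT_max KK0 cKK (continuous_subspaceT cPsi).
rewrite inE => -[/= [tT Kx] [sT Ky]].
exists t, x, s, y; split => // t' x' s' y' tT' Kx' sT' Ky'.
have := Hmax ((t', x'), (s', y')); rewrite /Psi'/= !clamp_id//; apply.
by rewrite inE.
Qed.

End Doubling.

Section Absorption.
Variable R : realType.

Lemma quadratic_absorb (eps u L : R) : 0 < eps -> 0 <= u -> 0 <= L ->
  (2 * eps)^-1 * u ^+ 2 <= L * u -> u <= 2 * L * eps.
Proof.
move=> e0 u0 L0; have e2 : 0 < 2 * eps by rewrite mulr_gt0.
rewrite -(ler_pM2l e2) mulrA mulfV ?gt_eqF// mul1r => H.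
have [->|un] := eqVneq u 0; first by rewrite !mulr_ge0// ltW.
have up : 0 < u by rewrite lt_neqAle eq_sym un.
by rewrite -(ler_pM2r up) -expr2 (le_trans H)// le_eqVlt; apply/orP; left; apply/eqP; ring.
Qed.

Lemma expr_unbounded (r M k : R) : 1 < r -> 0 < k -> exists n, M < k * r ^+ n.
Proof.
move=> r1 k0; pose dl := r - 1; have dl0 : 0 < dl by rewrite subr_gt0.
have ber n : 1 + n%:R * dl <= r ^+ n.
  elim: n => [|n IH]; first by rewrite mul0r addr0 expr0.
  rewrite exprS; apply: (@le_trans _ _ (r * (1 + n%:R * dl))); last first.
    by rewrite ler_pM2l//; apply: lt_trans r1.
  have -> : r = 1 + dl by rewrite /dl; ring.
  have : 0 <= n%:R * dl ^+ 2 by rewrite mulr_ge0 ?sqr_ge0.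
  by rewrite -natr1; nra.
pose n := Num.bound `|M / k / dl|; exists n.
have Hn : M / k / dl < n%:R.
  by apply: le_lt_trans (ler_norm _) _; exact: archi_boundP (normr_ge0 _).
move: Hn; rewrite ltr_pdivrMr// => Hn.
rewrite mulrC -ltr_pdivrMr//; apply: lt_le_trans Hn _; apply: le_trans (ber n).
by rewrite lerDr.
Qed.

End Absorption.

(** * Convergence of the scheme to the viscosity solution *)

Section DiscreteSubsolutions.
Variables (R : realType) (d : nat).
Implicit Types (x y p : 'rV[R]_d).
Variables (T M Lx Lt N B : R) (G : R -> 'rV[R]_d -> 'rV[R]_d -> R).

(* The last condition is the consistency of a monotone scheme, tested only against
   paraboloids. *)
Definition discrete_subsolution (h : R) (zT : 'rV[R]_d -> R) (w w' : R -> 'rV[R]_d -> R) :=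
  [/\ forall t x, 0 <= t <= T -> `|w t x| <= M,
      (forall t x y, 0 <= t <= T -> `|w t x - w t y| <= Lx * enorm (x - y)) /\
      (forall s t x, 0 <= s <= T -> 0 <= t <= T -> `|w s x - w t x| <= Lt * `|s - t|),
      forall x, w T x = zT x,
      forall t x, 0 < t < T -> is_derive t 1 (w ^~ x) (w' t x)
    & forall t x y eps, 0 < t < T -> 0 < eps ->
      (forall k, w t (x + step h k) - w t x <=
         (2 * eps)^-1 * (enorm (x + step h k - y) ^+ 2 - enorm (x - y) ^+ 2)) ->
      0 <= w' t x + G t x (eps^-1 *: (x - y)) + N * d%:R * h / eps].

End DiscreteSubsolutions.

(** Purposes of the five bounds: the two times are closer than the terminal layer [th] and than
    [t0 / 2], the two points are at distance at most 1, the Lipschitz errors near [T] are at most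
    [e / 8], and the variation of the Hamiltonian between the two points is at most [lam / 4]. *)
Lemma exists_doubling_parameters (R : realType) (Lx Lt B t0 e th lam : R) :
  0 <= Lx -> 0 <= Lt -> 0 <= B -> 0 < t0 -> 0 < e -> 0 < th -> 0 < lam ->
  exists2 eps : R, 0 < eps & [/\ 2 * Lt * eps < th, 2 * Lt * eps < t0 / 2, 2 * Lx * eps <= 1,
    (2 * Lt ^+ 2 + 2 * Lx ^+ 2) * eps <= e / 8 &
    B * (1 + 2 * Lx) * ((2 * Lt + 2 * Lx) * eps) <= lam / 4].
Proof.
move=> Lx0 Lt0 B0 t00 e0 th0 lam0.
pose c1 := 2 * Lt; pose c3 := 2 * Lx; pose c4 := 2 * Lt ^+ 2 + 2 * Lx ^+ 2.
pose c5 := B * (1 + 2 * Lx) * (2 * Lt + 2 * Lx).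
have c10 : 0 <= c1 by rewrite /c1; ge0.
have c30 : 0 <= c3 by rewrite /c3; ge0.
have c40 : 0 <= c4 by rewrite /c4; ge0.
have c50 : 0 <= c5 by rewrite /c5; ge0.
pose D := 1 + c1 + c3 + c4 + c5.
have D0 : 0 < D by rewrite /D; lra.
pose u := Num.min (Num.min th (t0 / 2)) (Num.min 1 (Num.min (e / 8) (lam / 4))).
have u0 : 0 < u by rewrite /u !lt_min !divr_gt0// th0 ltr01.
have [u1 u2 u3 u4 u5] : [/\ u <= th, u <= t0 / 2, u <= 1, u <= e / 8 & u <= lam / 4].
  by rewrite /u; split; rewrite !ge_min lexx ?orbT.
pose eps := u / (2 * D); have eps0 : 0 < eps by rewrite divr_gt0// mulr_gt0.
have DE : D * eps = u / 2 by rewrite /eps; field; rewrite gt_eqF.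
have key c : c <= D -> c * eps <= u / 2 by move=> cD; rewrite -DE ler_pM2r.
have k1 := key c1; have k3 := key c3; have k4 := key c4; have k5 := key c5.
exists eps => //; split.
- by apply: le_lt_trans (k1 _) _; rewrite /D; lra.
- by apply: le_lt_trans (k1 _) _; rewrite /D; lra.
- by apply: le_trans (k3 _) _; rewrite /D; lra.
- by apply: le_trans (k4 _) _; rewrite /D; lra.
- by rewrite mulrA; apply: le_trans (k5 _) _; rewrite /D; lra.
Qed.

(** Doubling of variables for one half of the convergence. [G] is left abstract because the other
    half applies the result to the opposite functions and a reflected Hamiltonian. *)
Lemma discrete_subsolution_limit (R : realType) (d : nat) (T M Lx Lt N B : R)
    (G : R -> 'rV[R]_d -> 'rV[R]_d -> R) (z : R -> 'rV[R]_d -> R) (t0 : R) x0 (e : R) :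
  0 < T -> 0 <= M -> 0 <= Lx -> 0 <= Lt -> 0 <= N -> 0 <= B ->
  (forall t x p r, 0 <= t <= T -> `|G t x p - G t x r| <= B * enorm (p - r)) ->
  (forall t s x y p, 0 <= t <= T -> 0 <= s <= T ->
    `|G t x p - G s y p| <= B * (1 + enorm p) * (`|t - s| + enorm (x - y))) ->
  (forall t x, 0 <= t <= T -> `|z t x| <= M) ->
  (forall t x (e : R), 0 <= t <= T -> 0 < e -> exists2 r : R, 0 < r &
    forall s y, 0 <= s <= T -> `|s - t| < r -> enorm (y - x) < r -> `|z s y - z t x| < e) ->
  (forall phi t0 x0, C1test phi -> 0 < t0 < T ->
    loc_min T (fun s y => z s y - phi s y) t0 x0 ->
    'D_1 (fun s => phi s x0) t0 + G t0 x0 (grad (phi t0) x0) <= 0) ->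
  0 < t0 < T -> 0 < e ->
  exists2 h0 : R, 0 < h0 & forall h w w', 0 < h -> h < h0 ->
    discrete_subsolution T M Lx Lt N G h (z T) w w' -> w t0 x0 - z t0 x0 <= e.
Proof.
move=> T0 M0 Lx0 Lt0 N0 B0 GLp GLx zM zc zsuper /andP[t00 t0T] e0.
(* The slack: the linear part of [a] makes the comparison strict by [lam], and three errors of at
   most [lam / 4] each cannot use it up. *)
pose lam := e / (4 * T); have lam0 : 0 < lam by rewrite divr_gt0// mulr_gt0.
pose kap := e / 4; have kap0 : 0 < kap by rewrite divr_gt0.
have Tt0 : 0 < T - t0 by rewrite subr_gt0.
pose rho s := (T - s) / (T - t0).
have rho1 : 1 < rho (t0 / 2) by rewrite /rho ltr_pdivlMr// mul1r; lra.
pose M' := 2 * M + 1; have M'0 : 0 < M' by have := M0; rewrite /M'; lra.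
have [n Hn] := expr_unbounded M' rho1 kap0.
(* The power of rho is negligible at t0 but exceeds all a priori bounds near time 0, which
   keeps the maximum point of the doubled functional away from 0. *)
pose a s := lam * (T - s) + kap * rho s ^+ n.
pose a' s := - lam - kap * (n%:R * rho s ^+ n.-1 / (T - t0)).
(* Small enough for the gradient of the penalty [sig ^+ 2 * enorm (y - x0) ^+ 2] to cost at most
   [lam / 4] in [G]; the penalty still confines the maximum point to distance [Ry] from [x0]. *)
pose sig := lam / (8 * (B + 1) * M').
have B1 : 0 < B + 1 by rewrite ltr_wpDl.
have sig0 : 0 < sig by rewrite divr_gt0// !mulr_gt0.
pose Ry := M' / sig; have Ry0 : 0 < Ry by rewrite divr_gt0.
(* One unit of room for the distance between the two points and one for a jump of length [h < 1], so
   that all competitors stay in the box. *)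
pose r := Ry + 2; have r0 : 0 < r by rewrite /r addr_gt0.
have [th th0 Hth] := terminal_modulus T0 zc x0 r (divr_gt0 e0 (ltr0n R 8)).
have [eps eps0 [E1 E2 E3 E4 E5]] := exists_doubling_parameters Lx0 Lt0 B0 t00 e0 th0 lam0.
have Nd1 : 0 < N * d%:R + 1 by rewrite ltr_wpDl// mulr_ge0.
(* [eps] is fixed before [h]: the consistency error is [N * d%:R * h / eps], which this threshold
   keeps below [lam / 4]. *)
exists (Num.min 1 (eps * lam / (4 * (N * d%:R + 1)))).
  by rewrite lt_min ltr01 divr_gt0// mulr_gt0.
move=> h w w' h0; rewrite lt_min => /andP[h1 hN] [wM [wx wt] wT dw wsub].
rewrite leNgt; apply/negP => He.
have da (s : R) : is_derive s 1 a (a' s).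
  have d1 : is_derive s 1 (fun s : R => T - s) (- 1 : R).
    by apply: is_derive_eq; ring.
  have d2 : is_derive s 1 rho (- (T - t0)^-1).
    have -> : rho = (T - t0)^-1 *: (fun s => T - s) by apply/funext => s'; rewrite /rho mulrC.
    by apply: is_derive_eq; rewrite /GRing.scale/= mulrN1.
  have d3 := @is_deriveX _ _ rho n s 1 _ d2.
  have -> : a = lam *: (fun s => T - s) + kap *: (rho ^+ n).
    by apply/funext => s'; rewrite /a !fctE.
  apply: (is_derive_eq (is_deriveD (is_deriveZ lam d1) (is_deriveZ kap d3))).
  by rewrite /a' /GRing.scale/=; ring.
have ca : continuous a.
  move=> s; apply: differentiable_continuous; apply/derivable1_diffP.
  by have := da s => ?; exact: ex_derive.
have [t [x [s [y [tT Kx sT Ky Hmax]]]]] := doubling_max T0 zc x0 eps (sig ^+ 2) (ltW r0) wx wt ca.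
rewrite /= in Kx Ky Hmax.
have t0T' : 0 <= t0 <= T by rewrite (ltW t00) ltW.
have Kx0 i : x0 0 i - r <= x0 0 i <= x0 0 i + r by rewrite lerBlDr lerDl (ltW r0).
have rho_ge0 s' : s' <= T -> 0 <= rho s' by move=> s'T; rewrite divr_ge0 ?subr_ge0// ltW.
have a1 s' : s' <= T -> kap * rho s' ^+ n <= a s'.
  by move=> s'T; rewrite /a lerDr mulr_ge0 ?subr_ge0// ltW.
have at0 : a t0 <= e / 2.
  rewrite /a /rho divff ?gt_eqF// expr1n mulr1 /kap.
  have : lam * (T - t0) <= e / 4.
    apply: (@le_trans _ _ (lam * T)); first by rewrite ler_pM2l// gerBl ltW.
    by rewrite /lam le_eqVlt; apply/orP; left; apply/eqP; field; rewrite gt_eqF.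
  by clear; lra.
have := Hmax t0 x0 t0 x0 t0T' Kx0 t0T' Kx0.
rewrite !subrr enorm0 expr0n/= !mulr0 !subr0.
set u := enorm (x - y); set yy := enorm (y - x0) => H0.
have u0 : 0 <= u by exact: enorm_ge0.
have yy0 : 0 <= yy by exact: enorm_ge0.
have ei0 : 0 <= (2 * eps)^-1 by rewrite invr_ge0 mulr_ge0// ltW.
have pen1 : 0 <= (2 * eps)^-1 * u ^+ 2 by rewrite mulr_ge0 ?sqr_ge0.
have pen2 : 0 <= (2 * eps)^-1 * (t - s) ^+ 2 by rewrite mulr_ge0 ?sqr_ge0.
have pen3 : 0 <= sig ^+ 2 * yy ^+ 2 by rewrite mulr_ge0 ?sqr_ge0.
have sT' : s <= T by case/andP: sT.
have as0 : 0 <= a s.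
  by apply: le_trans (a1 s sT'); rewrite mulr_ge0 ?exprn_ge0 ?rho_ge0// ltW.
have Hmain : e / 2 < w t x - z s y - (2 * eps)^-1 * u ^+ 2
     - (2 * eps)^-1 * (t - s) ^+ 2 - sig ^+ 2 * yy ^+ 2 - a s.
  by apply: lt_le_trans H0; move: He at0; clear; lra.
have wzM : w t x - z s y <= 2 * M.
  have := wM t x tT; have := zM s y sT; rewrite !ler_norml => /andP[h3 h4] /andP[h5 h6].
  by move: h3 h6; clear; lra.
have sy0 : 0 <= sig * yy by exact: mulr_ge0 (ltW sig0) yy0.
have yR : yy <= Ry.
  rewrite /Ry ler_pdivlMr// mulrC -(@ler_pXn2r _ 2)//; last by rewrite nnegrE (ltW M'0).
  rewrite exprMn; apply: (@le_trans _ _ (2 * M)).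
    by move: Hmain wzM pen1 pen2 as0 e0; clear; lra.
  by have := M0; rewrite /M'; clear; nra.
have ulip : u <= 2 * Lx * eps.
  apply: quadratic_absorb => //.
  have := Hmax t y s y tT Ky sT Ky; rewrite subrr enorm0 expr0n/= mulr0 subr0 -/u -/yy.
  have := wx t x y tT; rewrite -/u ler_norml => /andP[_ H1].
  by move: H1; clear; lra.
have tlip : `|t - s| <= 2 * Lt * eps.
  apply: quadratic_absorb => //.
  have := Hmax s x s y sT Kx sT Ky; rewrite subrr expr0n/= mulr0 subr0 -/u -/yy.
  have := wt t s x tT sT; rewrite ler_norml => /andP[_ H1].
  by rewrite real_normK ?num_real//; move: H1; clear; lra.
have sgt : t0 / 2 < s.
  rewrite ltNge; apply/negP => st0.
  have R1 : rho (t0 / 2) <= rho s by rewrite /rho ler_pM2r ?invr_gt0// lerB.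
  have R2 : rho (t0 / 2) ^+ n <= rho s ^+ n.
    by apply: lerXn2r => //; rewrite nnegrE rho_ge0//; move: t00 t0T; clear; lra.
  have R3 : kap * rho (t0 / 2) ^+ n <= kap * rho s ^+ n by rewrite ler_pM2l.
  have := a1 s sT'; move: Hn R3 Hmain wzM pen1 pen2 pen3 e0; rewrite /M'.
  move: (kap * _) (kap * rho s ^+ n) => k1 k2; clear; lra.
have Hwz : e / 2 < w t x - z s y.
  by move: Hmain pen1 pen2 pen3 as0; clear; lra.
(* Near [T] the common terminal datum, the Lipschitz bounds of [w] and the modulus of [z] give a gap
   of at most [e / 4], against the gap above [e / 2] at the maximum point. *)
have boundary : T - s < th -> T - t <= 2 * Lt * eps -> False.
  move=> Ts Tt.
  have := Hth s y sT Ts Ky.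
  have tT' : t <= T by case/andP: tT.
  have TT : 0 <= T <= T by rewrite lexx ltW.
  have := wt t T x tT TT; rewrite (distrC t T) (@ger0_norm _ (T - t)) ?subr_ge0// ler_norml => /andP[_ W1].
  have := wx T x y TT; rewrite -/u ler_norml => /andP[_ W2].
  have W3 : Lt * (T - t) <= Lt * (2 * Lt * eps) by rewrite ler_wpM2l.
  have W4 : Lx * u <= Lx * (2 * Lx * eps) by rewrite ler_wpM2l.
  have W5 : Lt * (2 * Lt * eps) + Lx * (2 * Lx * eps) <= e / 8.
    by apply: le_trans E4; rewrite le_eqVlt; apply/orP; left; apply/eqP; ring.
  have := wT y; move: W1 W2 W3 W4 W5 Hwz e0; rewrite wT.
  by clear; lra.
have tltT : t < T.
  rewrite lt_neqAle (proj2 (andP tT)) andbT; apply/eqP => tE.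
  apply: boundary; last by rewrite tE subrr; ge0.
  apply: le_lt_trans E1; apply: le_trans tlip; rewrite -tE; exact: ler_norm.
have sltT : s < T.
  rewrite lt_neqAle sT' andbT; apply/eqP => sE.
  apply: boundary; first by rewrite sE subrr.
  by apply: le_trans tlip; rewrite distrC -sE; exact: ler_norm.
have tgt0 : 0 < t.
  have : s - t <= 2 * Lt * eps by apply: le_trans tlip; rewrite distrC ler_norm.
  by move: sgt E2; clear; lra.
have sgt0 : 0 < s by apply: lt_trans sgt; rewrite divr_gt0.
have tTT : 0 < t < T by rewrite tgt0.
have sTT : 0 < s < T by rewrite sgt0.
(* First-order condition in time. In [x], where [w] need not be differentiable, maximality is used
   along the jumps [step h k] instead. *)
have w'E : w' t x = (t - s) / eps.
  pose f r := w r x - (2 * eps)^-1 * (r - s) ^+ 2.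
  have df r' : 0 < r' < T -> is_derive r' 1 f (w' r' x - (r' - s) / eps).
    move=> hr; have := dw r' x hr => ?; rewrite /f.
    apply: is_derive_eq; rewrite /GRing.scale/=; field; rewrite gt_eqF//.
  have : is_derive t 1 f 0.
    apply: (@derive1_at_max R f 0 T t (ltW T0)).
    - by move=> r'; rewrite in_itv/= => hr; have := df r' hr => ?; exact: ex_derive.
    - by rewrite in_itv.
    - move=> r'; rewrite in_itv/= => /andP[hr1 hr2].
      have hr : 0 <= r' <= T by rewrite !ltW.
      have := Hmax r' x s y hr Kx sT Ky; rewrite -/u -/yy /f; clear; lra.
  move=> d1; have d2 := df t tTT.
  have E1' : 'D_1 f t = 0 by case: d1.
  have E2' : 'D_1 f t = w' t x - (t - s) / eps by case: d2.
  by apply: subr0_eq; rewrite -E2' E1'.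
have Kstep k i : x0 0 i - r <= (x + step h k) 0 i <= x0 0 i + r.
  have := enorm_coord (x + step h k - x0) i.
  have : enorm (x + step h k - x0) <= r.
    have -> : x + step h k - x0 = (x - y) + (y - x0) + step h k.
      by apply/rowP => j; rewrite !mxE; ring.
    apply: le_trans (enormD _ _) _; rewrite (enorm_step _ (ltW h0)).
    have := enormD (x - y) (y - x0); rewrite -/u -/yy /r.
    by move: yR ulip E3 h1; clear; lra.
  rewrite [(x + step h k - x0) 0 i]mxE [(- x0) 0 i]mxE => H1 H2.
  have := le_trans H2 H1; rewrite ler_norml => /andP[H3 H4].
  by apply/andP; split; move: H3 H4; clear; lra.
have Sub : 0 <= w' t x + G t x (eps^-1 *: (x - y)) + N * d%:R * h / eps.
  apply: wsub => // k.
  have := Hmax t (x + step h k) s y tT (Kstep k) sT Ky; rewrite -/u -/yy.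
  by clear; lra.
pose A s' := - (2 * eps)^-1 * (t - s') ^+ 2 - a s'.
pose A' s' := (t - s') / eps - a' s'.
have dA (s' : R) : is_derive s' 1 A (A' s').
  have := da s' => ?; rewrite /A; apply: is_derive_eq; rewrite /A' /GRing.scale/=.
  by field; rewrite gt_eqF.
have cA' : continuous A'.
  have -> : A' = (fun s' => 1 * (eps^-1 * (cst t s') + (- eps^-1) * id s')
     + 1 * (1 * cst lam s' + (kap * n%:R / (T - t0)) * rho s' ^+ n.-1)).
    by apply/funext => s'; rewrite /A' /a' /=; field; rewrite !gt_eqF.
  apply: continuous_lincomb; apply: continuous_lincomb.
  - exact: cst_continuous.
  - by move=> ?; exact: cvg_id.
  - exact: cst_continuous.
  - move=> s'; apply: (@continuous_comp _ _ _ rho (fun r : R => r ^+ n.-1)); last exact: exprn_continuous.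
    have -> : rho = (fun s' => (T - t0)^-1 * cst T s' + (- (T - t0)^-1) * id s').
      by apply/funext => s''; rewrite /rho /=; ring.
    by apply: continuous_lincomb => ?; [exact: cst_continuous|exact: cvg_id].
have [C1 Dphi] := C1test_separated x x0 (- (2 * eps)^-1) (- sig ^+ 2) dA cA'.
have Dsy := Dphi s y.
have Super : A' s + G s y (eps^-1 *: (x - y) - (2 * sig ^+ 2) *: (y - x0)) <= 0.
  have lm : loc_min T (fun s' y' => z s' y' - (A s' + (- (2 * eps)^-1 * sqdist x y'
       + - sig ^+ 2 * sqdist x0 y'))) s y.
    exists 1 => // s' y' /andP[hs1 hs2] _ yy1.
    have hs : 0 <= s' <= T by rewrite !ltW.
    have Ky' i : x0 0 i - r <= y' 0 i <= x0 0 i + r.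
      have := enorm_coord (y' - x0) i.
      have : enorm (y' - x0) <= r.
        have -> : y' - x0 = (y' - y) + (y - x0) by apply/rowP => j; rewrite !mxE; ring.
        apply: le_trans (enormD _ _) _; rewrite -/yy /r.
        by move: yR yy1; clear; lra.
      rewrite [(y' - x0) 0 i]mxE [(- x0) 0 i]mxE => H1 H2.
      have := le_trans H2 H1; rewrite ler_norml => /andP[H3 H4].
      by apply/andP; split; move: H3 H4; clear; lra.
    have := Hmax t x s' y' tT Kx hs Ky'.
    rewrite /A !sqdistE [enorm (y - x)]enormB [enorm (y' - x)]enormB.
    by clear; lra.
  have := zsuper _ _ _ C1 sTT lm; rewrite (proj1 Dsy) (proj2 Dsy).
  congr (_ + G s y _ <= _); apply/rowP => j; rewrite !mxE; field; rewrite gt_eqF//.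
have la' : lam <= - a' s.
  rewrite /a' opprB opprK lerDr mulr_ge0 ?(ltW kap0)// divr_ge0 ?(ltW Tt0)//.
  by rewrite mulr_ge0// exprn_ge0// rho_ge0.
set p := eps^-1 *: (x - y) in Sub Super.
have pL : enorm p <= 2 * Lx.
  rewrite /p enormZ gtr0_norm ?invr_gt0// -/u mulrC ler_pdivrMr//.
have G1 : `|G t x p - G s y p| <= lam / 4.
  apply: le_trans (GLx t s x y p tT sT) _; apply: le_trans E5; rewrite -/u.
  apply: ler_pM.
  - by rewrite mulr_ge0// addr_ge0// enorm_ge0.
  - by rewrite addr_ge0.
  - by rewrite ler_wpM2l// lerD2l.
  - by rewrite mulrDl lerD.
have G2 : `|G s y p - G s y (p - (2 * sig ^+ 2) *: (y - x0))| <= lam / 4.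
  apply: le_trans (GLp s y _ _ sT) _; rewrite opprB addrCA subrr addr0 enormZ -/yy.
  rewrite ger0_norm; last by rewrite mulr_ge0 ?sqr_ge0.
  have H1 : sig * yy <= M'.
    by move: yR; rewrite /Ry ler_pdivlMr// mulrC.
  apply: (@le_trans _ _ ((B + 1) * (2 * sig * M'))).
    apply: ler_pM => //; first by rewrite mulr_ge0// mulr_ge0 ?sqr_ge0.
      by rewrite lerDl.
    have -> : 2 * sig ^+ 2 * yy = 2 * sig * (sig * yy) by ring.
    by rewrite ler_wpM2l// mulr_ge0// ltW.
  by rewrite /sig le_eqVlt; apply/orP; left; apply/eqP; field; rewrite !gt_eqF.
have G3 : N * d%:R * h / eps <= lam / 4.
  rewrite ler_pdivrMr//; move: (ltW hN); rewrite ler_pdivlMr ?mulr_gt0// => H1.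
  have : 0 <= 4 * h by rewrite mulr_ge0// ltW.
  by move: H1; rewrite mulrDr mulr1; move: (N * d%:R) => c; clear; nra.
move: G1 G2; rewrite !ler_norml => /andP[_ G1] /andP[_ G2].
move: Sub Super la' lam0; rewrite w'E /A'.
by move: G1 G2 G3; clear; lra.
Qed.

Section Hamiltonian.
Variables (R : realType) (d m : nat) (T N : R) (A : set 'rV[R]_m).
Variables (c : R -> 'rV[R]_d -> 'rV[R]_m -> R) (f : R -> 'rV[R]_d -> 'rV[R]_m -> 'rV[R]_d).
Variables (q : 'rV[R]_d -> R) (alpha : R -> 'rV[R]_d -> 'rV[R]_d -> 'rV[R]_m).
Hypothesis argmin : is_unique_argmin T A c f alpha.
Hypothesis A1 : assumption_A1 T A c f q.
Implicit Types (x y p r : 'rV[R]_d).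

Lemma Ham_lipschitz : exists B : R, [/\ 0 <= B,
  forall t x p r, 0 <= t <= T -> `|Ham A c f t x p - Ham A c f t x r| <= B * enorm (p - r)
  & forall t s x y p, 0 <= t <= T -> 0 <= s <= T ->
    `|Ham A c f t x p - Ham A c f s y p| <= B * (1 + enorm p) * (`|t - s| + enorm (x - y))].
Proof.
have [M [L [cfM [_ [cfL _]]]]] := A1.
pose B := `|M| + `|L|.
have B0 : 0 <= B by rewrite addr_ge0.
have MB : M <= B by rewrite (le_trans (ler_norm _))// lerDl.
have LB : L <= B by rewrite (le_trans (ler_norm _))// lerDr.
exists B; split => //.
- suff H t x p r : 0 <= t <= T -> Ham A c f t x p - Ham A c f t x r <= B * enorm (p - r).
    by move=> t x p r tT; rewrite ler_norml lerNl opprB {1}enormB !H.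
  move=> tT; pose a := alpha t x r; have Aa : A a by have [] := argmin x r tT.
  have H1 := Ham_le argmin x p tT Aa; have H2 := Ham_argmin argmin x r tT.
  apply: (@le_trans _ _ (dotv (p - r) (f t x a))).
    by rewrite dotvBl H2 -/a; move: H1; lra.
  apply: le_trans (dotv_le_enorm _ _) _; rewrite mulrC.
  apply: ler_wpM2r; first exact: enorm_ge0.
  by have [_ fM] := cfM t x a tT Aa; apply: le_trans fM MB.
- suff H t s x y p : 0 <= t <= T -> 0 <= s <= T -> Ham A c f t x p - Ham A c f s y p <=
      B * (1 + enorm p) * (`|t - s| + enorm (x - y)).
    move=> t s x y p tT sT; rewrite ler_norml lerNl opprB H// andbT.
    by rewrite distrC enormB H.
  move=> tT sT; pose a := alpha s y p; have Aa : A a by have [] := argmin y p sT.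
  have H1 := Ham_le argmin x p tT Aa; have H2 := Ham_argmin argmin y p sT.
  have [cL fL] := cfL t s x y a a tT sT Aa Aa.
  rewrite subrr enorm0 addr0 in cL fL.
  set D := `|t - s| + enorm (x - y) in cL fL *.
  have D0 : 0 <= D by rewrite addr_ge0 ?enorm_ge0.
  have LD : L * D <= B * D by rewrite ler_wpM2r.
  apply: (@le_trans _ _ (c t x a - c s y a + dotv p (f t x a - f s y a))).
    by rewrite dotvBr H2 -/a; move: H1; lra.
  rewrite [leRHS](_ : _ = B * D + enorm p * (B * D)); last by ring.
  apply: lerD.
    by apply: le_trans (ler_norm _) _; apply: le_trans cL LD.
  apply: le_trans (dotv_le_enorm _ _) _.
  by apply: ler_wpM2l; [exact: enorm_ge0|exact: le_trans fL LD].
Qed.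

End Hamiltonian.

Section Parabola.
Variables (R : realType) (d : nat).
Implicit Types (x y F : 'rV[R]_d).

(** Central differences are exact on quadratics, so the viscosity term is the whole consistency
    error. *)
Lemma gen_sqdist (N h : R) F y x : h != 0 ->
  gen N h F (sqdist y) x = 2 * dotv (x - y) F + 2 * (N * d%:R * h).
Proof.
move=> h0; rewrite -gen_gradh_laplh//.
have sq i (e : R) : sqdist y (x + e *: evec R i) = sqdist y x + e * (2 * (x - y) 0 i) + e ^+ 2.
  by rewrite addrC sqdist_line.
have sqN i (e : R) : sqdist y (x - e *: evec R i) = sqdist y x - e * (2 * (x - y) 0 i) + e ^+ 2.
  by rewrite -scaleNr sq sqrrN mulNr.
congr (_ + _).
  rewrite -dotvZl; congr dotv; apply/rowP => i; rewrite mxE sq sqN !mxE.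
  by field.
rewrite /laplh (eq_bigr (fun=> 2)); last by move=> i _; rewrite sq sqN; field.
by rewrite sumr_const card_ord -[2 *+ d]mulr_natl; ring.
Qed.

Lemma gen_monotone (N h : R) F (phi psi : 'rV[R]_d -> R) x : 0 < h -> enorm F <= 2 * N ->
  (forall k, phi (x + step h k) - phi x <= psi (x + step h k) - psi x) ->
  gen N h F phi x <= gen N h F psi x.
Proof. by move=> h0 FN H; apply: ler_sum => k _; rewrite ler_wpM2l ?rate_ge0. Qed.

Lemma genZ (N h b : R) F (phi : 'rV[R]_d -> R) x :
  gen N h F (fun y => b * phi y) x = b * gen N h F phi x.
Proof. by rewrite /gen mulr_sumr; apply: eq_bigr => k _; ring. Qed.

Lemma C1testN (phi : R -> 'rV[R]_d -> R) : C1test phi -> C1test (fun s y => - phi s y).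
Proof.
move=> [dt [dx [j0 [jt jx]]]].
have jN (g : R -> 'rV[R]_d -> R) : jcont g -> jcont (fun s y => - g s y).
  move=> jg t x e e0; have [r r0 H] := jg t x e e0.
  by exists r => // s y st yx; rewrite -opprD normrN; exact: H.
split; [|split; [|split; [|split]]].
- by move=> t x; apply: derivableN; exact: dt.
- by move=> t x i; apply: derivableN; exact: dx.
- exact: jN.
- have -> : (fun t x => 'D_1 (fun s => - phi s x) t) = (fun t x => - 'D_1 (fun s => phi s x) t).
    by apply/funext => t; apply/funext => x; rewrite deriveN.
  exact: jN.
- move=> i.
  have -> : (fun t x => partial i (fun y => - phi t y) x) = (fun t x => - partial i (phi t) x).
    by apply/funext => t; apply/funext => x; rewrite /partial deriveN.
  exact: jN.
Qed.

End Parabola.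

Section Convergence.
Variables (R : realType) (d m : nat) (T N : R) (A : set 'rV[R]_m).
Variables (c : R -> 'rV[R]_d -> 'rV[R]_m -> R) (f : R -> 'rV[R]_d -> 'rV[R]_m -> 'rV[R]_d).
Variables (q : 'rV[R]_d -> R) (alpha : R -> 'rV[R]_d -> 'rV[R]_d -> 'rV[R]_m).
Hypothesis argmin : is_unique_argmin T A c f alpha.
Hypothesis A1 : assumption_A1 T A c f q.
Hypothesis A3 : assumption_A3 T A c f q.
Hypothesis NF : Num.max 1 (supnorm_f T A f / 2) <= N.
Hypothesis T0 : 0 < T.
Implicit Types (x y p : 'rV[R]_d).

Let drift_le' := drift_le A1 NF.

(** The first half uses the control minimising at the gradient of the paraboloid, for which the
    scheme is an inequality in the right direction; the second uses the control minimising for [w]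
    itself, for which the scheme is an equality. *)
Lemma semidiscrete_discrete_subsolutions (M L K h Mw : R) (w w' : R -> 'rV[R]_d -> R) :
  scheme_solution T N h M L K q w w' -> semidiscrete_solution T N h A c f q w ->
  (forall t x, 0 < t < T -> w' t x = 'D_1 (fun s => w s x) t) ->
  (forall t x, 0 <= t <= T -> `|w t x| <= Mw) ->
  discrete_subsolution T Mw (lip_space d T L) (lip_time d T N M L) N (Ham A c f) h q w w' /\
  discrete_subsolution T Mw (lip_space d T L) (lip_time d T N M L) N
    (fun t x p => - Ham A c f t x (- p)) h (fun x => - q x)
    (fun t x => - w t x) (fun t x => - w' t x).
Proof.
move=> sol [_ [_ [dw wT]]] w'E wM; have h0 := sol_h sol.
have hn : h != 0 by rewrite gt_eqF.
have tTw (t : R) : 0 < t < T -> 0 <= t <= T by move=> /andP[? ?]; rewrite !ltW.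
have eqw t x : 0 < t < T -> let a := alpha t x (gradh h (w t) x) in
    A a /\ - w' t x = c t x a + gen N h (f t x a) (w t) x.
  move=> tT a; have [Aa _] := argmin x (gradh h (w t) x) (tTw t tT); split => //.
  have [_ E] := dw t x tT; rewrite w'E// -gen_gradh_laplh// addrA -(Ham_argmin argmin)// ?tTw//; lra.
have lew t x a : 0 < t < T -> A a -> - w' t x <= c t x a + gen N h (f t x a) (w t) x.
  move=> tT Aa; have [_ E] := dw t x tT; rewrite w'E// -gen_gradh_laplh//.
  by have := Ham_le argmin x (gradh h (w t) x) (tTw t tT) Aa; lra.
have parab (eps : R) F x y : 0 < eps -> gen N h F (fun z => (2 * eps)^-1 * sqdist y z) x =
    dotv (eps^-1 *: (x - y)) F + N * d%:R * h / eps.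
  move=> e0; rewrite genZ gen_sqdist// dotvZl; field; rewrite gt_eqF//.
split; split => //.
- by split => [t x y|s t x]; [exact: (scheme_lip sol)|exact: (scheme_lip_time sol)].
- exact: (sol_derive sol).
- move=> t x y eps tT e0 H.
  pose p := eps^-1 *: (x - y); pose a := alpha t x p.
  have Aa : A a by have [] := argmin x p (tTw t tT).
  rewrite -/p (Ham_argmin argmin _ _ (tTw t tT)) -/a.
  have H1 := lew t x a tT Aa.
  have H2 : gen N h (f t x a) (w t) x <= gen N h (f t x a) (fun z => (2 * eps)^-1 * sqdist y z) x.
    apply: gen_monotone => //; first by rewrite drift_le' ?tTw.
    by move=> k; rewrite -mulrBr !sqdistE; exact: H.
  by rewrite parab// -/p in H2; lra.
- by move=> t x tT; rewrite normrN wM.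
- split => [t x y|s t x] H; rewrite -opprD normrN; first exact: (scheme_lip sol).
  by move=> H'; exact: (scheme_lip_time sol).
- by move=> x; rewrite wT.
- by move=> t x tT; have := sol_derive sol x tT => ?; exact: is_deriveN.
- move=> t x y eps tT e0 H.
  pose p := eps^-1 *: (x - y).
  have [Aa E] := eqw t x tT; set a := alpha _ _ _ in Aa E.
  have H1 := Ham_le argmin x (- p) (tTw t tT) Aa.
  rewrite -/p.
  have H2 : gen N h (f t x a) (fun z => - (2 * eps)^-1 * sqdist y z) x <= gen N h (f t x a) (w t) x.
    apply: gen_monotone => //; first by rewrite drift_le' ?tTw.
    by move=> k; have := H k; rewrite -mulrBr !sqdistE mulNr; lra.
  have E2 : gen N h (f t x a) (fun z => - (2 * eps)^-1 * sqdist y z) x =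
      - (dotv p (f t x a) + N * d%:R * h / eps).
    by rewrite genZ mulNr -genZ parab.
  by rewrite E2 in H2; rewrite dotvNl in H1; lra.
Qed.

Variables (vh : R -> R -> 'rV[R]_d -> R) (v : R -> 'rV[R]_d -> R).
Hypothesis vhS : forall h, 0 < h < 1 -> semidiscrete_solution T N h A c f q (vh h).
Hypothesis vS : viscosity_solution T A c f q v.
Variables (M L K : R).
Hypothesis sol : forall h, 0 < h < 1 ->
  scheme_solution T N h M L K q (vh h) (fun t x => 'D_1 (fun s => vh h s x) t).

Lemma semidiscrete_converges t x (e : R) : 0 <= t <= T -> 0 < e ->
  exists2 h0 : R, 0 < h0 & forall h, 0 < h < h0 -> h < 1 -> `|vh h t x - v t x| <= e.
Proof.
suff interior s (e' : R) : 0 < s < T -> 0 < e' ->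
    exists2 h0 : R, 0 < h0 & forall h, 0 < h < h0 -> h < 1 -> `|vh h s x - v s x| <= e'.
  move=> /andP[t0 tT] e0.
  have [_ [vc [vT _]]] := vS.
  have [tE|tT'] := eqVneq t T.
    exists 1 => // h hh _; have [_ [_ [_ hT]]] := vhS hh.
    by rewrite tE vT hT subrr normr0 ltW.
  have [t00|tn0] := eqVneq t 0; last first.
    by apply: interior => //; rewrite !lt_neqAle t0 tT tT' eq_sym tn0.
  (* The viscosity inequalities say nothing at time 0: a nearby interior time [s] is used instead,
     by continuity of [v] and the Lipschitz bound of the scheme in time. *)
  have e3 : 0 < e / 3 by rewrite divr_gt0.
  have I0 : 0 <= (0 : R) <= T by rewrite lexx ltW.
  have [r r0 Hr] := vc 0 x (e / 3) I0 e3.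
  pose Lt := lip_time d T N M L.
  have Lt0 : 0 <= Lt.
    have half : 0 < (2^-1 : R) < 1 by rewrite invr_gt0 ltr0n invf_lt1// ltr1n.
    exact: lip_time_ge0 (sol half).
  have L1 : 0 < Lt + 1 by rewrite ltr_wpDl.
  pose s := Num.min (Num.min (T / 2) (r / 2)) (e / 3 / (Lt + 1)).
  have s0 : 0 < s by rewrite /s !lt_min !divr_gt0.
  have sT : s <= T / 2 by rewrite /s !ge_min lexx.
  have sr : s <= r / 2 by rewrite /s !ge_min lexx orbT.
  have sL : s <= e / 3 / (Lt + 1) by rewrite /s ge_min lexx orbT.
  have sTT : 0 < s < T by rewrite s0; have := T0; move: sT; lra.
  have sI : 0 <= s <= T by case/andP: sTT => ? ?; rewrite !ltW.
  have [h0 h00 Hh] := interior s (e / 3) sTT e3.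
  exists h0 => // h hh h1; have hI : 0 < h < 1 by case/andP: hh => -> _.
  have := Hh h hh h1.
  have := scheme_lip_time (sol hI) x I0 sI; rewrite -/Lt sub0r normrN (gtr0_norm s0) => H1.
  have H2 : Lt * s <= e / 3.
    apply: (@le_trans _ _ ((Lt + 1) * s)); first by rewrite ler_pM2r// lerDl.
    by rewrite mulrC -ler_pdivlMr.
  have H3 : `|v s x - v 0 x| < e / 3.
    apply: Hr => //; last by rewrite subrr enorm0.
    by rewrite subr0 gtr0_norm//; move: sr r0; lra.
  rewrite t00; have {}H1 := le_trans H1 H2; move: H1 H3.
  rewrite !ler_norml ltr_norml => /andP[a1 a2] /andP[a3 a4] /andP[a5 a6].
  by apply/andP; split; lra.
move=> sT e0.
have [Mq [_ [_ [qM _]]]] := A1.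
have [[Mv vM] [vc [vT [vsub vsup]]]] := vS.
have half : 0 < (2^-1 : R) < 1 by rewrite invr_gt0 ltr0n invf_lt1// ltr1n.
pose Lt := lip_time d T N M L; have Lt0 : 0 <= Lt := lip_time_ge0 (sol half).
have Lx0 := lip_space_ge0 (sol half).
have N0 : 0 <= N by apply: le_trans (sol_N (sol half)).
have [B [B0 HLp HLx]] := Ham_lipschitz argmin A1.
pose Mm := `|Mq| + Lt * T + `|Mv|.
have Mm0 : 0 <= Mm by rewrite /Mm; have T0' := ltW T0; ge0.
have zM r y : 0 <= r <= T -> `|v r y| <= Mm.
  move=> rT; apply: le_trans (vM r y rT) _; apply: le_trans (ler_norm _) _.
  by rewrite /Mm lerDr addr_ge0// mulr_ge0// ltW.
have wM h : 0 < h < 1 -> forall r y, 0 <= r <= T -> `|vh h r y| <= Mm.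
  move=> hI r y rT; have TT : 0 <= T <= T by rewrite lexx ltW.
  have H1 := scheme_lip_time (sol hI) y rT TT.
  have H2 : `|r - T| <= T by case/andP: rT => r0 rT; rewrite distrC ger0_norm ?subr_ge0// gerBl.
  have H3 : Lt * `|r - T| <= Lt * T by rewrite ler_wpM2l.
  have -> : vh h r y = vh h r y - vh h T y + q y by rewrite (sol_terminal (sol hI)); ring.
  apply: le_trans (ler_normD _ _) _; rewrite /Mm addrC; apply: (@le_trans _ _ (`|Mq| + Lt * T)).
    by apply: lerD; [exact: le_trans (qM y) (ler_norm _)|exact: le_trans H1 H3].
  by rewrite lerDl.
have vTq : v T = q by apply/funext => y; exact: vT.
have [h1 h10 H1] := discrete_subsolution_limit x T0 Mm0 Lx0 Lt0 N0 B0 HLp HLx zM vc vsup sT e0.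
(* Changing the sign of [v], and [H(t, x, p)] into [- H(t, x, - p)], exchanges subsolutions and
   supersolutions; this yields the lower bound. *)
have HLp' (t' : R) y p p' : 0 <= t' <= T ->
    `|- Ham A c f t' y (- p) - - Ham A c f t' y (- p')| <= B * enorm (p - p').
  move=> tT; have -> : enorm (p - p') = enorm (- p - - p') by rewrite -opprD enormN.
  by rewrite -opprD normrN; exact: HLp.
have HLx' (t' r : R) y y' p : 0 <= t' <= T -> 0 <= r <= T ->
    `|- Ham A c f t' y (- p) - - Ham A c f r y' (- p)| <=
    B * (1 + enorm p) * (`|t' - r| + enorm (y - y')).
  by move=> tT rT; rewrite -opprD normrN; have := HLx t' r y y' (- p) tT rT; rewrite enormN.
have zM' r y : 0 <= r <= T -> `|- v r y| <= Mm by rewrite normrN; exact: zM.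
have vc' (t' : R) y (e1 : R) : 0 <= t' <= T -> 0 < e1 -> exists2 r : R, 0 < r &
    forall s y', 0 <= s <= T -> `|s - t'| < r -> enorm (y' - y) < r -> `|- v s y' - - v t' y| < e1.
  move=> tT e''; have [r r0 H] := vc t' y e1 tT e''.
  by exists r => // s' y' s'T st yy; rewrite -opprD normrN; exact: H.
have vsup' phi (t0 : R) x0 : C1test phi -> 0 < t0 < T ->
    loc_min T (fun s y => - v s y - phi s y) t0 x0 ->
    'D_1 (fun s => phi s x0) t0 + - Ham A c f t0 x0 (- grad (phi t0) x0) <= 0.
  move=> C1 t0T [r r0 Hm].
  have := vsub (fun s y => - phi s y) t0 x0 (C1testN C1) t0T.
  have -> : 'D_1 (fun s => - phi s x0) t0 = - 'D_1 (fun s => phi s x0) t0.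
    by rewrite deriveN//; case: C1.
  have -> : grad (fun y => - phi t0 y) x0 = - grad (phi t0) x0.
    by apply/rowP => i; rewrite !mxE /partial deriveN//; case: C1 => _ [].
  move=> H; suff : 0 <= - 'D_1 (fun s => phi s x0) t0 + Ham A c f t0 x0 (- grad (phi t0) x0) by lra.
  apply: H; exists r => // s' y' h1' h2' h3'.
  by have := Hm s' y' h1' h2' h3'; lra.
have [h2 h20 H2] := discrete_subsolution_limit (G := fun t x p => - Ham A c f t x (- p))
  (z := fun t x => - v t x) x T0 Mm0 Lx0 Lt0 N0 B0 HLp' HLx' zM' vc' vsup' sT e0.
exists (Num.min h1 h2); first by rewrite lt_min h10.
move=> h /andP[h0]; rewrite lt_min => /andP[hh1 hh2] hlt1.
have hI : 0 < h < 1 by rewrite h0.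
have [S1 S2] := semidiscrete_discrete_subsolutions (sol hI) (vhS hI) (fun t y _ => erefl) (wM h hI).
rewrite vTq in H1; have G1 := H1 h _ _ h0 hh1 S1.
have vTq' : (fun y => - v T y) = (fun y => - q y) by rewrite vTq.
rewrite vTq' in H2; have G2 := H2 h _ _ h0 hh2 S2.
rewrite ler_norml; apply/andP; split; [move: G2|exact: G1].
lra.
Qed.

End Convergence.

(** * Null sets and counting *)

Section NullSets.
Variables (R : realType) (d : nat).
Implicit Types (a b : 'rV[R]_d.+1).

Lemma box_vol_ge0 a b : (forall i, a 0 i <= b 0 i) -> 0 <= box_vol a b.
Proof. by move=> ab; apply: prodr_ge0 => i _; rewrite subr_ge0. Qed.

(** False in dimension 0, where the empty product is 1; hence dimension [d.+1] for null sets. *)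
Lemma box_vol_point a : box_vol a a = 0.
Proof. by rewrite /box_vol (bigD1 ord0)//= subrr mul0r. Qed.

Lemma sum_nth_le (U : Type) (x0 : U) (F : U -> R) (s : seq U) k :
  (forall x, 0 <= F x) -> F x0 = 0 -> \sum_(n < k) F (nth x0 s n) <= \sum_(x <- s) F x.
Proof.
move=> F0 Fx; elim: s k => [|x s IH] [|k].
- by rewrite big_ord0 big_nil.
- by rewrite big_nil big1// => i _; rewrite nth_nil.
- by rewrite big_ord0; apply: sumr_ge0.
- by rewrite big_ord_recl big_cons lerD2l IH.
Qed.

(** The list is prolonged by degenerate boxes of volume 0. *)
Lemma lebesgue_null_finite_cover (E : set 'rV[R]_d.+1) :
  (forall e : R, 0 < e -> exists s : seq ('rV[R]_d.+1 * 'rV[R]_d.+1),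
    [/\ forall p, p \in s -> forall i, p.1 0 i <= p.2 0 i,
        forall x, E x -> exists2 p, p \in s & forall i, p.1 0 i <= x 0 i <= p.2 0 i
      & \sum_(p <- s) box_vol p.1 p.2 <= e]) ->
  lebesgue_null E.
Proof.
move=> H e e0; have [s [s1 s2 s3]] := H e e0.
pose B n := nth ((0, 0) : 'rV[R]_d.+1 * 'rV[R]_d.+1) s n.
exists (fun n => (B n).1), (fun n => (B n).2); split.
- move=> n i; rewrite /B; have [ns|ns] := ltnP n (size s); first by apply: s1; rewrite mem_nth.
  by rewrite nth_default.
- move=> x /s2[p ps px]; exists (index p s) => i; rewrite /B nth_index//.
- move=> k; apply: le_trans s3.
  pose F (p : 'rV[R]_d.+1 * 'rV[R]_d.+1) := if p \in s then box_vol p.1 p.2 else 0.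
  have F0 p : 0 <= F p by rewrite /F; case: ifP => // ps; apply: box_vol_ge0; exact: s1.
  have -> : \sum_(p <- s) box_vol p.1 p.2 = \sum_(p <- s) F p.
    by rewrite big_seq [RHS]big_seq; apply: eq_bigr => p ps; rewrite /F ps.
  have E0 : F (0, 0) = 0 by rewrite /F box_vol_point if_same.
  have -> : \sum_(n < k) box_vol (B n).1 (B n).2 = \sum_(n < k) F (B n).
    apply: eq_bigr => n _; rewrite /F; case: ifP => // /negbT; rewrite /B => ns.
    by rewrite nth_default ?box_vol_point// leqNgt; apply: contra ns => ns; exact: mem_nth.
  exact: sum_nth_le.
Qed.

Lemma sum_subset_le (I : eqType) (F : I -> R) (s t : seq I) :
  (forall x, 0 <= F x) -> uniq s -> uniq t -> {subset s <= t} ->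
  \sum_(x <- s) F x <= \sum_(x <- t) F x.
Proof.
move=> F0 us ut st; rewrite [leRHS](bigID (mem s))/= -[leLHS]addr0.
apply: lerD; last by apply: sumr_ge0.
rewrite -[X in _ <= X]big_filter le_eqVlt; apply/orP; left; apply/eqP.
apply: perm_big; apply: uniq_perm => //; first exact: filter_uniq.
by move=> x; rewrite mem_filter/=; case: (boolP (x \in s)) => //= /st ->.
Qed.

(** The definition bounds partial sums only, so no double series is rearranged: a partial sum of the
    merged enumeration is dominated by a finite rectangle of indices, and the set of index [i] gets
    the share [e / 2 ^+ (pickle i).+1]. *)
Lemma lebesgue_null_bigcup (I : countType) (E : I -> set 'rV[R]_d.+1) :
  (forall i, lebesgue_null (E i)) -> lebesgue_null (fun x => exists i, E i x).
Proof.
move=> H e e0.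
have p2 n : 0 < (2 : R) ^+ n by rewrite exprn_gt0.
have en (i : I) : 0 < e / 2 ^+ (pickle i).+1 by rewrite divr_gt0.
have [ab Hab] := boolp.choice (fun i => H i _ (en i)).
have [bb Hbb] := boolp.choice Hab.
pose pt : 'rV[R]_d.+1 * 'rV[R]_d.+1 := (0, 0).
pose B m := if @pickle_inv (I * nat)%type m is Some p then (ab p.1 p.2, bb p.1 p.2) else pt.
pose V (p : I * nat) := box_vol (ab p.1 p.2) (bb p.1 p.2).
have V0 p : 0 <= V p by case: (Hbb p.1) => h _ _; exact: box_vol_ge0.
exists (fun m => (B m).1), (fun m => (B m).2); split.
- move=> m i; rewrite /B; case: pickle_inv => [p|] //=; by case: (Hbb p.1) => h _ _; exact: h.
- move=> x [i Ex]; have [_ h _] := Hbb i; have [n Hn] := h x Ex.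
  by exists (pickle (i, n)) => j; rewrite /B pickleK_inv.
- move=> k.
  pose S := pmap (@pickle_inv (I * nat)%type) (iota 0 k).
  have uS : uniq S by apply: pmap_uniq (iota_uniq 0 k); exact: pickle_invK.
  have -> : \sum_(n < k) box_vol (B n).1 (B n).2 = \sum_(p <- S) V p.
    rewrite -(big_mkord xpredT (fun n => box_vol (B n).1 (B n).2)) /index_iota subn0 /S.
    elim: (iota 0 k) => [|m s IH]; first by rewrite !big_nil.
    rewrite big_cons IH /= {1 2}/B; case: pickle_inv => [p|] /=; first by rewrite big_cons.
    by rewrite box_vol_point add0r.
  pose us := undup [seq p.1 | p <- S]; pose N := \max_(p <- S) p.2.+1.
  pose t := [seq (i, n) | i <- us, n <- iota 0 N].
  apply: (@le_trans _ _ (\sum_(p <- t) V p)).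
    apply: sum_subset_le => //.
      apply: allpairs_uniq; [exact: undup_uniq|exact: iota_uniq|by move=> [? ?] [? ?]].
    move=> [i n] pS; apply/allpairsP; exists (i, n); split => //=.
      by rewrite mem_undup; apply/mapP; exists (i, n).
    rewrite mem_iota/= add0n /N; exact: (@leq_bigmax_seq _ _ xpredT (fun p => p.2.+1) (i, n)).
  rewrite big_allpairs_dep/=.
  apply: (@le_trans _ _ (\sum_(i <- us) e / 2 ^+ (pickle i).+1)).
    apply: ler_sum => i _; have [_ _ h] := Hbb i.
    by have := h N; rewrite -(big_mkord xpredT (fun n => V (i, n))) /index_iota subn0.
  have um : uniq [seq pickle i | i <- us].
    by rewrite map_inj_uniq ?undup_uniq//; exact: (pcan_inj pickleK).
  have -> : \sum_(i <- us) e / 2 ^+ (pickle i).+1 =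
      \sum_(m <- [seq pickle i | i <- us]) e / 2 ^+ m.+1 by rewrite big_map.
  pose N' := \max_(m <- [seq pickle i | i <- us]) m.+1.
  apply: (@le_trans _ _ (\sum_(m <- iota 0 N') e / 2 ^+ m.+1)).
    apply: sum_subset_le => //; [by move=> m; rewrite divr_ge0// ltW|exact: iota_uniq|].
    move=> m ms; rewrite mem_iota/= add0n /N'.
    exact: (@leq_bigmax_seq _ _ xpredT (fun m => m.+1) m).
  have -> : \sum_(m <- iota 0 N') e / 2 ^+ m.+1 = e - e / 2 ^+ N'.
    have -> : iota 0 N' = index_iota 0 N' by rewrite /index_iota subn0.
    rewrite big_mkord; elim: N' => [|n IH]; first by rewrite big_ord0 expr0 divr1 subrr.
    by rewrite big_ord_recr/= IH exprS; field; rewrite gt_eqF.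
  by rewrite gerBl; apply: divr_ge0; exact: ltW.
Qed.

End NullSets.

Section ColumnCount.
Variable R : realType.

Lemma telescope_shift (psi : nat -> R) n J :
  \sum_(k < n) (psi (k + J)%N - psi k) = \sum_(l < J) (psi (n + l)%N - psi l).
Proof.
elim: J => [|J IH]; first by rewrite big_ord0 big1// => k _; rewrite addn0 subrr.
rewrite big_ord_recr/= -IH.
have -> : psi (n + J)%N - psi J = \sum_(k < n) (psi (k + J.+1)%N - psi (k + J)%N).
  elim: n {IH} => [|n IH]; first by rewrite big_ord0 add0n subrr.
  by rewrite big_ord_recr/= -IH addSnnS; ring.
by rewrite -big_split/=; apply: eq_bigr => k _; ring.
Qed.

(* Second differences of step J telescope along the column, so only boundedly many of them
   can be very negative. *)
Lemma bad_count_le (phi : nat -> R) (n J : nat) (D Gam beta : R) (bad : pred 'I_n) :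
  0 <= Gam ->
  (forall k, `|phi (k + J)%N - phi k| <= D) ->
  (forall k : 'I_n, phi (k + J + J)%N + phi k - 2 * phi (k + J)%N <= Gam) ->
  (forall k : 'I_n, bad k -> phi (k + J + J)%N + phi k - 2 * phi (k + J)%N <= - beta) ->
  (\sum_(k < n | bad k) 1) * beta <= 2 * J%:R * D + n%:R * Gam.
Proof.
move=> G0 HD HG Hb; pose psi k := phi (k + J)%N - phi k.
have E : \sum_(k < n) (phi (k + J + J)%N + phi k - 2 * phi (k + J)%N) =
    \sum_(l < J) (psi (n + l)%N - psi l).
  by rewrite -telescope_shift; apply: eq_bigr => k _; rewrite /psi; ring.
have low : - (2 * J%:R * D) <= \sum_(l < J) (psi (n + l)%N - psi l).
  rewrite lerNl -sumrN; apply: (@le_trans _ _ (\sum_(l < J) 2 * D)).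
    apply: ler_sum => l _; have := HD l; have := HD (n + l)%N; rewrite -/(psi l) -/(psi _).
    by rewrite !ler_norml => /andP[a1 a2] /andP[a3 a4]; lra.
  by rewrite sumr_const card_ord -mulr_natl le_eqVlt; apply/orP; left; apply/eqP; ring.
have up : \sum_(k < n) (phi (k + J + J)%N + phi k - 2 * phi (k + J)%N) <=
    n%:R * Gam - (\sum_(k < n | bad k) 1) * beta.
  have -> : n%:R * Gam - (\sum_(k < n | bad k) 1) * beta =
      \sum_(k < n) (Gam - if bad k then beta else 0).
    rewrite sumrB; congr (_ - _); first by rewrite sumr_const card_ord mulr_natl.
    by rewrite mulr_suml [LHS]big_mkcond; apply: eq_bigr => k _; case: ifP; rewrite ?mul1r.
  apply: ler_sum => k _; case: ifP => bk; last by rewrite subr0.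
  by apply: le_trans (Hb k bk) _; lra.
by rewrite -E in low; have := le_trans low up; lra.
Qed.

Lemma unit_cell (n : nat) (y : R) : 0 <= y <= n.+1%:R ->
  exists k : 'I_n.+1, k%:R <= y <= k%:R + 1.
Proof.
elim: n => [|n IH] /andP[y0 yn]; first by exists ord0; rewrite y0 add0r.
have [yle|ygt] := leP y n.+1%:R.
  by have [|k hk] := IH; [rewrite y0|exists (widen_ord (leqnSn _) k)].
by exists ord_max => /=; rewrite (ltW ygt) natr1.
Qed.

End ColumnCount.

(** * Slopes and differentiability of semiconcave functions *)

Section SlopeComparison.
Variable R : realType.

Lemma slope_le_nat (phi : nat -> R) (b : R) n :
  (forall l, phi l.+2 - 2 * phi l.+1 + phi l <= b) -> 0 <= b ->
  phi n - phi 0%N <= n%:R * (phi 1%N - phi 0%N) + n%:R ^+ 2 * b.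
Proof.
move=> H b0.
have inc l : phi l.+1 - phi l <= phi 1%N - phi 0%N + l%:R * b.
  elim: l => [|l IH]; first by rewrite mul0r addr0.
  by have := H l; rewrite -[l.+1%:R]natr1; lra.
elim: n => [|n IH]; first by rewrite subrr mul0r expr0n/= mul0r addr0.
have nb : 0 <= n%:R * b by rewrite mulr_ge0.
by have := inc n; rewrite -[n.+1%:R]natr1; lra.
Qed.

(* One-sided slopes are almost monotone: s' need not be a multiple of s, which costs the
   term L * s / s'. *)
Lemma slope_le (psi : R -> R) (L b s s' : R) :
  0 < s -> s <= s' -> 0 <= L -> 0 <= b ->
  (forall r r', `|psi r - psi r'| <= L * `|r - r'|) ->
  (forall l : nat, psi (l.+2%:R * s) - 2 * psi (l.+1%:R * s) + psi (l%:R * s) <= b) ->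
  (psi s' - psi 0) / s' <= (psi s - psi 0) / s + 2 * L * s / s' + s' * b / s ^+ 2.
Proof.
move=> s0 ss' L0 b0 lip sd.
have s'0 : 0 < s' by apply: lt_le_trans ss'.
pose n := Num.truncn (s' / s).
have /andP[n1 n2] : n%:R <= s' / s < n.+1%:R by apply: truncn_itv; rewrite divr_ge0 ?ltW.
have n1' := n1; rewrite ler_pdivlMr// in n1; rewrite ltr_pdivrMr// -natr1 mulrDl mul1r in n2.
have := @slope_le_nat (fun l => psi (l%:R * s)) b n sd b0; rewrite mul0r mul1r => H.
have L1 := lip s' (n%:R * s); rewrite (@ger0_norm _ (s' - _)) ?subr_ge0// in L1.
have L2 := lip s 0; rewrite subr0 (gtr0_norm s0) in L2.
move: L1 L2; rewrite !ler_norml => /andP[_ L1] /andP[L2 L3].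
set D := psi s - psi 0 in L2 L3 H *.
have r0 : 0 <= s' - n%:R * s by lra.
have rs : s' - n%:R * s <= s by lra.
have E1 : n%:R * D <= s' / s * D + L * s.
  have -> : n%:R * D = s' / s * D - (s' - n%:R * s) * (D / s) by field; rewrite gt_eqF.
  have Ds : - L <= D / s by rewrite ler_pdivlMr// mulNr.
  have : - ((s' - n%:R * s) * (D / s)) <= (s' - n%:R * s) * L by nra.
  have : (s' - n%:R * s) * L <= s * L by rewrite ler_wpM2r.
  lra.
have E2 : n%:R ^+ 2 * b <= (s' / s) ^+ 2 * b.
  by apply: ler_wpM2r => //; apply: lerXn2r; rewrite ?nnegrE// divr_ge0 ?(ltW s0) ?(ltW s'0).
rewrite ler_pdivrMr//.
have -> : (D / s + 2 * L * s / s' + s' * b / s ^+ 2) * s' =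
   s' / s * D + 2 * (L * s) + (s' / s) ^+ 2 * b by field; rewrite !gt_eqF.
have LL : L * (s' - n%:R * s) <= L * s by rewrite ler_wpM2l.
lra.
Qed.

End SlopeComparison.

Lemma differentiable_near (R : realType) (V W : normedModType R) (f : V -> W)
    (df : {linear V -> W}) (x : V) :
  continuous df ->
  (forall e : R, 0 < e -> \forall h \near (0 : V), `|f (h + x) - f x - df h| <= e * `|h|) ->
  differentiable f x.
Proof.
move=> cdf H.
have ex : f \o shift x = cst (f x) + df +o_ 0 id.
  apply/eqaddoP => e e0; apply: filterS (H e e0) => h.
  by rewrite !fctE /= opprD addrA.
by apply/diff_locallyP; rewrite (diff_unique cdf ex).
Qed.

Section Differentiability.
Variables (R : realType) (d : nat).
Implicit Types (x y z : 'rV[R]_d).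

Definition linear_of_row (l : 'rV[R]_d) (y : 'rV[R]_d) : R := dotv l y.

Lemma linear_of_row_linear l : linear (linear_of_row l).
Proof. by move=> a x y; rewrite /linear_of_row dotvDr dotvZr. Qed.

HB.instance Definition _ l :=
  GRing.isLinear.Build R 'rV[R]_d R _ (linear_of_row l) (linear_of_row_linear l).

Lemma differentiable_of_expansion (g : 'rV[R]_d -> R) x (l : 'rV[R]_d) :
  (forall e : R, 0 < e -> exists2 r : R, 0 < r & forall y, enorm y < r ->
    `|g (x + y) - g x - dotv l y| <= e * enorm y) ->
  differentiable g x.
Proof.
move=> H.
have cl : continuous (linear_of_row l).
  move=> y; rewrite /linear_of_row /dotv.
  apply: (@cvg_sum_seq R 'I_d _ (nbhs y) (nbhs_filter y) (index_enum _)
    (fun i z => l 0 i * z 0 i) (fun i => l 0 i * y 0 i)) => i.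
  by apply: (@continuousM R _ (cst (l 0 i)) (fun z => z 0 i) y);
    [exact: cst_continuous|exact: continuous_coord].
apply: (@differentiable_near R 'rV[R]_d R g (linear_of_row l) x cl) => e e0.
have d1 : 0 < d%:R + 1 :> R by rewrite ltr_wpDl.
have [r r0 Hr] := H (e / (d%:R + 1)) (divr_gt0 e0 d1).
apply: (@filterS _ (nbhs (0 : 'rV[R]_d)) (nbhs_filter _) _ _ _ (near_enorm 0 r0)) => y.
rewrite subr0 => yr.
rewrite [y + x]addrC /linear_of_row/=.
apply: le_trans (Hr y yr) _.
have := enorm_le_norm y => yn.
have yn' : enorm y <= (d%:R + 1) * `|y|.
  by apply: le_trans yn _; apply: ler_wpM2r; rewrite ?lerDl.
apply: (@le_trans _ _ (e / (d%:R + 1) * ((d%:R + 1) * `|y|))).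
  by apply: ler_wpM2l => //; rewrite divr_ge0 ?ltW.
by rewrite mulrA divfK ?gt_eqF.
Qed.

End Differentiability.

Section DerivativeOnALine.
Variable R : realType.

(** By [slope_le], the corrected slope [D s - C * s] almost grows as [s] decreases: the error
    [2 * L * s / s'] vanishes when [s] tends to 0 with [s'] fixed. Its limit is therefore its
    supremum. *)
Lemma right_slope_limit (psi : R -> R) (L C : R) : 0 <= L -> 0 <= C ->
  (forall r r', `|psi r - psi r'| <= L * `|r - r'|) ->
  (forall r s, psi (r + s) + psi (r - s) - 2 * psi r <= C * s ^+ 2) ->
  exists l : R, forall e : R, 0 < e -> exists2 r : R, 0 < r &
    forall s, 0 < s < r -> `|(psi s - psi 0) / s - l| <= e.
Proof.
move=> L0 C0 lip sc.
pose D s := (psi s - psi 0) / s.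
have DL s : 0 < s -> D s <= L.
  move=> s0; rewrite /D ler_pdivrMr//; apply: le_trans (ler_norm _) _.
  by have := lip s 0; rewrite subr0 (gtr0_norm s0).
have Dmono s s' : 0 < s -> s <= s' -> D s' - C * s' <= D s + 2 * L * s / s'.
  move=> s0 ss'; have b0 : 0 <= C * s ^+ 2 by rewrite mulr_ge0 ?sqr_ge0.
  have := @slope_le R psi L (C * s ^+ 2) s s' s0 ss' L0 b0 lip.
  have -> : s' * (C * s ^+ 2) / s ^+ 2 = C * s' by field; rewrite gt_eqF.
  rewrite -/(D s) -/(D s') => H.
  have {}H := H (fun l => _); rewrite lerBlDr; apply: H => l.
  have := sc (l.+1%:R * s) s.
  have -> : l.+1%:R * s + s = l.+2%:R * s by rewrite -[l.+2%:R]natr1; ring.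
  have -> : l.+1%:R * s - s = l%:R * s by rewrite -natr1; ring.
  lra.
pose Y := [set y | exists s, 0 < s /\ y = D s - C * s].
have Ys : has_sup Y.
  split; first by exists (D 1 - C * 1), 1.
  exists L => y [s [s0 ->]]; have := DL s s0; have : 0 <= C * s by rewrite mulr_ge0// ltW.
  lra.
exists (sup Y) => e e0.
have e2 : 0 < e / 2 by rewrite divr_gt0.
have [y [s' [s'0 yE]] Hy] := sup_adherent e2 Ys.
have C1 : 0 < C + 1 by rewrite ltr_wpDl.
have L1 : 0 < 4 * L + 1 by rewrite ltr_wpDl// mulr_ge0.
exists (Num.min s' (Num.min (e / (C + 1)) (e * s' / (4 * L + 1)))).
  by rewrite !lt_min s'0 !divr_gt0// mulr_gt0.
move=> s /andP[s0]; rewrite !lt_min => /and3P[ss' sC sL].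
have up : D s - C * s <= sup Y by apply: sup_upper_bound => //; exists s.
rewrite ltr_pdivlMr// in sC; rewrite ltr_pdivlMr// in sL.
have low := Dmono s s' s0 (ltW ss').
have q : 2 * L * s / s' <= e / 2.
  rewrite ler_pdivrMr//; lra.
rewrite -/(D s) ler_norml; apply/andP; split; first by rewrite yE in Hy; lra.
have : C * s <= e by lra.
lra.
Qed.

(** Since both one-sided slopes converge, so does the second difference divided by [s];
    semiconcavity makes its limit nonpositive, and the last hypothesis, at arbitrarily small scales
    only, makes it nonnegative. The one-sided slopes are thus opposite. *)
Lemma line_derivative (psi : R -> R) (L C : R) : 0 <= L -> 0 <= C ->
  (forall r r', `|psi r - psi r'| <= L * `|r - r'|) ->
  (forall r s, psi (r + s) + psi (r - s) - 2 * psi r <= C * s ^+ 2) ->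
  (forall e s0 : R, 0 < e -> 0 < s0 ->
     exists2 s : R, 0 < s < s0 & - (e * s) < psi s + psi (- s) - 2 * psi 0) ->
  exists l : R, forall e : R, 0 < e -> exists2 r : R, 0 < r &
    forall t, `|t| < r -> `|psi t - psi 0 - t * l| <= e * `|t|.
Proof.
move=> L0 C0 lip sc nk.
have [l1 H1] := right_slope_limit L0 C0 lip sc.
have lip' r r' : `|psi (- r) - psi (- r')| <= L * `|r - r'|.
  by rewrite -[r - r']opprK normrN opprD; exact: lip.
have sc' r s : psi (- (r + s)) + psi (- (r - s)) - 2 * psi (- r) <= C * s ^+ 2.
  have -> : - (r + s) = - r - s by ring.
  have -> : - (r - s) = - r + s by ring.
  by have := sc (- r) s; lra.
have [l2 H2] := right_slope_limit (psi := fun s => psi (- s)) L0 C0 lip' sc'.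
rewrite oppr0 in H2.
have l12 : l1 + l2 = 0.
  apply/eqP; rewrite -normr_le0; apply/ler_addgt0Pl => e e0; rewrite addr0.
  have e4 : 0 < e / 4 by rewrite divr_gt0.
  have [r1 r10 K1] := H1 _ e4; have [r2 r20 K2] := H2 _ e4.
  have C1 : 0 < C + 1 by rewrite ltr_wpDl.
  have m0 : 0 < Num.min (Num.min r1 r2) (e / 4 / (C + 1)).
    by rewrite !lt_min r10 r20 !divr_gt0.
  have [s /andP[s0]] := nk _ _ e4 m0; rewrite !lt_min => /andP[/andP[sr1 sr2] sC] Hs.
  have := K1 s; rewrite s0 sr1 => /(_ erefl); rewrite ler_norml => /andP[a1 a2].
  have := K2 s; rewrite s0 sr2 => /(_ erefl); rewrite ler_norml => /andP[b1 b2].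
  rewrite ltr_pdivlMr// in sC.
  have sum : (psi s - psi 0) / s + (psi (- s) - psi 0) / s = (psi s + psi (- s) - 2 * psi 0) / s.
    by field; rewrite gt_eqF.
  have hi : (psi s + psi (- s) - 2 * psi 0) / s <= e / 4.
    rewrite ler_pdivrMr//; have := sc 0 s; rewrite add0r sub0r; nra.
  have lo : - (e / 4) <= (psi s + psi (- s) - 2 * psi 0) / s.
    by rewrite ler_pdivlMr// mulNr ltW.
  rewrite -sum in hi lo; rewrite ler_norml; apply/andP; split; lra.
exists l1 => e e0.
have [r1 r10 K1] := H1 _ e0; have [r2 r20 K2] := H2 _ e0.
exists (Num.min r1 r2); first by rewrite lt_min r10.
move=> t; rewrite lt_min => /andP[t1 t2].
have [->|tn] := eqVneq t 0; first by rewrite subrr mul0r subr0 normr0 mulr0.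
have [t0|t0] := ltP 0 t.
  rewrite (gtr0_norm t0) in t1 *; have := K1 t; rewrite t0 t1 => /(_ erefl).
  have -> : (psi t - psi 0) / t - l1 = (psi t - psi 0 - t * l1) / t by field.
  by rewrite normrM normfV (gtr0_norm t0) ler_pdivrMr.
have {}t0 : t < 0 by rewrite lt_neqAle tn.
have nt : 0 < - t by rewrite oppr_gt0.
rewrite (ltr0_norm t0) in t2 *; have := K2 (- t); rewrite nt t2 opprK => /(_ erefl).
have -> : (psi t - psi 0) / - t - l2 = - (psi t - psi 0 - t * l1) / t.
  have -> : l2 = - l1 by apply/eqP; rewrite -addr_eq0 addrC l12.
  by field.
by rewrite mulNr normrN normrM normfV (ltr0_norm t0) ler_pdivrMr.
Qed.

End DerivativeOnALine.

Section FrechetDifferentiability.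
Variables (R : realType) (d : nat).
Implicit Types (x y z : 'rV[R]_d).

(* Midpoint concavity passes the estimate from the axes to their span. *)
Lemma midpoint_concave_lower (psi : 'rV[R]_d -> R) (e r : R) :
  psi 0 = 0 -> (forall y z, psi y + psi z <= 2 * psi (2^-1 *: (y + z))) ->
  (forall i (t : R), `|t| <= r -> - (e * `|t|) <= psi (t *: evec R i)) ->
  forall (s : seq 'I_d) (y : 'rV[R]_d), (forall i, 2 ^+ size s * `|y 0 i| <= r) ->
    - (e * \sum_(i <- s) `|y 0 i|) <= psi (\sum_(i <- s) y 0 i *: evec R i).
Proof.
move=> psi0 mid axis; elim => [|i s IH] y yr; first by rewrite !big_nil mulr0 oppr0 psi0.
rewrite !big_cons.
have p2 : 1 <= (2 : R) ^+ size s by rewrite exprn_ege1// ler1n.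
have yi : `|2 * y 0 i| <= r.
  apply: le_trans (yr i); rewrite /= exprS normrM (@ger0_norm _ 2)// -mulrA ler_pM2l//.
  by rewrite ler_peMl.
have H1 := axis i _ yi.
have H2 := IH (2 *: y); rewrite /= in H2.
have {}H2 : - (e * \sum_(j <- s) `|(2 *: y) 0 j|) <=
    psi (\sum_(j <- s) (2 *: y) 0 j *: evec R j).
  apply: H2 => j; rewrite mxE normrM (@ger0_norm _ 2)// mulrCA mulrA -exprS.
  exact: yr.
have := mid ((2 * y 0 i) *: evec R i) (\sum_(j <- s) (2 *: y) 0 j *: evec R j).
have -> : 2^-1 *: ((2 * y 0 i) *: evec R i + \sum_(j <- s) (2 *: y) 0 j *: evec R j)
   = y 0 i *: evec R i + \sum_(j <- s) y 0 j *: evec R j.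
  rewrite scalerDr scalerA mulrA mulVf// mul1r; congr (_ + _).
  rewrite scaler_sumr; apply: eq_bigr => j _.
  by rewrite mxE scalerA mulrA mulVf// mul1r.
have E : \sum_(j <- s) `|(2 *: y) 0 j| = 2 * \sum_(j <- s) `|y 0 j|.
  by rewrite mulr_sumr; apply: eq_bigr => j _; rewrite mxE normrM ger0_norm.
rewrite E in H2; rewrite normrM (@ger0_norm _ 2)// in H1.
set S := \sum_(j <- s) `|y 0 j| in H2 *; set P := psi (_ + _).
by lra.
Qed.

(** Subtracting the candidate linear part and [C / 2 * enorm y ^+ 2] leaves a midpoint concave [psi]
    with [psi 0 = 0]. The axes bound it from below, and [psi y + psi (- y) <= 0] turns this into a
    bound from above. *)
Lemma semiconcave_differentiable (g : 'rV[R]_d -> R) (L C : R) x : 0 <= L -> 0 <= C ->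
  (forall y z, `|g y - g z| <= L * enorm (y - z)) ->
  (forall y z, g (y + z) + g (y - z) - 2 * g y <= C * enorm z ^+ 2) ->
  (forall (i : 'I_d) (e s0 : R), 0 < e -> 0 < s0 -> exists2 s : R, 0 < s < s0 &
     - (e * s) < g (x + s *: evec R i) + g (x - s *: evec R i) - 2 * g x) ->
  differentiable g x.
Proof.
move=> L0 C0 lip sc nk.
have line i : exists l : R, forall e : R, 0 < e -> exists2 r : R, 0 < r &
    forall t, `|t| < r -> `|g (x + t *: evec R i) - g x - t * l| <= e * `|t|.
  have := @line_derivative R (fun t => g (x + t *: evec R i)) L C L0 C0.
  rewrite scale0r addr0; apply.
  - move=> r r'; apply: le_trans (lip _ _) _; rewrite opprD addrACA subrr add0r -scalerBl.
    by rewrite enormZ enorm_evec mulr1.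
  - move=> r s; have := sc (x + r *: evec R i) (s *: evec R i).
    by rewrite enormZ enorm_evec mulr1 real_normK ?num_real// -!addrA -scalerDl -scalerBl.
  - move=> e s0 e0 s00; have [s ss0 H] := nk i e s0 e0 s00; exists s => //.
    by rewrite scaleNr.
have [l Hl] := boolp.choice line.
pose lr := \row_i l i.
apply: (@differentiable_of_expansion _ _ _ _ lr) => e e0.
have D0 : 0 < d%:R + 1 :> R by rewrite ltr_wpDl.
pose e' := e / (4 * (d%:R + 1)); have e'0 : 0 < e' by rewrite divr_gt0// mulr_gt0.
have C1 : 0 < C + 1 by rewrite ltr_wpDl.
have Hr0 i : exists r : R, 0 < r /\ forall t, `|t| < r ->
    `|g (x + t *: evec R i) - g x - t * l i| <= e' * `|t|.
  by have [r r0 h] := Hl i e' e'0; exists r.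
have [r Hr] := boolp.choice Hr0.
pose rm := \big[Num.min/1]_i r i.
have rm0 : 0 < rm by apply/bigmin_gtP; split => // i _; case: (Hr i).
pose rho := Num.min (rm / 2) (e' / (C + 1)).
have rho0 : 0 < rho by rewrite lt_min !divr_gt0.
have rho_rm : rho < rm by rewrite gt_min ltr_pdivrMr// mulr_natr mulr2n ltrDl rm0.
have rho_C : (C + 1) * rho <= e' by rewrite mulrC -ler_pdivlMr// ge_min lexx orbT.
pose psi y := g (x + y) - g x - dotv lr y - C / 2 * enorm y ^+ 2.
have psi0 : psi 0 = 0.
  have d0 : dotv lr 0 = 0 by rewrite -(scale0r 0) dotvZr mul0r.
  by rewrite /psi addr0 enorm0 expr0n/= mulr0 d0 !subr0 subrr.
have mid y z : psi y + psi z <= 2 * psi (2^-1 *: (y + z)).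
  have := sc (x + 2^-1 *: (y + z)) (2^-1 *: (y - z)).
  have -> : x + 2^-1 *: (y + z) + 2^-1 *: (y - z) = x + y by apply/rowP => i; rewrite !mxE; field.
  have -> : x + 2^-1 *: (y + z) - 2^-1 *: (y - z) = x + z by apply/rowP => i; rewrite !mxE; field.
  rewrite /psi dotvZr dotvDr !enormZ !exprMn.
  have n2 : `|2^-1 : R| ^+ 2 = 4^-1 by rewrite real_normK ?num_real//; field.
  rewrite n2; have := parallelogram y z.
  move: (g (x + y)) (g (x + z)) (g x) (g _) (dotv lr y) (dotv lr z) => a1 a2 a3 a4 a5 a6.
  by move: (enorm (y + z) ^+ 2) (enorm (y - z) ^+ 2) (enorm y ^+ 2) (enorm z ^+ 2) => b1 b2 b3 b4 H1 H2; nra.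
have axis i (t : R) : `|t| <= rho -> - (2 * e' * `|t|) <= psi (t *: evec R i).
  move=> tr; have [_ H] := Hr i.
  have tri : `|t| < r i.
    by apply: le_lt_trans tr _; apply: lt_le_trans rho_rm _; exact: bigmin_le.
  have := H t tri; rewrite ler_norml => /andP[H1 _].
  rewrite /psi dotvZr dotv_evec mxE enormZ enorm_evec mulr1.
  have H3 : C / 2 * `|t| ^+ 2 <= e' * `|t|.
    rewrite expr2 mulrA; apply: ler_wpM2r => //.
    apply: le_trans rho_C; apply: ler_pM => //; [by rewrite divr_ge0|].
    by rewrite ler_pdivrMr// ; lra.
  by lra.
have pd : 0 < (2 : R) ^+ d by rewrite exprn_gt0.
(* [midpoint_concave_lower] doubles the point once per axis, hence [2 ^+ d]; the second bound keeps
   the quadratic correction below [e / 2 * enorm y]. *)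
exists (Num.min (rho / 2 ^+ d) (e / (C + 1))); first by rewrite lt_min !divr_gt0.
have key y : enorm y < rho / 2 ^+ d -> - (e / 2 * enorm y) <= psi y.
  move=> yr.
  have := @midpoint_concave_lower psi (2 * e') rho psi0 mid axis (enum 'I_d) y.
  rewrite size_enum_ord !big_enum/= -row_sum_evec => H.
  apply: le_trans (H _); last first.
    move=> i; rewrite mulrC -ler_pdivlMr//; apply: le_trans (enorm_coord y i) (ltW yr).
  rewrite lerN2; apply: (@le_trans _ _ (2 * e' * ((d%:R + 1) * enorm y))).
    apply: ler_wpM2l; first by rewrite mulr_ge0// ltW.
    apply: (@le_trans _ _ (\sum_(i < d) enorm y)); first by apply: ler_sum => i _; exact: enorm_coord.
    by rewrite sumr_const card_ord -[enorm y *+ d]mulr_natl; apply: ler_wpM2r; rewrite ?enorm_ge0// lerDl.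
  by rewrite /e' le_eqVlt; apply/orP; left; apply/eqP; field; rewrite gt_eqF.
move=> y; rewrite lt_min => /andP[y1 y2].
have k1 := key y y1; have := key (- y); rewrite enormN => /(_ y1) k2.
have m0 := mid y (- y); rewrite subrr scaler0 psi0 mulr0 in m0.
have y0 := enorm_ge0 y.
have q0 : 0 <= C / 2 * enorm y ^+ 2 by rewrite mulr_ge0 ?sqr_ge0// divr_ge0.
have q1 : C / 2 * enorm y ^+ 2 <= e / 2 * enorm y.
  rewrite expr2 mulrA; apply: ler_wpM2r => //.
  by rewrite ltr_pdivlMr// in y2; lra.
have -> : g (x + y) - g x - dotv lr y = psi y + C / 2 * enorm y ^+ 2 by rewrite /psi; ring.
have -> : e * enorm y = 2 * (e / 2 * enorm y) by field.
move: k1 k2 m0 q0 q1; move: (psi y) (psi (- y)) (C / 2 * _) (e / 2 * enorm y) => a1 a2 a3 a4.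
by move=> *; rewrite ler_norml; apply/andP; split; lra.
Qed.

End FrechetDifferentiability.

(** * Kinks along an axis form a null set *)

Section KinksAreNull.
Variables (R : realType) (d : nat).
Implicit Types (x y : 'rV[R]_d.+1).

(** A quantified failure of the last hypothesis of [semiconcave_differentiable]; countably many
    choices of [eta] and [s0] exhaust all failures. *)
Definition kinks (g : 'rV[R]_d.+1 -> R) (i : 'I_d.+1) (eta s0 : R) : set 'rV[R]_d.+1 :=
  [set x | forall s, 0 < s < s0 ->
     g (x + s *: evec R i) + g (x - s *: evec R i) - 2 * g x <= - (eta * s)].

Section Grid.
Variables (g : 'rV[R]_d.+1 -> R) (L C : R) (i : 'I_d.+1) (eta s0 c0 ell : R).
Hypotheses (L0 : 0 <= L) (C0 : 0 <= C) (eta0 : 0 < eta) (s00 : 0 < s0) (ell0 : 0 < ell).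
Hypothesis lip : forall x y, `|g x - g y| <= L * enorm (x - y).
Hypothesis sc : forall x y, g (x + y) + g (x - y) - 2 * g x <= C * enorm y ^+ 2.

Section Mesh.
Variables (n J : nat).
Let del := ell / n.+1%:R.
Hypotheses (J0 : (0 < J)%N) (JL : 8 * L * d.+1%:R <= eta * J%:R) (Js : J%:R * del < s0).

(** A column, given by the coordinates off axis [i], and a height along axis [i]. *)
Definition cell_index := ({ffun 'I_d -> 'I_n.+1} * 'I_n.+1)%type.

Definition cell_coord (p : cell_index) (j : 'I_d.+1) : R :=
  if unlift i j is Some j' then (p.1 j')%:R else (p.2)%:R.

Definition cell_lo (p : cell_index) : 'rV[R]_d.+1 := \row_j (c0 + cell_coord p j * del).
Definition cell_hi (p : cell_index) : 'rV[R]_d.+1 := \row_j (c0 + (cell_coord p j + 1) * del).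

Definition bad_cell (p : cell_index) : bool :=
  `[< exists2 x, kinks g i eta s0 x & forall j, cell_lo p 0 j <= x 0 j <= cell_hi p 0 j >].

Let del0 : 0 < del. Proof. by rewrite divr_gt0. Qed.

Lemma cell_vol p : box_vol (cell_lo p) (cell_hi p) = del ^+ d.+1.
Proof.
rewrite /box_vol (eq_bigr (fun=> del)); first by rewrite prodr_const card_ord.
by move=> j _; rewrite !mxE; ring.
Qed.

Lemma cell_lo_shift (k : {ffun 'I_d -> 'I_n.+1}) (l : 'I_n.+1) :
  cell_lo (k, l) = cell_lo (k, ord0) + (l%:R * del) *: evec R i.
Proof.
apply/rowP => j; rewrite !mxE eqxx/= /cell_coord.
case: unliftP => [j' ->|->]/=.
  by rewrite eq_sym (negPf (neq_lift _ _)) mulr0 addr0.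
by rewrite eqxx mul0r addr0 mulr1.
Qed.

(** By [JL] the step [s = J%:R * del] is so much longer than a cell that moving a kink to the corner
    of its cell spoils at most half of [eta * s]; [bad_count_le] then applies with
    [beta = eta * s / 2]. The resulting bound does not depend on [n]. *)
Lemma bad_column_count (k : {ffun 'I_d -> 'I_n.+1}) :
  \sum_(l < n.+1 | bad_cell (k, l)) 1 <= (4 * L * J%:R + 2 * C * J%:R * ell) / eta.
Proof.
have JR : 0 < J%:R :> R by rewrite ltr0n.
pose s := J%:R * del; have sp : 0 < s by rewrite mulr_gt0.
(* The sequence starts [J] cells below the column, so that the second difference indexed by [l] is
   centred at the corner of cell [l]. *)
pose phi (m : nat) := g (cell_lo (k, ord0) + ((m%:R - J%:R) * del) *: evec R i).
have E0 (l : nat) : phi (l + J)%N = g (cell_lo (k, ord0) + (l%:R * del) *: evec R i).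
  by rewrite /phi natrD addrK.
have shift (a b : R) : cell_lo (k, ord0) + a *: evec R i + b *: evec R i =
    cell_lo (k, ord0) + (a + b) *: evec R i by rewrite -addrA -scalerDl.
have E1 (l : nat) : phi (l + J + J)%N = g (cell_lo (k, ord0) + (l%:R * del) *: evec R i + s *: evec R i).
  by rewrite /phi shift !natrD addrK; congr (g (_ + _ *: _)); rewrite /s; ring.
have E2 (l : nat) : phi l = g (cell_lo (k, ord0) + (l%:R * del) *: evec R i - s *: evec R i).
  by rewrite /phi -scaleNr shift; congr (g (_ + _ *: _)); rewrite /s; ring.
have ee (a : R) : enorm (a *: evec R i) = `|a| by rewrite enormZ enorm_evec mulr1.
have beta0 : 0 < eta * s / 2 by rewrite divr_gt0 ?mulr_gt0.
have Hcount := @bad_count_le R phi n.+1 J (L * s) (C * s ^+ 2) (eta * s / 2)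
  (fun l => bad_cell (k, l)).
have {}Hcount : (\sum_(l < n.+1 | bad_cell (k, l)) 1) * (eta * s / 2) <=
    2 * J%:R * (L * s) + n.+1%:R * (C * s ^+ 2).
  apply: Hcount.
  - by rewrite mulr_ge0 ?sqr_ge0.
  - move=> l; rewrite E0 E2; apply: le_trans (lip _ _) _.
    by rewrite opprB [X in enorm X]addrC subrK ee gtr0_norm.
  - move=> l; rewrite E1 E2 E0; apply: le_trans (sc _ _) _.
    by rewrite ee real_normK ?num_real.
  - move=> l /asboolP[x kx xin]; rewrite E1 E2 E0 -cell_lo_shift.
    set y := cell_lo (k, l).
    have xy : enorm (x - y) <= d.+1%:R * del.
      apply: enorm_le_bound => j; have := xin j; rewrite !mxE => /andP[h1 h2].
      by rewrite ger0_norm; lra.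
    have lip1 (v : 'rV[R]_d.+1) : `|g (y + v) - g (x + v)| <= L * (d.+1%:R * del).
      apply: le_trans (lip _ _) _; apply: ler_wpM2l => //.
      by rewrite opprD addrACA subrr addr0 enormB.
    have := lip1 (s *: evec R i); have := lip1 (- (s *: evec R i)).
    have := lip1 0; rewrite !addr0 !ler_norml => /andP[a1 _] /andP[_ a2] /andP[_ a3].
    have := kx s; rewrite sp Js => /(_ erefl) H.
    have JL' : 8 * L * d.+1%:R * del <= eta * s.
      by rewrite /s mulrA; apply: ler_wpM2r => //; exact: ltW.
    move: JL' H a1 a2 a3; rewrite (_ : 8 * L * d.+1%:R * del = 8 * (L * (d.+1%:R * del))); last by ring.
    by lra.
rewrite ler_pdivlMr//.
have s2 : 0 < s / 2 by rewrite divr_gt0.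
rewrite -(ler_pM2r s2); apply: le_trans (_ : _ <= 2 * J%:R * (L * s) + n.+1%:R * (C * s ^+ 2)) _.
  by apply: le_trans Hcount; rewrite le_eqVlt; apply/orP; left; apply/eqP; ring.
rewrite le_eqVlt; apply/orP; left; apply/eqP.
by rewrite /s /del; field; rewrite gt_eqF.
Qed.

(** There are [n.+1 ^ d] columns, each with boundedly many bad cells of volume [del ^+ d.+1], which
    leaves a factor [1 / n.+1]. *)
Lemma bad_cells_volume : \sum_(p | bad_cell p) box_vol (cell_lo p) (cell_hi p) <=
  (4 * L * J%:R + 2 * C * J%:R * ell) / eta * ell ^+ d.+1 / n.+1%:R.
Proof.
rewrite (eq_bigr (fun=> del ^+ d.+1)); last by move=> p _; exact: cell_vol.
rewrite big_mkcond/=.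
rewrite (eq_bigr (fun p : cell_index => if bad_cell (p.1, p.2) then del ^+ d.+1 else 0)); last by case.
rewrite -(pair_bigA _ (fun k l => if bad_cell (k, l) then del ^+ d.+1 else 0))/=.
set Cb := (_ / eta).
apply: (@le_trans _ _ (\sum_(k : {ffun 'I_d -> 'I_n.+1}) Cb * del ^+ d.+1)).
  apply: ler_sum => k _; rewrite -big_mkcond/=.
  rewrite (eq_bigr (fun=> 1 * del ^+ d.+1)); last by move=> *; rewrite mul1r.
  rewrite -mulr_suml; apply: ler_wpM2r; first by rewrite exprn_ge0 ?ltW.
  exact: bad_column_count.
rewrite sumr_const card_ffun !card_ord -[X in X <= _]mulr_natl natrX.
rewrite le_eqVlt; apply/orP; left; apply/eqP.
by rewrite /del expr_div_n !exprS; field; rewrite ?expf_neq0 ?gt_eqF.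
Qed.

Lemma cells_cover x : (forall j, c0 <= x 0 j <= c0 + ell) ->
  exists p : cell_index, forall j, cell_lo p 0 j <= x 0 j <= cell_hi p 0 j.
Proof.
move=> xin.
have H j : exists k : 'I_n.+1, k%:R <= (x 0 j - c0) / del <= k%:R + 1.
  apply: unit_cell; have /andP[h1 h2] := xin j; apply/andP; split.
    by apply: divr_ge0; [rewrite subr_ge0|exact: ltW].
  rewrite ler_pdivrMr//.
  have -> : n.+1%:R * del = ell by rewrite /del; field.
  by lra.
have [k Hk] := boolp.choice H.
exists ([ffun j' => k (lift i j')], k i) => j; rewrite !mxE.
have -> : cell_coord ([ffun j' => k (lift i j')], k i) j = (k j)%:R.
  by rewrite /cell_coord; case: unliftP => [j' ->|->]/=; rewrite ?ffunE.
have /andP[h1 h2] := Hk j; rewrite ler_pdivlMr// in h1; rewrite ler_pdivrMr// in h2.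
by apply/andP; split; lra.
Qed.

End Mesh.

Lemma kinks_null : lebesgue_null
  (fun x => kinks g i eta s0 x /\ forall j, c0 <= x 0 j <= c0 + ell).
Proof.
have L0' := L0; have C0' := C0; have ell0' := ltW ell0.
apply: lebesgue_null_finite_cover => e e0.
pose J := (Num.bound `|8 * L * d.+1%:R / eta|).+1.
have JL : 8 * L * d.+1%:R <= eta * J%:R.
  rewrite -ler_pdivrMl// mulrC.
  apply: le_trans (ler_norm _) _; apply: le_trans (ltW (archi_boundP (normr_ge0 _))) _.
  by rewrite ler_nat leqnSn.
pose V := (4 * L * J%:R + 2 * C * J%:R * ell) / eta * ell ^+ d.+1.
have V0 : 0 <= V.
  by rewrite /V mulr_ge0 ?exprn_ge0// divr_ge0 ?(ltW eta0)// addr_ge0// !mulr_ge0.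
have JR : 0 <= J%:R * ell / s0 by rewrite divr_ge0 ?mulr_ge0// ltW.
have Ve : 0 <= V / e by rewrite divr_ge0// ltW.
(* [J] depends only on [L], [eta] and the dimension, so the mesh can be refined afterwards: the
   first summand gives [J%:R * del < s0], the second a volume at most [e]. *)
pose n := Num.bound (J%:R * ell / s0 + V / e).
have nb : J%:R * ell / s0 + V / e < n.+1%:R.
  by apply: lt_le_trans (archi_boundP (addr_ge0 JR Ve)) _; rewrite ler_nat leqnSn.
have Js : J%:R * (ell / n.+1%:R) < s0.
  rewrite mulrA ltr_pdivrMr// [s0 * _]mulrC -ltr_pdivrMr//; apply: le_lt_trans nb; rewrite lerDl//.
exists [seq (cell_lo p, cell_hi p) | p <- [seq p <- index_enum (cell_index n) | bad_cell p]].
split.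
- move=> _ /mapP[p _ ->] j /=; rewrite !mxE lerD2l; apply: ler_wpM2r; last by rewrite lerDl.
  by rewrite divr_ge0.
- move=> x [kx xin]; have [p Hp] := cells_cover n xin.
  exists (cell_lo p, cell_hi p) => //; apply/mapP; exists p => //.
  by rewrite mem_filter mem_index_enum andbT; apply/asboolP; exists x.
- rewrite big_map big_filter/=; apply: le_trans (bad_cells_volume _ JL Js) _ => //.
  rewrite -/V ler_pdivrMr// [e * _]mulrC -ler_pdivrMr//; apply: ltW; apply: le_lt_trans nb.
  by rewrite lerDr.
Qed.

End Grid.
End KinksAreNull.

(** * Slopes across scales and the limit of discrete gradients *)

Section SlopeAcrossScales.
Variables (R : realType) (d : nat).
Variables (phi : 'rV[R]_d -> R) (L C b h : R) (u : 'rV[R]_d).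
Hypotheses (L0 : 0 <= L) (C0 : 0 <= C) (b0 : 0 <= b) (h0 : 0 < h) (u1 : enorm u = 1).
Hypothesis lip : forall x y, `|phi x - phi y| <= L * enorm (x - y).
Hypothesis sc : forall x y, h <= enorm y ->
  phi (x + y) + phi (x - y) - 2 * phi x <= C * (enorm y ^+ 2 + Num.sqrt (h * enorm y)).
Hypothesis ax : forall x, phi (x + h *: u) + phi (x - h *: u) - 2 * phi x <= b.

Local Notation slope x s := ((phi (x + s *: u) - phi x) / s).

Let shift x (r s : R) : x + r *: u + s *: u = x + (r + s) *: u.
Proof. by rewrite -addrA -scalerDl. Qed.

Let shiftB x (r s : R) : x + r *: u - s *: u = x + (r - s) *: u.
Proof. by rewrite -addrA -scalerBl. Qed.

Lemma slope_le_step x (s : R) : h <= s ->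
  slope x s <= slope x h + 2 * L * h / s + s * b / h ^+ 2.
Proof.
move=> hs.
have lip' (r r' : R) : `|phi (x + r *: u) - phi (x + r' *: u)| <= L * `|r - r'|.
  apply: le_trans (lip _ _) _.
  by rewrite opprD addrACA subrr add0r -scalerBl enormZ u1 mulr1.
have := @slope_le R (fun r => phi (x + r *: u)) L b h s h0 hs L0 b0 lip'.
rewrite scale0r addr0; apply => l.
have := ax (x + (l.+1%:R * h) *: u); rewrite shift shiftB.
have -> : l.+1%:R * h + h = l.+2%:R * h by rewrite -[l.+2%:R]natr1; ring.
have -> : l.+1%:R * h - h = l%:R * h by rewrite -natr1; ring.
by move=> H; lra.
Qed.

Lemma slope_double x (p : R) : h <= p ->
  slope x (2 * p) <= slope x p + C / 2 * (p + Num.sqrt (h / p)).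
Proof.
move=> hp; have p0 := lt_le_trans h0 hp.
have ep : enorm (p *: u) = p by rewrite enormZ u1 mulr1 gtr0_norm.
have := @sc (x + p *: u) (p *: u); rewrite ep => /(_ hp).
rewrite addrK shift (_ : p + p = 2 * p); last by ring.
have -> : Num.sqrt (h * p) = p * Num.sqrt (h / p).
  have -> : h * p = p ^+ 2 * (h / p) by field; rewrite gt_eqF.
  by rewrite sqrtrM ?sqr_ge0// sqrtr_sqr gtr0_norm.
move=> H; rewrite -lerBlDl.
rewrite -(ler_pM2r p0) -(@ler_pM2r _ 2)//.
have -> : ((phi (x + (2 * p) *: u) - phi x) / (2 * p) - (phi (x + p *: u) - phi x) / p) * p * 2 =
  phi (x + (2 * p) *: u) - phi x - 2 * (phi (x + p *: u) - phi x) by field; rewrite gt_eqF.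
by rewrite expr2 in H; lra.
Qed.

(** Each doubling divides the error [sqrt (h / p)] by [sqrt 2]; as [1 / sqrt 2 <= 3 / 4], these
    errors sum to at most [4 * sqrt (h / p)]. *)
Lemma slope_dyadic n x (p : R) : h <= p ->
  slope x (2 ^+ n * p) <= slope x p + C / 2 * ((2 ^+ n - 1) * p + 4 * Num.sqrt (h / p)).
Proof.
have C2 : 0 <= C / 2 by rewrite divr_ge0.
elim: n p => [|n IH] p hp.
  rewrite expr0 subrr mul0r add0r mul1r lerDl mulr_ge0// mulr_ge0// sqrtr_ge0.
have p0 := lt_le_trans h0 hp.
have hp2 : h <= 2 * p by apply: (le_trans hp); lra.
have := IH _ hp2; have := slope_double x hp.
rewrite mulrA -exprSr => H1 H2; apply: (le_trans H2).
apply: (le_trans (lerD H1 (lexx _))); rewrite -addrA -mulrDr lerD2l; apply: ler_wpM2l => //.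
have sq : Num.sqrt (h / (2 * p)) <= 3 / 4 * Num.sqrt (h / p).
  have -> : 3 / 4 * Num.sqrt (h / p) = Num.sqrt ((3 / 4) ^+ 2 * (h / p)).
    by rewrite [RHS]sqrtrM ?sqr_ge0// sqrtr_sqr gtr0_norm.
  have hp0 : 0 <= h / p by apply: divr_ge0; exact: ltW.
  rewrite ler_sqrt; last by rewrite mulr_ge0 ?sqr_ge0.
  have -> : h / (2 * p) = 2^-1 * (h / p) by field; rewrite gt_eqF.
  by apply: ler_wpM2r; last lra.
by rewrite exprS; lra.
Qed.

(** Freedom in the starting scale [p] makes [s] an exact power of two times [p], so [slope_dyadic]
    needs no rounding. *)
Lemma dyadic_scale (a s : R) : 0 < a -> a <= s ->
  exists n p, [/\ a <= p, p <= 2 * a & s = 2 ^+ n * p].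
Proof.
move=> a0 as_.
have ex : exists n, s / 2 ^+ n <= 2 * a.
  exists (Num.bound (s / a)); rewrite ler_pdivrMr ?exprn_gt0//.
  have sa0 : 0 <= s / a by rewrite divr_ge0// ltW// (lt_le_trans a0).
  have := archi_boundP sa0; set n := Num.bound _ => H.
  rewrite ltr_pdivrMr// in H; apply: (le_trans (ltW H)).
  have n2 : n%:R <= 2 ^+ n :> R by rewrite -natrX ler_nat ltnW// ltn_expl.
  have := ler_wpM2r (ltW a0) n2; have : 0 <= 2 ^+ n * a by rewrite mulr_ge0// ?exprn_ge0// ltW.
  lra.
case: (ex_minnP ex) => n Hn Hmin; exists n, (s / 2 ^+ n); split => //; last first.
  by rewrite mulrC divfK// expf_neq0.
case: n Hn Hmin => [|n] Hn Hmin; first by rewrite expr0 divr1.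
rewrite leNgt; apply/negP => lta; have := Hmin n; rewrite ltnn => H.
suff : false by []; apply: H; rewrite ltW//.
move: lta; rewrite exprS invfM mulrCA => lta; lra.
Qed.

(** Chains the comparisons at a scale [p] between [kap ^+ 2 * h] and twice that: from [h] to [p] by
    [slope_le_step], from [p] to [s] by [slope_dyadic], where [sqrt (h / p) <= 1 / kap]. *)
Lemma slope_le_fixed_scale x (kap s : R) : 1 <= kap -> kap ^+ 2 * h <= s ->
  slope x s <= slope x h + 2 * L / kap ^+ 2 + 2 * kap ^+ 2 * (b / h) + C / 2 * (s + 4 / kap).
Proof.
move=> kap1 ks.
have k0 : 0 < kap by apply: lt_le_trans kap1.
have k20 : 0 < kap ^+ 2 by rewrite exprn_gt0.
have k21 : 1 <= kap ^+ 2 by rewrite exprn_ege1.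
have [n [p [pl pu ->]]] := dyadic_scale (mulr_gt0 k20 h0) ks.
have hp : h <= p by apply: le_trans pl; rewrite ler_peMl// ltW.
have p0 := lt_le_trans h0 hp.
have H1 := slope_le_step x hp; have H2 := slope_dyadic n x hp.
have C2 : 0 <= C / 2 by rewrite divr_ge0.
have hpk : h / p <= (kap ^+ 2)^-1 by rewrite ler_pdivrMr// mulrC ler_pdivlMr// mulrC.
have E1 : 2 * L * h / p <= 2 * L / kap ^+ 2.
  by rewrite -[2 * L * h / p]mulrA; apply: ler_wpM2l => //; rewrite mulr_ge0.
have E2 : p * b / h ^+ 2 <= 2 * kap ^+ 2 * (b / h).
  have -> : 2 * kap ^+ 2 * (b / h) = 2 * (kap ^+ 2 * h) * b / h ^+ 2 by field; rewrite gt_eqF.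
  by apply: ler_wpM2r; [rewrite invr_ge0 exprn_ge0// ltW|exact: ler_wpM2r].
have E3 : Num.sqrt (h / p) <= kap^-1.
  rewrite -[kap^-1]gtr0_norm ?invr_gt0// -sqrtr_sqr ler_sqrt ?sqr_ge0//.
  by rewrite exprVn.
have E4 : C / 2 * ((2 ^+ n - 1) * p + 4 * Num.sqrt (h / p)) <= C / 2 * (2 ^+ n * p + 4 / kap).
  by apply: ler_wpM2l => //; lra.
by lra.
Qed.

End SlopeAcrossScales.

Section GradientLimit.
Variables (R : realType) (d : nat).
Variables (phi : R -> 'rV[R]_d -> R) (g : 'rV[R]_d -> R) (L C a : R).
Hypotheses (L0 : 0 <= L) (C0 : 0 <= C) (a0 : 0 <= a).
Hypothesis lip : forall h, 0 < h < 1 -> forall x y, `|phi h x - phi h y| <= L * enorm (x - y).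
Hypothesis sc : forall h, 0 < h < 1 -> forall x y, h <= enorm y ->
  phi h (x + y) + phi h (x - y) - 2 * phi h x <= C * (enorm y ^+ 2 + Num.sqrt (h * enorm y)).
Hypothesis ax : forall h, 0 < h < 1 -> forall x k,
  phi h (x + step h k) + phi h (x - step h k) - 2 * phi h x <= a * Num.sqrt h ^+ 3.
Hypothesis cv : forall y, phi h y @[h --> 0^'+] --> g y.

Lemma near_scale : \forall h \near (0 : R)^'+, 0 < h < 1.
Proof. by near=> h; apply/andP; split. Unshelve. all: by end_near. Qed.

Lemma derivative_slope (x u : 'rV[R]_d) (e : R) : derivable g x u -> 0 < e ->
  exists2 r : R, 0 < r & forall s, 0 < s < r -> 'D_u g x - e <= (g (x + s *: u) - g x) / s.
Proof.
move=> gu e0; have /cvgrPdist_le/(_ _ e0)/nbhs_ballP[r /= r0 H] := gu.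
exists r => // s /andP[s0 sr].
have := H s; rewrite /ball/= sub0r normrN gtr0_norm// => /(_ sr); rewrite gt_eqF// => /(_ isT).
rewrite ler_norml => /andP[_]; rewrite [s *: u + x]addrC [_ *: _]mulrC.
by rewrite /derive; lra.
Qed.

Lemma stepE (h : R) k : step h k = h *: (step 1 k : 'rV[R]_d).
Proof. by rewrite /step mulr1 scalerA mulrC. Qed.

Lemma enorm_step1 (k : 'I_d * bool) : enorm (step (1 : R) k) = 1.
Proof. by rewrite /step enormZ enorm_evec !mulr1 /sgb; case: k.2; rewrite ?normrN normr1. Qed.

Lemma near_values (z : R -> 'rV[R]_d) (x y : 'rV[R]_d) (e : R) : z h @[h --> 0^'+] --> x -> 0 < e ->
  \forall h \near 0^'+, `|phi h (z h + y) - g (x + y)| <= e.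
Proof.
move=> zx e0.
have e2 : 0 < e / 2 by rewrite divr_gt0.
have L1 : 0 < L + 1 by rewrite ltr_wpDl.
have e3 : 0 < e / 2 / (L + 1) by rewrite divr_gt0.
have /cvgrPdist_le/(_ _ e2) H1 := @cv (x + y).
have H2 := zx _ (near_enorm x e3).
near=> h.
have hI : 0 < h < 1 by near: h; exact: near_scale.
have h1 : `|g (x + y) - phi h (x + y)| <= e / 2 by near: h.
have h2 : enorm (z h - x) < e / 2 / (L + 1) by near: h.
have h3 := lip hI (z h + y) (x + y).
rewrite opprD addrACA subrr addr0 in h3.
rewrite ltr_pdivlMr// in h2.
have h4 : L * enorm (z h - x) <= e / 2.
  by have := enorm_ge0 (z h - x); lra.
have := le_trans h3 h4; move: h1; rewrite !ler_norml => /andP[? ?] /andP[? ?].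
by apply/andP; split; lra.
Unshelve. all: by end_near. Qed.

(** Order of choices: [s] costs at most [e / 4] in the slope of [g] and keeps [C * s] small; [kap]
    makes the errors of order [1 / kap] small; last, [h] is small enough for [kap ^+ 2 * a * sqrt h]
    and for the distance from [phi h] to [g] at both ends of the segment. *)
Lemma forward_slope_ge (z : R -> 'rV[R]_d) (x : 'rV[R]_d) k (e : R) : z h @[h --> 0^'+] --> x ->
  derivable g x (step 1 k) -> 0 < e ->
  \forall h \near 0^'+,
    'D_(step 1 k) g x - e <= (phi h (z h + step h k) - phi h (z h)) / h.
Proof.
move=> zx gu e0; set u : 'rV[R]_d := step 1 k.
have e4 : 0 < e / 4 by rewrite divr_gt0.
have [r r0 Hr] := derivative_slope gu e4.
have C1 : 0 < 4 * (C + 1) by rewrite mulr_gt0// ltr_wpDl.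
pose s := Num.min (r / 2) (e / (4 * (C + 1))).
have s0 : 0 < s by rewrite /s lt_min !divr_gt0.
have sr : s < r by apply: (@le_lt_trans _ _ (r / 2)); [rewrite /s ge_min lexx|lra].
have sC : s * (4 * (C + 1)) <= e by rewrite -ler_pdivlMr// /s ge_min lexx orbT.
pose kap := 1 + 8 * (L + C) / e.
have LC0 : 0 <= 8 * (L + C) / e by rewrite divr_ge0 ?mulr_ge0 ?addr_ge0// ltW.
have k1 : 1 <= kap by rewrite /kap lerDl.
have k0 : 0 < kap by apply: lt_le_trans k1.
have k20 : 0 < kap ^+ 2 by rewrite exprn_gt0.
have kLC : 8 * (L + C) <= kap * e.
  have -> : kap * e = e + 8 * (L + C) by rewrite /kap; field; rewrite gt_eqF.
  by rewrite lerDr ltW.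
have den : 0 < 16 * (kap ^+ 2 * a + 1) by rewrite mulr_gt0// ltr_wpDl// mulr_ge0// ltW.
have thr : 0 < (e / (16 * (kap ^+ 2 * a + 1))) ^+ 2 by rewrite exprn_gt0// divr_gt0.
have esp : 0 < e * s / 8 by rewrite divr_gt0 ?mulr_gt0.
near=> h.
have hI : 0 < h < 1 by near: h; exact: near_scale.
have /andP[h0 _] := hI.
have hs : h < s / kap ^+ 2 by near: h; apply: nbhs_right_lt; rewrite divr_gt0.
have ht : h < (e / (16 * (kap ^+ 2 * a + 1))) ^+ 2 by near: h; exact: nbhs_right_lt.
have v1 : `|phi h (z h + s *: u) - g (x + s *: u)| <= e * s / 8 by near: h; exact: near_values.
have v0 : `|phi h (z h + 0) - g (x + 0)| <= e * s / 8 by near: h; exact: near_values.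
have b0 : 0 <= a * Num.sqrt h ^+ 3 by rewrite mulr_ge0// exprn_ge0// sqrtr_ge0.
have ax' y : phi h (y + h *: u) + phi h (y - h *: u) - 2 * phi h y <= a * Num.sqrt h ^+ 3.
  by rewrite -stepE; exact: ax.
rewrite ltr_pdivlMr// mulrC in hs.
have main := slope_le_fixed_scale L0 C0 b0 h0 (enorm_step1 k) (lip hI) (sc hI) ax' (z h) k1 (ltW hs).
rewrite -/u -(stepE h) in main.
have bh : a * Num.sqrt h ^+ 3 / h = a * Num.sqrt h.
  by rewrite -{2}(sqr_sqrtr (ltW h0)); field; rewrite gt_eqF// sqrtr_gt0.
rewrite bh in main.
have sqh : Num.sqrt h <= e / (16 * (kap ^+ 2 * a + 1)).
  rewrite -[X in _ <= X]gtr0_norm ?divr_gt0// -sqrtr_sqr ler_sqrt; first exact: ltW.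
  exact: sqr_ge0.
have E1 : 2 * kap ^+ 2 * (a * Num.sqrt h) <= e / 8.
  rewrite ler_pdivlMr// in sqh; have := sqrtr_ge0 h; lra.
have E2 : 2 * L / kap ^+ 2 <= 2 * L / kap.
  apply: ler_wpM2l; first by rewrite mulr_ge0.
  by rewrite lef_pV2 ?posrE// ler_eXnr.
have E3 : 2 * L / kap + 2 * C / kap <= e / 4.
  by rewrite -mulrDl ler_pdivrMr//; lra.
have E4 : C / 2 * (s + 4 / kap) <= e / 8 + 2 * C / kap.
  have -> : C / 2 * (s + 4 / kap) = C * s / 2 + 2 * C / kap by field; rewrite gt_eqF.
  by rewrite lerD2r; lra.
have E5 : (g (x + s *: u) - g x) / s - e / 4 <= (phi h (z h + s *: u) - phi h (z h)) / s.
  rewrite -[e / 4](mulfK (lt0r_neq0 s0)) -mulrBl ler_pM2r ?invr_gt0//.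
  move: v1 v0; rewrite !addr0 !ler_norml => /andP[? ?] /andP[? ?]; lra.
have := Hr s; rewrite s0 sr => /(_ isT) E6; rewrite -/u in E6.
lra.
Unshelve. all: by end_near. Qed.

(** A central difference is the mean of a forward and a backward quotient, and the latter is a
    forward quotient based at [z h - step h k]; this is why [forward_slope_ge] admits moving base
    points. Upper bounds come from the opposite direction, by linearity of the differential. *)
Lemma gradh_near (z : R -> 'rV[R]_d) (x : 'rV[R]_d) (e : R) : z h @[h --> 0^'+] --> x ->
  differentiable g x -> 0 < e ->
  \forall h \near 0^'+, enorm (gradh h (phi h) (z h) - grad g x) <= d%:R * e.
Proof.
move=> zx gx e0.
have fwd k y : (forall h, 0 < h -> enorm (y h - z h) <= h) -> \forall h \near 0^'+,
    'D_(step 1 k) g x - e <= (phi h (y h + step h k) - phi h (y h)) / h.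
  move=> yz; apply: forward_slope_ge => //; last exact: diff_derivable.
  apply/cvgrPdist_le => r r0.
  have r2 : 0 < r / 2 by rewrite divr_gt0.
  have H := zx _ (near_enorm x r2).
  near=> h.
  have hp : 0 < h by [].
  have hr : h < r / 2 by near: h; exact: nbhs_right_lt.
  have H1 : enorm (z h - x) < r / 2 by near: h.
  have H2 := yz h hp.
  rewrite distrC; apply: le_trans (norm_le_enorm _) _.
  have -> : y h - x = (y h - z h) + (z h - x) by rewrite addrA subrK.
  by apply: le_trans (enormD _ _) _; lra.
have est h k : 0 < h -> enorm (step h k : 'rV[R]_d) <= h.
  by move=> h0; rewrite stepE enormZ enorm_step1 mulr1 gtr0_norm.
have Hall : \forall h \near 0^'+, forall k : 'I_d * bool,
    'D_(step 1 k) g x - e <= (phi h (z h + step h k) - phi h (z h)) / h /\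
    'D_(step 1 k) g x - e <= (phi h (z h) - phi h (z h - step h k)) / h.
  apply: filter_forall => k.
  have F1 := fwd k z; have F2 := fwd k (fun h => z h - step h k).
  near=> h; split.
    near: h; apply: F1 => h h0; rewrite subrr enorm0; exact: ltW.
  have := subrK (step h k) (z h) => E; rewrite -{1}E.
  near: h; apply: F2 => h h0; rewrite addrAC subrr add0r enormN; exact: est.
near=> h.
have h0 : 0 < h by [].
have H : forall k : 'I_d * bool,
    'D_(step 1 k) g x - e <= (phi h (z h + step h k) - phi h (z h)) / h /\
    'D_(step 1 k) g x - e <= (phi h (z h) - phi h (z h - step h k)) / h by near: h.
apply: enorm_le_bound => i; rewrite !mxE /partial.
have sT b : step b (i, true) = b *: evec R i by rewrite /step /= mul1r.
have sF b : step b (i, false) = - (b *: evec R i) by rewrite /step /= mulN1r scaleNr.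
have [p1 p2] := H (i, true); have [m1 m2] := H (i, false).
rewrite !sT scale1r in p1 p2; rewrite !sF scale1r opprK in m1 m2.
have DN : 'D_(- evec R i) g x = - 'D_(evec R i) g x.
  by rewrite !deriveE// linearN.
rewrite DN in m1 m2.
set Y := phi h (z h + _) in p1 m2 *; set Z := phi h (z h - _) in p2 m1 *.
have -> : (Y - Z) / (2 * h) = ((Y - phi h (z h)) / h + (phi h (z h) - Z) / h) / 2.
  by field; rewrite gt_eqF.
have E1 : (Z - phi h (z h)) / h = - ((phi h (z h) - Z) / h) by rewrite -mulNr opprB.
have E2 : (phi h (z h) - Y) / h = - ((Y - phi h (z h)) / h) by rewrite -mulNr opprB.
rewrite E1 in m1; rewrite E2 in m2.
by rewrite ler_norml; apply/andP; split; lra.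
Unshelve. all: by end_near. Qed.

End GradientLimit.

(** One integer [n] fixes the strength of the kink, the range of scales and the size of the cube, so
    that the exceptional set is a countable union of sets handled by [kinks_null]. *)
Lemma semiconcave_ae_differentiable (R : realType) (d : nat) (g : 'rV[R]_d.+1 -> R) (L C : R) :
  0 <= L -> 0 <= C ->
  (forall x y, `|g x - g y| <= L * enorm (x - y)) ->
  (forall x y, g (x + y) + g (x - y) - 2 * g x <= C * enorm y ^+ 2) ->
  exists E : set 'rV[R]_d.+1, lebesgue_null E /\ forall x, ~ E x -> differentiable g x.
Proof.
move=> L0 C0 lip sc.
pose F (p : 'I_d.+1 * nat) (x : 'rV[R]_d.+1) := kinks g p.1 p.2.+1%:R^-1 p.2.+1%:R^-1 x /\
  forall j, - p.2.+1%:R <= x 0 j <= - p.2.+1%:R + 2 * p.2.+1%:R.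
exists (fun x => exists p, F p x); split.
  apply: lebesgue_null_bigcup => -[i n].
  by apply: (kinks_null i (- n.+1%:R) L0 C0 _ _ _ lip sc); rewrite ?invr_gt0 ?mulr_gt0.
move=> x xE; apply: (semiconcave_differentiable L0 C0 lip sc) => i e s0 e0 s00.
apply: contrapT => H; apply: xE.
pose B := enorm x + e^-1 + s0^-1.
have B0 : 0 <= B by rewrite !addr_ge0 ?enorm_ge0 ?invr_ge0 ?ltW.
pose n := Num.bound B; have nB : B < n.+1%:R.
  by apply: lt_le_trans (archi_boundP B0) _; rewrite ler_nat leqnSn.
have [xn en sn] : [/\ enorm x <= n.+1%:R, n.+1%:R^-1 <= e & n.+1%:R^-1 <= s0].
  have ei : 0 < e^-1 by rewrite invr_gt0.
  have si : 0 < s0^-1 by rewrite invr_gt0.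
  have x0 := enorm_ge0 x.
  move: nB; rewrite /B => nB; split; first by lra.
    by rewrite -[e]invrK lef_pV2 ?posrE//; lra.
  by rewrite -[s0]invrK lef_pV2 ?posrE//; lra.
exists (i, n); split => /= [s /andP[sp ss]|j].
  rewrite leNgt; apply/negP => Hlt; apply: H; exists s.
    by rewrite sp (lt_le_trans ss sn).
  by apply: le_lt_trans Hlt; rewrite lerN2; apply: ler_wpM2r => //; exact: ltW.
have := le_trans (enorm_coord x j) xn; rewrite ler_norml => /andP[h1 h2].
by apply/andP; split; lra.
Qed.

(** * Passage to the value function and to the policy *)

Section ValueFunction.
Variables (R : realType) (d m : nat) (T N M L K : R) (A : set 'rV[R]_m).
Variables (c : R -> 'rV[R]_d -> 'rV[R]_m -> R) (f : R -> 'rV[R]_d -> 'rV[R]_m -> 'rV[R]_d).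
Variables (q : 'rV[R]_d -> R) (alpha : R -> 'rV[R]_d -> 'rV[R]_d -> 'rV[R]_m).
Variables (vh : R -> R -> 'rV[R]_d -> R) (v : R -> 'rV[R]_d -> R).
Hypothesis argmin : is_unique_argmin T A c f alpha.
Hypothesis A1 : assumption_A1 T A c f q.
Hypothesis NF : Num.max 1 (supnorm_f T A f / 2) <= N.
Hypothesis T0 : 0 < T.
Hypothesis vhS : forall h, 0 < h < 1 -> semidiscrete_solution T N h A c f q (vh h).
Hypothesis vS : viscosity_solution T A c f q v.
Hypothesis sol : forall h, 0 < h < 1 ->
  scheme_solution T N h M L K q (vh h) (fun t x => 'D_1 (fun s => vh h s x) t).

(** An admissible [h], from which the signs of the constants, themselves independent of [h], are
    read off. *)
Let half : 0 < (2^-1 : R) < 1.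
Proof. by rewrite invr_gt0 ltr0n invf_lt1// ltr1n. Qed.

Lemma sc_const_ge0 : 0 <= sc_const d T L K.
Proof.
have L0 := sol_L (sol half); have K0 := sol_K (sol half).
by rewrite /sc_const mulr_ge0 ?mulr_ge0 ?expR_ge0 ?addr_ge0.
Qed.

Lemma axis_const_ge0 : 0 <= axis_const d T L K.
Proof.
have L0 := sol_L (sol half); have K0 := sol_K (sol half).
have G0 := lip_step_ge0 (sol half).
rewrite /axis_const mulr_ge0 ?expR_ge0//.
by rewrite !(addr_ge0, mulr_ge0, exprn_ge0, sqr_ge0).
Qed.

(** Moving times are harmless because the Lipschitz constant in time is uniform in [h]. *)
Lemma semidiscrete_cvg (th : R -> R) (t : R) x :
  (forall h, 0 < h < 1 -> 0 <= th h <= T) -> th h @[h --> 0^'+] --> t -> 0 <= t <= T ->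
  vh h (th h) x @[h --> 0^'+] --> v t x.
Proof.
move=> thT tht tT.
have Lt0 := lip_time_ge0 (sol half); set Lt := lip_time _ _ _ _ _ in Lt0.
have Lt1 : 0 < Lt + 1 by rewrite ltr_wpDl.
apply/cvgrPdist_le => e e0.
have e2 : 0 < e / 2 by rewrite divr_gt0.
have e3 : 0 < e / 2 / (Lt + 1) by rewrite divr_gt0.
have [h0 h00 Hh] := semidiscrete_converges argmin A1 NF T0 vhS vS sol x tT e2.
have /cvgrPdist_le/(_ _ e3) H1 := tht.
near=> h.
have hI : 0 < h < 1 by near: h; exact: near_scale.
have [hp h1] := andP hI.
have H2 : `|t - th h| <= e / 2 / (Lt + 1) by near: h.
have hh0 : h < h0 by near: h; exact: nbhs_right_lt.
have := Hh h; rewrite hp hh0 h1 => /(_ isT isT) H3.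
have := scheme_lip_time (sol hI) x tT (thT h hI); rewrite -/Lt => H4.
have H5 : Lt * `|t - th h| <= e / 2.
  rewrite ler_pdivlMr// in H2; have := normr_ge0 (t - th h); lra.
rewrite distrC; have -> : vh h (th h) x - v t x = - (vh h t x - vh h (th h) x) + (vh h t x - v t x).
  by ring.
apply: le_trans (ler_normD _ _) _; rewrite normrN; lra.
Unshelve. all: by end_near. Qed.

Let fixed_cvg (t : R) x : 0 <= t <= T -> vh h t x @[h --> 0^'+] --> v t x.
Proof. by move=> tT; apply: semidiscrete_cvg => //; exact: cvg_cst. Qed.

Lemma value_lip (t : R) (x y : 'rV[R]_d) : 0 <= t <= T ->
  `|v t x - v t y| <= lip_space d T L * enorm (x - y).
Proof.
move=> tT.
have cv : `|vh h t x - vh h t y| @[h --> 0^'+] --> `|v t x - v t y|.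
  by apply: cvg_norm; apply: cvgB; exact: fixed_cvg.
apply: (cvgr_to_le cv); near=> h.
have hI : 0 < h < 1 by near: h; exact: near_scale.
exact: (scheme_lip (sol hI)).
Unshelve. all: by end_near. Qed.

(** For a fixed nonzero [y], both the restriction [h <= enorm y] and the term [sqrt (h * enorm y)]
    disappear in the limit. *)
Lemma value_second_difference (t : R) (x y : 'rV[R]_d) : 0 <= t <= T ->
  v t (x + y) + v t (x - y) - 2 * v t x <= sc_const d T L K * enorm y ^+ 2.
Proof.
move=> tT; have C0 := sc_const_ge0; set C := sc_const _ _ _ _ in C0 *.
have [y0|yn0] := eqVneq (enorm y) 0.
  rewrite (enorm0_eq0 y0) enorm0 expr0n/= addr0 subr0 mulr0 le_eqVlt; apply/orP; left; apply/eqP.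
  by ring.
have yp : 0 < enorm y by rewrite lt_neqAle eq_sym yn0 enorm_ge0.
apply/ler_addgt0Pr => e e0.
have C1 : 0 < C + 1 by rewrite ltr_wpDl.
pose e1 := e / (C + 1); have e10 : 0 < e1 by rewrite divr_gt0.
have cv : vh h t (x + y) + vh h t (x - y) - 2 * vh h t x @[h --> 0^'+] -->
    v t (x + y) + v t (x - y) - 2 * v t x.
  apply: cvgB; first by apply: cvgD; exact: fixed_cvg.
  by apply: cvgM; [exact: cvg_cst|exact: fixed_cvg].
apply: (cvgr_to_le cv); near=> h.
have hI : 0 < h < 1 by near: h; exact: near_scale.
have /andP[h0 _] := hI.
have hy : h < enorm y by near: h; exact: nbhs_right_lt.
have hs : h < e1 ^+ 2 / enorm y by near: h; apply: nbhs_right_lt; rewrite divr_gt0 ?exprn_gt0.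
apply: (le_trans (scheme_second_difference x (sol hI) tT (ltW hy))); rewrite -/C.
have sq : Num.sqrt (h * enorm y) <= e1.
  rewrite -[e1]gtr0_norm// -sqrtr_sqr ler_sqrt ?sqr_ge0//.
  by rewrite -ler_pdivlMr// ltW.
rewrite mulrDr lerD2l.
have : (C + 1) * e1 = e by rewrite mulrC /e1 divfK// gt_eqF.
have : C * Num.sqrt (h * enorm y) <= C * e1 by exact: ler_wpM2l.
by lra.
Unshelve. all: by end_near. Qed.

Lemma value_semiconcave (t : R) : 0 <= t <= T -> semiconcave (v t).
Proof.
move=> tT; exists (sc_const d T L K + 1); split; first by rewrite ltr_wpDl// sc_const_ge0.
move=> x y; apply: (le_trans (value_second_difference x y tT)).
by rewrite mulrDl lerDl mul1r sqr_ge0.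
Qed.

Lemma semidiscrete_gradient (th : R -> R) (xh : R -> 'rV[R]_d) (t : R) (x : 'rV[R]_d) (e : R) :
  0 <= t <= T -> (forall h, 0 < h < 1 -> 0 <= th h <= T) ->
  th h @[h --> 0^'+] --> t -> xh h @[h --> 0^'+] --> x ->
  differentiable (v t) x -> 0 < e ->
  \forall h \near 0^'+, enorm (gradh h (vh h (th h)) (xh h) - grad (v t) x) <= d%:R * e.
Proof.
move=> tT thT tht xhx vx e0.
apply: (@gradh_near R d (fun h => vh h (th h)) (v t) (lip_space d T L) (sc_const d T L K)
  (axis_const d T L K)) => //.
- exact: lip_space_ge0 (sol half).
- exact: sc_const_ge0.
- exact: axis_const_ge0.
- by move=> h hI y z; apply: (scheme_lip (sol hI)); exact: thT.
- by move=> h hI y z hz; apply: (scheme_second_difference _ (sol hI)) => //; exact: thT.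
- by move=> h hI y k; apply: (scheme_axis_second_difference (sol hI)); exact: thT.
- by move=> y; exact: semidiscrete_cvg.
Qed.

Lemma semidiscrete_policy (alpha0 : R -> 'rV[R]_d -> 'rV[R]_m)
    (th : R -> R) (xh : R -> 'rV[R]_d) (t : R) (x : 'rV[R]_d) :
  assumption_A2 T A alpha alpha0 ->
  0 <= t <= T -> (forall h, 0 < h < 1 -> 0 <= th h <= T) ->
  th h @[h --> 0^'+] --> t -> xh h @[h --> 0^'+] --> x ->
  differentiable (v t) x ->
  alpha (th h) (xh h) (gradh h (vh h (th h)) (xh h)) @[h --> 0^'+] --> alpha t x (grad (v t) x).
Proof.
move=> [La [alip _]] tT thT tht xhx vx; apply/cvgrPdist_le => e e0.
pose B : R := (`|La| + 1) * (2 + d%:R); have B0 : 0 < B.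
  by apply: mulr_gt0; [rewrite ltr_wpDl|rewrite ltr_wpDr].
have eB : 0 < e / B by rewrite divr_gt0.
have G := semidiscrete_gradient tT thT tht xhx vx eB.
have /cvgrPdist_le/(_ _ eB) H1 := tht.
have H2 := xhx _ (near_enorm x eB).
near=> h.
have hI : 0 < h < 1 by near: h; exact: near_scale.
have g1 : enorm (gradh h (vh h (th h)) (xh h) - grad (v t) x) <= d%:R * (e / B) by near: h.
have g2 : `|t - th h| <= e / B by near: h.
have g3 : enorm (xh h - x) < e / B by near: h.
rewrite distrC; apply: le_trans (norm_le_enorm _) _.
apply: (le_trans (alip _ _ _ _ _ _ (thT h hI) tT)).
set S : R := _ + _ + _.
have S0 : 0 <= S by rewrite /S !addr_ge0 ?enorm_ge0.
apply: (@le_trans _ _ ((`|La| + 1) * S)).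
  by apply: ler_wpM2r => //; apply: (le_trans (ler_norm _)); rewrite lerDl.
have -> : e = (`|La| + 1) * ((2 + d%:R) * (e / B)).
  by rewrite [RHS]mulrA -/B [RHS]mulrC divfK// gt_eqF.
apply: ler_wpM2l; first by rewrite addr_ge0.
by rewrite /S distrC; lra.
Unshelve. all: by end_near. Qed.

End ValueFunction.

Theorem theorem3p6 (R : realType) (d m : nat) (T N : R) (A : set 'rV[R]_m)
  (c : R -> 'rV[R]_d -> 'rV[R]_m -> R) (f : R -> 'rV[R]_d -> 'rV[R]_m -> 'rV[R]_d)
  (q : 'rV[R]_d -> R)
  (alpha : R -> 'rV[R]_d -> 'rV[R]_d -> 'rV[R]_m)
  (alpha0 : R -> 'rV[R]_d -> 'rV[R]_m)
  (vh : R -> R -> 'rV[R]_d -> R) (v : R -> 'rV[R]_d -> R) :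
  (1 <= d)%N -> (1 <= m)%N -> 1 <= T -> compact A ->
  is_unique_argmin T A c f alpha ->
  assumption_A1 T A c f q ->
  assumption_A2 T A alpha alpha0 ->
  assumption_A3 T A c f q ->
  Num.max 1 (supnorm_f T A f / 2) <= N ->
  (forall h, 0 < h < 1 -> semidiscrete_solution T N h A c f q (vh h)) ->
  viscosity_solution T A c f q v ->
  (forall t, 0 <= t <= T -> semiconcave (v t)) /\
  (forall t, 0 <= t <= T ->
     exists E : set 'rV[R]_d, lebesgue_null E /\
       forall x, ~ E x ->
         differentiable (v t) x /\
         forall (th : R -> R) (xh : R -> 'rV[R]_d),
           (forall h, 0 < h < 1 -> 0 <= th h <= T) ->
           th h @[h --> 0^'+] --> t ->
           xh h @[h --> 0^'+] --> x ->
           alpha (th h) (xh h) (gradh h (vh h (th h)) (xh h)) @[h --> 0^'+]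
             --> alpha t x (grad (v t) x)).
Proof.
(* The null set results are stated in dimension [d.+1]. *)
case: d c f q alpha alpha0 vh v => [|d] c f q alpha alpha0 vh v // _ _ T1 _ argmin A1 A2 A3 NF vhS vS.
have T0 : 0 < T by apply: lt_le_trans T1.
have [M [L [K [M0 L0 K0 cb [qL qK]]]]] := exists_scheme_constants A1 A3 NF.
have sol h : 0 < h < 1 ->
    scheme_solution T N h M L K q (vh h) (fun t x => 'D_1 (fun s => vh h s x) t).
  by move=> hI; apply: (semidiscrete_scheme_solution argmin NF) => //; exact: vhS.
split=> [t tT|t tT]; first exact: (value_semiconcave argmin A1 NF T0 vhS vS sol).
have half : 0 < (2^-1 : R) < 1 by rewrite invr_gt0 ltr0n invf_lt1// ltr1n.
have [E [E0 Ed]] := semiconcave_ae_differentiable (lip_space_ge0 (sol _ half)) (sc_const_ge0 sol)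
  (fun x y => value_lip argmin A1 NF T0 vhS vS sol x y tT)
  (fun x y => value_second_difference argmin A1 NF T0 vhS vS sol x y tT).
exists E; split=> // x xE; split; first exact: Ed.
move=> th xh thT tht xhx.
exact: (semidiscrete_policy argmin A1 NF T0 vhS vS sol A2 tT thT tht xhx (Ed x xE)).
Qed.
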